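(* Let $\nu>0$ and $a>0$. (i) For any $0\le b\le a$, $$\lim_{t\to\infty}t^{\nu}\,P^{(\nu)}_a(I_t-I_\infty>b)=\frac{2\nu}{2^{\nu}a^{2\nu}\Gamma(\nu+1)}\int_b^a z^{2\nu-1}(z-b)^{2\nu}\,dz.$$ In particular, $$\lim_{t\to\infty}t^{\nu}\,P^{(\nu)}_a(\rho_\infty>t)=\frac{a^{2\nu}}{2^{\nu+1}\Gamma(\nu+1)}.$$ (ii) For any continuous function $g:\mathbb{R}\to\mathbb{R}$, $$\lim_{t\to\infty}t^{\nu}\Big\{E^{(\nu)}_a[g(I_\infty)]-E^{(\nu)}_a[g(I_t)]\Big\}=\frac{2\nu}{2^{\nu}a^{2\nu}\Gamma(\nu+1)}\int_0^a (a^{2\nu}-2z^{2\nu})z^{2\nu-1}g(z)\,dz.$$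
   Context: For $\mu\in\mathbb{R}$ and $x>0$, $P^{(\mu)}_x$ denotes the law on $\Omega=C([0,\infty);\mathbb{R})$ of the Bessel process with index $\mu$ (dimension $2(\mu+1)$) started at $x$, and $E^{(\mu)}_x$ the corresponding expectation; $R$ is the coordinate process on $\Omega$. For $t\ge0$, $I_t=\inf_{0\le s\le t}R_s$, and $I_\infty=\inf_{t\ge0}R_t$. Set $\rho_\infty=\inf\{t\ge0: R_t=I_\infty\}$. $\Gamma$ is the gamma function. *)

(* Defs.v *)
From HB Require Import structures.
From mathcomp Require Import all_boot all_order all_algebra.
From mathcomp Require Import all_classical all_reals all_analysis.
Set Implicit Arguments. Unset Strict Implicit. Unset Printing Implicit Defensive.
Import Order.TTheory GRing.Theory Num.Theory.
Import numFieldNormedType.Exports.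
Local Open Scope classical_set_scope.
Local Open Scope ring_scope.

Section Defs.
Variable R : realType.

Definition Gamma (s : R) : R :=
  Rintegral lebesgue_measure `]0, +oo[%classic (fun x => x `^ (s - 1) * expR (- x)).

Definition besselI (nu z : R) : R :=
  limn (series (fun k : nat =>
    (z / 2) `^ (2 * k%:R + nu) / (k`!%:R * Gamma (k%:R + nu + 1)))).

Definition bessel_density (nu t x y : R) : R :=
  if (0 < y) then
    (y / t) * (y / x) `^ nu * expR (- (x ^+ 2 + y ^+ 2) / (2 * t)) * besselI nu (x * y / t)
  else 0.

(* Finite-dimensional distributions of the Bessel process started at x:
   for l = [:: (dt1, A1); ...; (dtn, An)], the probability that
   R_{dt1} \in A1, R_{dt1+dt2} \in A2, ..., R_{dt1+...+dtn} \in An. *)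
Fixpoint bessel_fdd (nu x : R) (l : seq (R * set R)) : \bar R :=
  match l with
  | [::] => 1%E
  | (dt, A) :: l' =>
      (\int[lebesgue_measure]_(y in A) ((bessel_density nu dt x y)%:E * bessel_fdd nu y l'))%E
  end.

Fixpoint cum_times (t0 : R) (l : seq (R * set R)) : seq (R * set R) :=
  match l with
  | [::] => [::]
  | (dt, A) :: l' => (t0 + dt, A) :: cum_times (t0 + dt) l'
  end.

Definition is_bessel_process d (T : measurableType d) (P : probability T R)
    (nu x : R) (X : R -> T -> R) : Prop :=
  [/\ (forall w, X 0 w = x),
      (forall w, {within `[0, +oo[%classic, continuous (fun s => X s w)}),
      (forall t, measurable_fun setT (X t)) &
      (forall l : seq (R * set R),
          all (fun p => 0 < p.1) l -> (forall p, p \in l -> measurable p.2) ->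
          P [set w | all (fun q => `[< q.2 (X q.1 w) >]) (cum_times 0 l)]
          = bessel_fdd nu x l)].

End Defs.

Section Infima.
Variables (R : realType) (T : Type) (X : R -> T -> R).
Definition run_inf (t : R) (w : T) : R := inf [set X s w | s in `[0, t]%classic].
Definition glob_inf (w : T) : R := inf [set X s w | s in `[0, +oo[%classic].
Definition argmin_time (w : T) : R :=
  inf [set t | 0 <= t /\ X t w = glob_inf w].
End Infima.

(* Main.v *)
(** The function x^(-2 nu) is the scale function of the process (it is harmonic
    away from 0), and its image under the semigroup at time t is explicit: it is
    x^(-2 nu) up to an error O(t^2) locally uniformly in x > 0 as t -> 0, and it
    is asymptotic to c t^(-nu), with c = 1 / (2^nu Gamma(nu + 1)), as t -> oo.
    The maximal inequality for the supermartingale X^(-2 nu) and its converse for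
    a level that can only be crossed continuously, both along dyadic grids, show
    that for an event E of the past of t, contained in X_t >= y,
      P(E, X goes below y after t) = y^(2 nu) E[X_t^(-2 nu); E].
    With E = {I_t >= z} the right-hand expectation, times t^nu, tends to
    c (1 - (z/a)^(2 nu)).  Cutting the range of I_t into small cells turns
    t^nu P(I_t - I_oo > b) into a Stieltjes sum for the first limit; up to a null
    event, rho_oo > t is the case b = 0.  Replacing g by a step function,
    E g(I_oo) - E g(I_t) is minus the sum over the jumps z of g of
    jump(z) * P(I_oo < z <= I_t), and summation by parts gives the last limit. *)

Require Import Defs.
From HB Require Import structures.
From mathcomp Require Import all_boot all_order all_algebra.
From mathcomp Require Import all_classical all_reals all_analysis.
From mathcomp Require Import measurable_realfun ring lra.
Set Implicit Arguments. Unset Strict Implicit. Unset Printing Implicit Defensive.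
Import Order.TTheory GRing.Theory Num.Theory.
Import numFieldNormedType.Exports.
Local Open Scope classical_set_scope.
Local Open Scope ring_scope.

(** * Incomplete gamma functions *)

Section IncompleteGamma.
Variable R : realType.
Implicit Types s b u w : R.
Notation mu := (@lebesgue_measure R).

(** No stopping time, strong Markov property or law of a hitting time occurs: only the
    finite-dimensional laws and the continuity of paths are given, so everything is read off
    deterministic grids. Turning the supermartingale inequality into an equality costs one error per
    grid step; there are [2 ^ m] steps of length [tau / 2 ^ m], so errors quadratic in the step
    disappear in the limit, where linear ones would stay. The part unspent at time [t + tau] decays
    like [tau ^ (- nu)]. The limit [c (1 - (z / a) ^ (2 nu))] is [c P(I_oo >= z)]: the mean of
    [X_t ^ (- 2 nu)] is equivalent to [c t ^ (- nu)] from every positive starting point, so that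
    only the probability of survival is remembered. The delicate half is the lower bound, where
    paths that go below [z] late must be shown to carry little of this mean. Paths are real-valued:
    on a null event they may be negative or unbounded below, and the infimum of an empty set or of
    one unbounded below is [0]. Inclusions and measurability have to take these defaults into
    account. *)

Definition gamma_kernel s u := u `^ s * expR (- u).

(* The parameter is shifted by one: this is usually written gamma(s + 1, b). *)
Definition lower_gamma s b := Rintegral mu `[0, b] (gamma_kernel s).

Lemma gamma_kernel_ge0 s u : 0 <= gamma_kernel s u.
Proof. by rewrite mulr_ge0 ?powR_ge0 ?expR_ge0. Qed.

Lemma measurable_gamma_kernel s (D : set R) : measurable_fun D (gamma_kernel s).
Proof.
apply: measurable_funTS; apply: measurable_funM; first exact: measurable_powR.
apply: measurableT_comp; first exact: measurable_expR.
exact: oppr_measurable.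
Qed.

Lemma continuous_gamma_kernel s u : 0 < u -> {for u, continuous (gamma_kernel s)}.
Proof.
move=> u0.
have cp : {for u, continuous (fun x => x `^ s)}.
  apply/differentiable_continuous/derivable1_diffP.
  by apply: derivable_powR; rewrite in_itv/= andbT.
apply: cvgM; first exact: cp.
apply: (@continuous_comp _ _ _ (fun x => - x) expR).
  exact: opp_continuous.
exact: continuous_expR.
Qed.

Lemma cvg_gamma_kernel_right0 s : 0 < s ->
  gamma_kernel s x @[x --> 0^'+] --> gamma_kernel s 0.
Proof.
move=> s0; rewrite /gamma_kernel powR0 ?gt_eqF// mul0r.
rewrite -[X in _ --> X](mul0r (expR (- 0))); apply: cvgM; first exact: powR_cvg0.
apply: cvg_at_right_filter.
apply: (@continuous_comp _ _ _ (fun x => - x) expR).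
  exact: opp_continuous.
exact: continuous_expR.
Qed.

Lemma within_continuous_gamma_kernel s b : 0 < s ->
  {within `[0, b], continuous (gamma_kernel s)}.
Proof.
move=> s0; case: (ltrP 0 b) => [b0|]; last first.
  rewrite le_eqVlt => /predU1P[->|b0].
    by rewrite set_itv1; exact: continuous_subspace1.
  by rewrite set_itv_ge ?bnd_simp -?ltNge//; exact: continuous_subspace0.
apply/continuous_within_itvP => //; split.
- by move=> x; rewrite in_itv/= => /andP[x0 _]; exact: continuous_gamma_kernel.
- exact: cvg_gamma_kernel_right0.
- by apply: cvg_at_left_filter; exact: continuous_gamma_kernel.
Qed.

Lemma integrable_gamma_kernel s b : 0 < s ->
  mu.-integrable `[0, b] (EFin \o gamma_kernel s).
Proof.
move=> s0; apply: continuous_compact_integrable; first exact: segment_compact.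
exact: within_continuous_gamma_kernel.
Qed.

Lemma is_derive_gamma_kernel s u : 0 < u ->
  is_derive u 1 (gamma_kernel s) (s * gamma_kernel (s - 1) u - gamma_kernel s u).
Proof.
move=> u0.
have dp := @is_derive1_powR _ s u u0.
have dN : is_derive u 1 (fun x : R => - x) (-1) by apply: is_deriveNid.
have de := @is_derive1_comp R (fun x => expR x) (fun x => - x) u _ _ (is_derive_expR (- u)) dN.
have dpe : is_derive u 1 (gamma_kernel s) _ := @is_deriveM _ _ _ _ _ _ _ _ dp de.
apply: is_derive_eq; rewrite /gamma_kernel /GRing.scale/=; ring.
Qed.

(** Integration by parts, as the fundamental theorem for [gamma_kernel s]. With [1 < s] the exponent
    [s - 1] in the derivative is positive, so the derivative is continuous up to [0]. *)
Lemma lower_gammaD1 s b : 1 < s -> 0 <= b ->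
  lower_gamma s b = s * lower_gamma (s - 1) b - gamma_kernel s b.
Proof.
move=> s1; rewrite le_eqVlt => /predU1P[<-|b0].
  rewrite /lower_gamma set_itv1 !Rintegral_set1 /gamma_kernel powR0 ?mul0r ?mulr0 ?subr0//.
  by rewrite gt_eqF// (lt_trans _ s1).
have s0 : 0 < s by exact: lt_trans s1.
have s10 : 0 < s - 1 by rewrite subr_gt0.
pose f u := s * gamma_kernel (s - 1) u - gamma_kernel s u.
have i1 := integrable_gamma_kernel b s0.
have i2 := integrable_gamma_kernel b s10.
have i3 : mu.-integrable `[0, b] (EFin \o (fun u => s * gamma_kernel (s - 1) u)).
  apply: eq_integrable (integrableZl _ s i2) => //.
have : Rintegral mu `[0, b] f = gamma_kernel s b - gamma_kernel s 0.
  rewrite /Rintegral (@continuous_FTC2 _ _ (gamma_kernel s))//.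
  - move=> x.
    apply: cvgB; last exact: within_continuous_gamma_kernel.
    by apply: cvgM; [exact: cvg_cst|exact: within_continuous_gamma_kernel].
  - split.
    + move=> x; rewrite in_itv/= => /andP[x0 _].
      by have [] := is_derive_gamma_kernel s x0.
    + exact: cvg_gamma_kernel_right0.
    + by apply: cvg_at_left_filter; exact: continuous_gamma_kernel.
  - move=> x; rewrite in_itv/= => /andP[x0 _]; rewrite derive1E.
    by have [_ ->] := is_derive_gamma_kernel s x0.
rewrite /f RintegralB// RintegralZl//.
rewrite -/(lower_gamma s b) -/(lower_gamma (s - 1) b) /=.
rewrite [gamma_kernel s 0]/gamma_kernel powR0 ?gt_eqF// mul0r subr0.
by move=> <-; rewrite opprB addrC subrK.
Qed.

Lemma gamma_kernel_exp_bound s : 0 < s ->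
  exists2 C, 0 < C & forall u, 0 <= u -> gamma_kernel s u <= C * expR (- (u / 2)).
Proof.
move=> s0; pose n := (Num.truncn s).+1.
have sn : s <= n%:R by rewrite ltW// truncnS_gt.
(* Half of the exponent absorbs the power: [(u / 2) ^ n / n! <= exp (u / 2)] with [n >= s]. For
   [u <= 1] it is enough that the constant is at least [1]. *)
exists (2 ^+ n * n`!%:R); first by rewrite mulr_gt0 ?exprn_gt0 ?ltr0n ?fact_gt0.
move=> u u0; rewrite /gamma_kernel.
have -> : expR (- u) = expR (- (u / 2)) * expR (- (u / 2)) by rewrite -expRD; congr expR; field.
rewrite mulrA ler_pM2r ?expR_gt0// expRN ler_pdivrMr ?expR_gt0//.
have C1 : 1 <= 2 ^+ n * n`!%:R :> R.
  by rewrite -[leLHS]mulr1 ler_pM// ?ler1n ?fact_gt0// exprn_ege1// ler1n.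
have [u1|u1] := leP u 1.
  have ex1 : 1 <= expR (u / 2) by rewrite -expR0 ler_expR divr_ge0.
  have us1 : u `^ s <= 1.
    by have := ge0_ler_powR (ltW s0) u0 ler01 u1; rewrite powR1.
  by apply: (le_trans us1); rewrite -[leLHS]mulr1 ler_pM.
apply: (@le_trans _ _ (u ^+ n)).
  by rewrite -powR_mulrn//; apply: ler_powR => //; exact: ltW.
have := expR_ge1Dxn (Num.truncn s) (divr_ge0 u0 (ler0n R 2)).
rewrite -/n expr_div_n => h.
have {h} h : u ^+ n / 2 ^+ n / n`!%:R <= expR (u / 2).
  by apply: le_trans h; rewrite lerDr.
rewrite -(@ler_pdivrMl _ (2 ^+ n * n`!%:R)) ?mulr_gt0 ?exprn_gt0 ?ltr0n ?fact_gt0//.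
by apply: le_trans h; rewrite invfM; lra.
Qed.

Lemma cvg_expR_half : expR (- (x / 2)) @[x --> +oo] --> (0 : R).
Proof.
apply: (@cvg_comp _ _ _ (fun x : R => x / 2) (fun x => expR (- x)) _ (@pinfty_nbhs R)).
  by apply: gt0_cvgMly => //; exact: cvg_id.
exact: cvgr_expR.
Qed.

Lemma integral_expR_half :
  (\int[mu]_(u in `[0%R, +oo[) (expR (- (u / 2)))%:E = 2%:E)%E.
Proof.
pose F (u : R) := - 2 * expR (- (u / 2)).
have dF (x : R) : is_derive x 1 F (expR (- (x / 2))).
  have dN : is_derive x 1 (fun x : R => - (x / 2)) (- 2^-1 * 1).
    have -> : (fun x : R => - (x / 2)) = (fun x => - 2^-1 * x).
      by apply/funext => y; rewrite mulrC mulNr.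
    exact: (@is_deriveZ _ _ _ (@id R) (- 2^-1) x 1 1 (is_derive_id _ _)).
  have de := @is_derive1_comp R (fun x => expR x) (fun x => - (x / 2)) x _ _ (is_derive_expR _) dN.
  have dF : is_derive x 1 F _ := @is_deriveZ _ _ _ _ (- 2) x 1 _ de.
  by apply: is_derive_eq; rewrite /GRing.scale/=; field.
have cE (x : R) : {for x, continuous (fun x : R => expR (- (x / 2)))}.
  apply: (@continuous_comp R R R (fun x : R => - (x / 2)) expR x).
    by apply: cvgN; apply: cvgM; [exact: cvg_id|exact: cvg_cst].
  exact: continuous_expR.
rewrite (@ge0_continuous_FTC2y _ _ F 0 0).
- by rewrite /F mul0r oppr0 expR0 mulr1 -EFinB sub0r opprK.
- by move=> x _; exact: expR_ge0.
- by apply: continuous_subspaceT => x; exact: cE.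
- rewrite /F -[X in _ --> X](mulr0 (- 2)); apply: cvgM; first exact: cvg_cst.
  exact: cvg_expR_half.
- by move=> x _; have [] := dF x.
- apply: cvg_at_right_filter; rewrite /F; apply: cvgM; first exact: cvg_cst.
  exact: cE.
- by move=> x _; rewrite derive1E; have [_ ->] := dF x.
Qed.

Lemma integrable_gamma_kernely s : 0 < s ->
  mu.-integrable `[0, +oo[ (EFin \o gamma_kernel s).
Proof.
move=> s0; have [C C0 hC] := gamma_kernel_exp_bound s0.
have mexp : measurable_fun (`[0%R, +oo[%classic : set R) (fun u : R => (expR (- (u / 2)))%:E).
  apply/measurable_EFinP; apply: measurable_funTS.
  apply: measurableT_comp; first exact: measurable_expR.
  by apply: measurableT_comp => //; exact: mulrr_measurable.
apply/integrableP; split; first by apply/measurable_EFinP; exact: measurable_gamma_kernel.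
apply: (@le_lt_trans _ _ (\int[mu]_(u in `[0%R, +oo[) (C%:E * (expR (- (u / 2)))%:E))%E).
  apply: ge0_le_integral => //=.
  - by apply/measurable_EFinP/measurableT_comp => //; exact: measurable_gamma_kernel.
  - exact: measurable_funeM.
  - move=> u; rewrite in_itv/= andbT => u0; rewrite -EFinM lee_fin ger0_norm ?gamma_kernel_ge0//.
    exact: hC.
rewrite ge0_integralZl_EFin//; last exact: ltW.
by rewrite integral_expR_half -EFinM ltry.
Qed.

Lemma GammaE s : 0 < s ->
  Gamma (s + 1) = Rintegral mu `[0, +oo[ (gamma_kernel s).
Proof.
move=> s0; rewrite /Gamma addrK Rintegral_itv_obnd_cbnd//.
apply: integrableS (integrable_gamma_kernely s0) => //.
by apply: subset_itv; rewrite bnd_simp.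
Qed.

Lemma lower_gamma_ge0 s b : 0 <= lower_gamma s b.
Proof. by apply: Rintegral_ge0 => x _; exact: gamma_kernel_ge0. Qed.

Lemma lower_gamma_le s b : 0 < s -> lower_gamma s b <= Gamma (s + 1).
Proof.
move=> s0; rewrite GammaE//.
rewrite /lower_gamma /Rintegral fine_le//.
- exact: integrable_fin_num (integrable_gamma_kernel b s0).
- exact: integrable_fin_num (integrable_gamma_kernely s0).
- apply: ge0_subset_integral => //.
  + by apply/measurable_EFinP; exact: measurable_gamma_kernel.
  + by move=> x _; rewrite lee_fin gamma_kernel_ge0.
  + by apply: subset_itv; rewrite bnd_simp.
Qed.

Lemma cvg_lower_gamma s : 0 < s ->
  lower_gamma s n%:R @[n --> \oo] --> Gamma (s + 1).
Proof.
move=> s0; rewrite GammaE//; apply: fine_cvg.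
rewrite fineK; last exact: integrable_fin_num (integrable_gamma_kernely s0).
have -> : `[0%R, +oo[%classic = \bigcup_n `[0%R, n%:R]%classic :> set R.
  apply/seteqP; split=> x /=; rewrite in_itv/= andbT.
    by move=> x0; exists (Num.truncn x).+1 => //=; rewrite in_itv/= x0 ltW// truncnS_gt.
  by move=> [n _]/=; rewrite in_itv/= => /andP[].
apply: ge0_nondecreasing_set_cvg_integral => //.
- by move=> m n mn; apply/subsetPset; apply: subset_itvl; rewrite bnd_simp ler_nat.
- by move=> n; apply/measurable_EFinP; exact: measurable_gamma_kernel.
- by move=> n x _; rewrite lee_fin gamma_kernel_ge0.
Qed.

Lemma cvg_gamma_kernel s : 0 < s -> gamma_kernel s u @[u --> +oo] --> 0.
Proof.
move=> s0; have [C C0 hC] := gamma_kernel_exp_bound s0.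
apply: (@squeeze_cvgr _ _ _ _ (fun=> 0) (fun u => C * expR (- (u / 2)))).
- near=> u.
  have u0 : 0 <= u by near: u; apply: nbhs_pinfty_ge; exact: num_real.
  by rewrite gamma_kernel_ge0 hC.
- exact: cvg_cst.
- rewrite -[X in _ --> X](mulr0 C); apply: cvgM; first exact: cvg_cst.
  exact: cvg_expR_half.
Unshelve. all: end_near. Qed.

Lemma Gamma_gt0 s : 0 < s -> 0 < Gamma (s + 1).
Proof.
move=> s0; apply: lt_le_trans (lower_gamma_le 1 s0).
have s1 : 1 < s + 1 by rewrite ltrDr.
have := lower_gammaD1 s1 ler01; rewrite addrK => /eqP.
rewrite eq_sym subr_eq => /eqP e.
have : 0 < (s + 1) * lower_gamma s 1.
  rewrite e; apply: ltr_wpDl; first exact: lower_gamma_ge0.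
  by rewrite /gamma_kernel mulr_gt0 ?expR_gt0 ?powR_gt0.
by rewrite pmulr_rgt0// addr_gt0.
Qed.

Lemma GammaD1 s : 1 < s -> Gamma (s + 1) = s * Gamma s.
Proof.
move=> s1; have s0 : 0 < s by exact: lt_trans s1.
have s10 : 0 < s - 1 by rewrite subr_gt0.
have h : lower_gamma s n%:R @[n --> \oo] --> s * Gamma s - 0.
  under eq_fun do rewrite lower_gammaD1//.
  apply: cvgB; last exact: (cvg_comp _ _ (@cvgr_idn R) (cvg_gamma_kernel s0)).
  apply: cvgM; first exact: cvg_cst.
  by have := cvg_lower_gamma s10; rewrite subrK.
have := cvg_unique _ (cvg_lower_gamma s0) h.
by rewrite subr0; apply.
Qed.

Lemma lower_gammaB s w b : 0 < s -> 0 <= w -> w <= b ->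
  lower_gamma s b - lower_gamma s w = Rintegral mu `]w, b] (gamma_kernel s).
Proof.
move=> s0 w0 wb; rewrite /lower_gamma Rintegral_itvB ?bnd_simp//.
exact: integrable_gamma_kernel.
Qed.

Lemma integrable_gamma_kernel_oc s w b : 0 < s -> 0 <= w ->
  mu.-integrable `]w, b] (EFin \o gamma_kernel s).
Proof.
move=> s0 w0; apply: integrableS (integrable_gamma_kernel b s0) => //.
by apply: subset_itv; rewrite bnd_simp.
Qed.

Lemma Rintegral_expRN w b : w < b ->
  Rintegral mu `]w, b] (fun u => expR (- u)) = expR (- w) - expR (- b).
Proof.
move=> wb.
have dN (u : R) : is_derive u 1 (fun x : R => - x) (-1) by apply: is_deriveNid.
have de (u : R) : is_derive u 1 (fun x => expR (- x)) (- expR (- u)).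
  have H : is_derive u 1 (fun x => expR (- x)) _ :=
    @is_derive1_comp R (fun x => expR x) (fun x => - x) u _ _ (is_derive_expR (- u)) (dN u).
  by apply: is_derive_eq; rewrite /GRing.scale/= mulrN1.
have dF (u : R) : is_derive u 1 (fun x => - expR (- x)) (expR (- u)).
  have H : is_derive u 1 (fun x => - expR (- x)) _ := @is_deriveN _ _ _ _ u 1 _ (de u).
  by apply: is_derive_eq; rewrite opprK.
have cE : continuous (fun u : R => expR (- u)).
  move=> u; apply: (@continuous_comp R R R (fun x : R => - x) expR u).
    exact: opp_continuous.
  exact: continuous_expR.
rewrite /Rintegral integral_itv_obnd_cbnd; last first.
  by apply/measurable_EFinP; apply: measurable_funTS; exact: continuous_measurable_fun.
rewrite (@continuous_FTC2 _ _ (fun u => - expR (- u)))//.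
- by rewrite -EFinB/= opprK addrC.
- by apply: continuous_subspaceT.
- split.
  + by move=> x _; have [] := dF x.
  + by apply: cvg_at_right_filter; apply: cvgN; exact: cE.
  + by apply: cvg_at_left_filter; apply: cvgN; exact: cE.
- by move=> x _; rewrite derive1E; have [_ ->] := dF x.
Qed.

(** On [u > w] one has [u ^ s >= w ^ s], and [exp (- u)] integrates to [exp (- w)]. This gives the
    sign of [poisson_defect], hence the supermartingale property of the scale function. *)
Lemma Gamma_sub_lower_ge s w : 0 < s -> 0 <= w ->
  gamma_kernel s w <= Gamma (s + 1) - lower_gamma s w.
Proof.
move=> s0 w0.
have h1 : lower_gamma s n%:R - lower_gamma s w @[n --> \oo] --> Gamma (s + 1) - lower_gamma s w.
  by apply: cvgB; [exact: cvg_lower_gamma|exact: cvg_cst].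
have h2 : w `^ s * (expR (- w) - expR (- n%:R)) @[n --> \oo] --> w `^ s * (expR (- w) - 0).
  apply: cvgM; first exact: cvg_cst.
  by apply: cvgB; [exact: cvg_cst|exact: cvgn_expR].
rewrite subr0 in h2.
apply: ler_cvg_to h2 h1 _; near=> n.
have wn : w < n%:R by near: n; exact: nbhs_infty_gtr.
have wn' := ltW wn.
rewrite lower_gammaB// -Rintegral_expRN//.
have iE : mu.-integrable `]w, n%:R] (EFin \o (fun u => expR (- u))).
  have iE : mu.-integrable `[w, n%:R] (EFin \o (fun u => expR (- u))).
    apply: continuous_compact_integrable; first exact: segment_compact.
    apply: continuous_subspaceT => u; apply: (@continuous_comp R R R (fun x : R => - x) expR u).
      exact: opp_continuous.
    exact: continuous_expR.
  apply: integrableS iE => //.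
  by apply: subset_itv; rewrite bnd_simp.
rewrite -RintegralZl; [apply: le_Rintegral => //|exact: measurable_itv|exact: iE].
- by apply: eq_integrable (integrableZl _ (w `^ s) iE).
- exact: integrable_gamma_kernel_oc.
- move=> u /=; rewrite in_itv/= => /andP[wu _].
  rewrite /gamma_kernel ler_pM2r ?expR_gt0//.
  apply: (ge0_ler_powR (ltW s0) w0 _ (ltW wu)).
  by rewrite nnegrE (le_trans w0)// ltW.
Unshelve. all: end_near. Qed.

(** On [u > w] one has [u ^ s <= u ^ (s + 2) / w ^ 2]. The gain of two powers of [w], which will be
    [x ^ 2 / (2 t)], makes the error on the scale function quadratic in [t]. *)
Lemma Gamma_sub_lower_le s w : 0 < s -> 0 < w ->
  Gamma (s + 1) - lower_gamma s w <= Gamma (s + 2 + 1) / w ^+ 2.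
Proof.
move=> s0 w0; have s20 : 0 < s + 2 by rewrite addr_gt0.
have h1 : lower_gamma s n%:R - lower_gamma s w @[n --> \oo] --> Gamma (s + 1) - lower_gamma s w.
  by apply: cvgB; [exact: cvg_lower_gamma|exact: cvg_cst].
apply: cvgr_to_le h1 _; near=> n.
have wn : w < n%:R by near: n; exact: nbhs_infty_gtr.
have [wn' w0'] := (ltW wn, ltW w0).
rewrite ler_pdivlMr ?exprn_gt0// lower_gammaB// mulrC.
apply: le_trans (lower_gamma_le n%:R s20).
apply: (@le_trans _ _ (lower_gamma (s + 2) n%:R - lower_gamma (s + 2) w)); last first.
  by rewrite gerBl lower_gamma_ge0.
rewrite lower_gammaB// -RintegralZl//; last exact: integrable_gamma_kernel_oc.
apply: le_Rintegral => //.
- by apply: eq_integrable (integrableZl _ (w ^+ 2) (integrable_gamma_kernel_oc _ s0 (ltW w0))).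
- by apply: integrable_gamma_kernel_oc => //; exact: ltW.
- move=> u /=; rewrite in_itv/= => /andP[wu _].
  have u0 : 0 < u by exact: lt_trans wu.
  rewrite /gamma_kernel mulrA ler_pM2r ?expR_gt0// powRD ?(gt_eqF u0) ?implybT//.
  have u0' := ltW u0.
  rewrite mulrC ler_pM2l ?powR_gt0// powR_mulrn// ler_pXn2r ?nnegrE//.
  exact: ltW.
Unshelve. all: end_near. Qed.

Lemma Gamma_ge_fact s k : 0 < s -> k`!%:R * Gamma (s + 1) <= Gamma (k%:R + s + 1).
Proof.
move=> s0; elim: k => [|k ih]; first by rewrite fact0 mul1r add0r.
have -> : k.+1%:R + s + 1 = (k%:R + s + 1) + 1 by rewrite -natr1; ring.
rewrite [Gamma (_ + _ + _ + _)]GammaD1; last by rewrite ltrDr ltr_wpDl.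
have G0 := ltW (Gamma_gt0 s0).
rewrite factS natrM -mulrA; apply: ler_pM; [exact: ler0n|by rewrite mulr_ge0|clear ih|exact: ih].
by rewrite -natr1 -addrA (addrC s) addrA lerDl; exact: ltW.
Qed.

(** For [s = 0] these would be the Poisson probabilities of mean [w]; for positive [s] the mass
    missing from their sum is [poisson_defect s w]. *)
Definition gamma_poisson s w k := gamma_kernel (k%:R + s) w / Gamma (k%:R + s + 1).

(** The ratio is at most a constant times [w ^ k / k!], because
    [Gamma (k + s + 1) >= k! Gamma (s + 1)]. *)
Lemma lower_gamma_ratio_cvg0 s w : 0 < s -> 0 <= w ->
  lower_gamma (k%:R + s) w / Gamma (k%:R + s + 1) @[k --> \oo] --> 0.
Proof.
move=> s0 w0; pose D := w `^ s * w / Gamma (s + 1).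
apply: (@squeeze_cvgr _ _ _ _ (fun=> 0) (fun k => D * exp_coeff w k)).
- near=> k; have ks0 : 0 < k%:R + s by rewrite ltr_wpDl.
  apply/andP; split; first by apply: divr_ge0; [exact: lower_gamma_ge0|exact: ltW (Gamma_gt0 ks0)].
  have h : lower_gamma (k%:R + s) w <= w ^+ k * (w `^ s * w).
    have -> : w ^+ k * (w `^ s * w) = Rintegral mu `[0, w] (cst (w ^+ k * w `^ s)).
      by rewrite Rintegral_cst//= lebesgue_measure_itv/= lte_fin; case: ltrP => [_|/(conj w0)/andP/le_anti<-]; rewrite ?subr0/= -?EFinB/= ?subr0 ?mulrA//= !mulr0.
    apply: le_Rintegral => //.
    + exact: integrable_gamma_kernel.
    + apply: continuous_compact_integrable; first exact: segment_compact.
      by apply: continuous_subspaceT => x; exact: cvg_cst.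
    + move=> u /=; rewrite in_itv/= => /andP[u0 uw].
      rewrite /gamma_kernel -powR_mulrn// -powRD; last first.
        by rewrite gt_eqF.
      rewrite -[leRHS]mulr1 ler_pM ?powR_ge0 ?expR_ge0//.
        by apply: ge0_ler_powR; rewrite ?nnegrE// ltW.
      by rewrite expR_le1 oppr_le0.
  rewrite ler_pdivrMr ?Gamma_gt0//; apply: (le_trans h).
  rewrite /D /exp_coeff/=.
  rewrite [leRHS](_ : _ = (w ^+ k * (w `^ s * w)) * (Gamma (k%:R + s + 1) / (k`!%:R * Gamma (s + 1)))); last first.
    by rewrite invfM; ring.
  rewrite ler_peMr ?mulr_ge0 ?exprn_ge0 ?powR_ge0//.
  have f0 : 0 < k`!%:R * Gamma (s + 1) by rewrite mulr_gt0 ?Gamma_gt0// ltr0n fact_gt0.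
  by rewrite ler_pdivlMr// mul1r Gamma_ge_fact.
- exact: cvg_cst.
- rewrite -[X in _ --> X](mulr0 D); apply: cvgM; first exact: cvg_cst.
  exact: cvg_exp_coeff.
Unshelve. all: end_near. Qed.

(** By [lower_gammaD1] and [GammaD1] the terms with [k >= 1] are differences of consecutive ratios
    [lower_gamma (k + s) w / Gamma (k + s + 1)]. Both recurrences take a parameter above [1], so the
    term [k = 0] is set aside. *)
Lemma series_gamma_poisson s w n : 0 < s -> 0 <= w ->
  series (gamma_poisson s w) n.+1 =
    gamma_poisson s w 0 + lower_gamma s w / Gamma (s + 1)
    - lower_gamma (n%:R + s) w / Gamma (n%:R + s + 1).
Proof.
move=> s0 w0; elim: n => [|n ih].
  by rewrite seriesEnat/= big_nat1 !add0r addrK.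
rewrite seriesSr ih /gamma_poisson.
have s1 : 1 < n.+1%:R + s by rewrite -natr1 addrAC ltrDr ltr_wpDl.
rewrite (lower_gammaD1 s1 w0) (GammaD1 s1).
have -> : n.+1%:R + s - 1 = n%:R + s by rewrite -natr1; ring.
have e : Gamma (n.+1%:R + s) = Gamma (n%:R + s + 1) by rewrite -natr1; congr Gamma; ring.
rewrite e.
have n0 : n.+1%:R + s != 0 by rewrite gt_eqF// (lt_trans _ s1).
rewrite [in RHS]mulrBl opprB.
have -> : (n.+1%:R + s) * lower_gamma (n%:R + s) w / ((n.+1%:R + s) * Gamma (n%:R + s + 1)) =
    lower_gamma (n%:R + s) w / Gamma (n%:R + s + 1) by rewrite -mulf_div divff// mul1r.
by rewrite -[LHS]addrA; congr (_ + _); exact: addrC.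
Qed.

(** Here [w ^ s] splits into [w ^ s (1 - exp (- w))], which dominates the integral of
    [u ^ s exp (- u)] over []0, w]], and the kernel at [w]. *)
Lemma lower_gamma_kernel_le s w : 0 < s -> 0 < w ->
  lower_gamma s w + gamma_kernel s w <= w `^ s.
Proof.
move=> s0 w0; have [w0' s0'] := (ltW w0, ltW s0).
have := lower_gammaB s0 (lexx 0) w0'.
rewrite {2}/lower_gamma set_itv1 Rintegral_set1 subr0 => ->.
have -> : w `^ s = w `^ s * (expR (- 0) - expR (- w)) + gamma_kernel s w.
  by rewrite oppr0 expR0 /gamma_kernel; ring.
rewrite lerD2r -Rintegral_expRN//.
have iE : mu.-integrable `]0, w] (EFin \o (fun u => expR (- u))).
  have iE : mu.-integrable `[0, w] (EFin \o (fun u => expR (- u))).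
    apply: continuous_compact_integrable; first exact: segment_compact.
    apply: continuous_subspaceT => u; apply: (@continuous_comp R R R (fun x : R => - x) expR u).
      exact: opp_continuous.
    exact: continuous_expR.
  apply: integrableS iE => //.
  by apply: subset_itv; rewrite bnd_simp.
rewrite -RintegralZl; [apply: le_Rintegral => //|exact: measurable_itv|exact: iE].
- exact: integrable_gamma_kernel_oc.
- by apply: eq_integrable (integrableZl _ (w `^ s) iE).
- move=> u /=; rewrite in_itv/= => /andP[u0 uw].
  rewrite /gamma_kernel ler_pM2r ?expR_gt0//.
  by apply: ge0_ler_powR; rewrite ?nnegrE// ltW.
Qed.

(* In the usual notation [1 - poisson_defect s w] is gamma(s, w) / Gamma(s). *)
Definition poisson_defect s w :=
  (Gamma (s + 1) - lower_gamma s w - gamma_kernel s w) / Gamma (s + 1).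

Lemma cvg_series_gamma_poisson s w : 0 < s -> 0 <= w ->
  series (gamma_poisson s w) @ \oo --> 1 - poisson_defect s w.
Proof.
move=> s0 w0; rewrite -cvg_shiftS.
under eq_fun do rewrite series_gamma_poisson//.
have G1 : Gamma (s + 1) != 0 by rewrite gt_eqF// Gamma_gt0.
have -> : 1 - poisson_defect s w = gamma_poisson s w 0 + lower_gamma s w / Gamma (s + 1) - 0.
  by rewrite /poisson_defect /gamma_poisson !add0r; field.
by apply: cvgB; [exact: cvg_cst|exact: lower_gamma_ratio_cvg0].
Qed.

Lemma poisson_defect_ge0 s w : 0 < s -> 0 <= w -> 0 <= poisson_defect s w.
Proof.
move=> s0 w0; apply: divr_ge0; last by rewrite ltW ?Gamma_gt0.
by rewrite subr_ge0 Gamma_sub_lower_ge.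
Qed.

Lemma poisson_defect_le s w : 0 < s -> 0 < w ->
  poisson_defect s w <= Gamma (s + 2 + 1) / Gamma (s + 1) / w ^+ 2.
Proof.
move=> s0 w0; rewrite /poisson_defect mulrAC ler_pM2r ?invr_gt0 ?Gamma_gt0//.
apply: le_trans (Gamma_sub_lower_le s0 w0).
by rewrite gerBl gamma_kernel_ge0.
Qed.

End IncompleteGamma.

(** * The Bessel semigroup and the scale function *)

(** Applied with [u k = (z / 2) ^ k / k!], it bounds the series of the Bessel function by the square
    of that of [exp (z / 2)]. *)
Lemma sum_sqr_le (R : realDomainType) (u : nat -> R) n : (forall k, 0 <= u k) ->
  \sum_(0 <= k < n) u k ^+ 2 <= (\sum_(0 <= k < n) u k) ^+ 2.
Proof.
move=> u0; elim: n => [|n ih]; first by rewrite !big_nil expr0n.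
rewrite !big_nat_recr//= sqrrD.
have s0 : 0 <= \sum_(0 <= k < n) u k by apply: sumr_ge0.
have p0 := mulr_ge0 s0 (u0 n).
have := lerD ih (lexx (u n ^+ 2)); lra.
Qed.

(** [powR] of a negative base is not the inverse, so the inverse is reached through the power [- 1]
    of the square. *)
Lemma measurable_invr (R : realType) : measurable_fun [set: R] (fun x : R => x^-1).
Proof.
have -> : (fun x : R => x^-1) = (fun x => x * (x ^+ 2) `^ (- 1)).
  apply/funext => x; rewrite powR_inv1 ?sqr_ge0//.
  by have [->|x0] := eqVneq x 0; [rewrite invr0 mul0r|field].
apply: measurable_funM => //.
by apply: (measurableT_comp (@measurable_powR R _)); exact: measurable_funX.
Qed.

Section BesselDensity.
Variables (R : realType) (nu : R).
Hypothesis nu0 : 0 < nu.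
Notation mu := (@lebesgue_measure R).
Implicit Types x y z t w : R.

Definition bessel_cst := (2 `^ nu * Gamma (nu + 1))^-1.

Lemma Gamma_nu_gt0 k : 0 < Gamma (k%:R + nu + 1).
Proof. by apply: Gamma_gt0; rewrite ltr_wpDl. Qed.

Lemma bessel_cst_gt0 : 0 < bessel_cst.
Proof. by rewrite invr_gt0 mulr_gt0 ?powR_gt0// Gamma_gt0. Qed.

Definition bessel_term z k :=
  (z / 2) `^ (2 * k%:R + nu) / (k`!%:R * Gamma (k%:R + nu + 1)).

Lemma bessel_term_ge0 z k : 0 <= bessel_term z k.
Proof. by rewrite divr_ge0 ?powR_ge0// mulr_ge0// ltW ?Gamma_nu_gt0. Qed.

Lemma powR_expR x s : 0 < x -> x `^ s = expR (s * ln x).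
Proof. by move=> x0; rewrite /powR gt_eqF. Qed.

Lemma bessel_term_le z k : 0 < z ->
  bessel_term z k <= (z / 2) `^ nu / Gamma (nu + 1) * exp_coeff (z / 2) k ^+ 2.
Proof.
move=> z0; have z20 : 0 < z / 2 by rewrite divr_gt0.
have z20' := ltW z20.
rewrite /bessel_term powRD; last by rewrite (gt_eqF z20) implybT.
rewrite -natrM powR_mulrn// /exp_coeff/= mulnC exprM.
have f0 : 0 < k`!%:R :> R by rewrite ltr0n fact_gt0.
have G0 := Gamma_gt0 nu0; have Gk := Gamma_nu_gt0 k.
move: (Gamma_ge_fact k nu0); move: (Gamma (k%:R + nu + 1)) (Gamma (nu + 1)) Gk G0 => Gkn Gn Gk G0 Gfact.
set A := (z / 2) `^ nu; set B := (z / 2) ^+ k.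
have [A0 B0] : 0 < A /\ 0 < B by rewrite powR_gt0 ?exprn_gt0.
have -> : A / Gn * (B / k`!%:R) ^+ 2 = (B ^+ 2 * A) / (k`!%:R * (k`!%:R * Gn)).
  by field; rewrite !gt_eqF.
rewrite ler_pM2l ?mulr_gt0 ?exprn_gt0//.
rewrite lef_pV2 ?posrE ?mulr_gt0//.
by rewrite ler_pM2l.
Qed.

Lemma series_bessel_term_le z n : 0 < z ->
  series (bessel_term z) n <= (z / 2) `^ nu / Gamma (nu + 1) * expR z.
Proof.
move=> z0; have z20 : 0 <= z / 2 by rewrite divr_ge0// ltW.
apply: (@le_trans _ _ (\sum_(0 <= k < n) (z / 2) `^ nu / Gamma (nu + 1) * exp_coeff (z / 2) k ^+ 2)).
  by rewrite seriesEnat; apply: ler_sum => k _; exact: bessel_term_le.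
rewrite -mulr_sumr; apply: ler_wpM2l.
  by rewrite divr_ge0 ?powR_ge0// ltW ?Gamma_gt0.
apply: le_trans (sum_sqr_le n (fun k => exp_coeff_ge0 k z20)) _.
have -> : expR z = expR (z / 2) ^+ 2 by rewrite -expRM_natl; congr expR; field.
rewrite ler_pXn2r ?nnegrE ?expR_ge0//; last first.
  by apply: sumr_ge0 => k _; exact: exp_coeff_ge0.
have := @nondecreasing_cvgn_le _ (series (exp_coeff (z / 2))) _ (is_cvg_series_exp_coeff _) n.
rewrite seriesEnat/=; apply.
by apply: nondecreasing_series => k _ _; exact: exp_coeff_ge0.
Qed.

Lemma nondecreasing_series_bessel z : nondecreasing_seq (series (bessel_term z)).
Proof. by apply: nondecreasing_series => k _ _; exact: bessel_term_ge0. Qed.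

Lemma is_cvg_series_bessel_gt0 z : 0 < z -> cvgn (series (bessel_term z)).
Proof.
move=> z0; apply: nondecreasing_is_cvgn; first exact: nondecreasing_series_bessel.
by exists ((z / 2) `^ nu / Gamma (nu + 1) * expR z) => _ [n _ <-]; exact: series_bessel_term_le.
Qed.

(* [powR] of a negative number is [1], so the negative arguments reduce to [2]. *)
Lemma is_cvg_series_bessel z : cvgn (series (bessel_term z)).
Proof.
case: (ltrgtP z 0) => [z0|z0|->]; last 2 first.
- exact: is_cvg_series_bessel_gt0.
- have -> : series (bessel_term 0) = cst 0.
    apply/funext => n; rewrite seriesEnat/= big1// => k _.
    by rewrite /bessel_term mul0r powR0 ?mul0r// gt_eqF// ltr_wpDl// mulr_ge0.
  exact: is_cvg_cst.
have -> : bessel_term z = bessel_term 2.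
  apply/funext => k; rewrite /bessel_term lt0_powR1; last by rewrite pmulr_llt0.
  by rewrite divff// powR1.
exact: is_cvg_series_bessel_gt0.
Qed.

Lemma besselI_ge0 z : 0 <= besselI nu z.
Proof.
apply: limr_ge; first exact: is_cvg_series_bessel.
by near=> n; rewrite seriesEnat/= sumr_ge0// => k _; exact: bessel_term_ge0.
Unshelve. all: end_near. Qed.

Lemma besselI_le z : 0 < z -> besselI nu z <= (z / 2) `^ nu / Gamma (nu + 1) * expR z.
Proof.
move=> z0; apply: limr_le; first exact: is_cvg_series_bessel.
by near=> n; exact: series_bessel_term_le.
Unshelve. all: end_near. Qed.

Lemma measurable_besselI : measurable_fun setT (besselI nu).
Proof.
apply: (@measurable_fun_cvg _ _ _ _ (fun n z => series (bessel_term z) n)).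
- move=> n; rewrite [X in measurable_fun _ X](_ : _ = fun z => \sum_(k < n) bessel_term z k); last first.
    by apply/funext => z; rewrite seriesEord.
  apply: measurable_sum => k; apply: measurable_funM; last exact: measurable_cst.
  apply: (measurableT_comp (@measurable_powR R _)).
  exact: mulrr_measurable.
- by move=> z _; exact: is_cvg_series_bessel.
Qed.

Lemma bessel_density_ge0 t x y : 0 < t -> 0 <= bessel_density nu t x y.
Proof.
move=> t0; rewrite /bessel_density; case: ifPn => // y0.
by rewrite !mulr_ge0 ?expR_ge0 ?powR_ge0 ?besselI_ge0// ?invr_ge0 ltW.
Qed.

Lemma bessel_density_le0 t x y : y <= 0 -> bessel_density nu t x y = 0.
Proof. by move=> y0; rewrite /bessel_density ltNge y0. Qed.

Lemma measurable_bessel_density t :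
  measurable_fun setT (fun z : R * R => bessel_density nu t z.1 z.2).
Proof.
apply: measurable_fun_if => //.
- by apply: measurable_fun_ltr.
- rewrite setTI; apply: measurable_funTS.
  apply: measurable_funM; first apply: measurable_funM; first apply: measurable_funM.
  + exact: measurable_funM.
  + apply: (measurableT_comp (@measurable_powR R _)).
    apply: measurable_funM => //.
    apply: (@measurableT_comp _ _ _ _ _ _ (fun x : R => x^-1) _ fst) => //.
    exact: measurable_invr.
  + apply: (measurableT_comp (@measurable_expR R)).
    apply: measurable_funM => //; apply: measurableT_comp => //.
    by apply: measurable_funD; exact: measurable_funX.
  + apply: (measurableT_comp measurable_besselI).
    by apply: measurable_funM => //; exact: measurable_funM.
Qed.

Lemma bessel_density_le t x y : 0 < t -> 0 < x -> 0 < y ->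
  bessel_density nu t x y <=
  bessel_cst * (y `^ (2 * nu) * y) * t `^ (- (1 + nu)) * expR (- ((x - y) ^+ 2 / (2 * t))).
Proof.
move=> t0 x0 y0; rewrite /bessel_density y0.
have z0 : 0 < x * y / t by rewrite divr_gt0// mulr_gt0.
apply: (@le_trans _ _ (y / t * (y / x) `^ nu * expR (- (x ^+ 2 + y ^+ 2) / (2 * t)) *
    ((x * y / t / 2) `^ nu / Gamma (nu + 1) * expR (x * y / t)))).
  apply: ler_wpM2l; last exact: besselI_le.
  by rewrite !mulr_ge0 ?expR_ge0 ?powR_ge0// ?invr_ge0 ltW.
(* The two sides are now equal: the powers of [x] cancel and the exponents complete the square
   [(x - y) ^ 2]. *)
rewrite le_eqVlt; apply/orP; left; apply/eqP.
have -> : expR (- ((x - y) ^+ 2 / (2 * t))) = expR (- (x ^+ 2 + y ^+ 2) / (2 * t)) * expR (x * y / t).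
  by rewrite -expRD; congr expR; field; rewrite gt_eqF.
have -> : t `^ (- (1 + nu)) = t^-1 * t `^ (- nu).
  by rewrite opprD powRD ?(gt_eqF t0) ?implybT// powR_inv1 ?ltW.
have -> : (y / x) `^ nu = y `^ nu * x `^ (- nu).
  by rewrite powRM ?invr_ge0 ?ltW// -powR_inv1 ?ltW// -powRrM mulN1r.
have -> : (x * y / t / 2) `^ nu = x `^ nu * y `^ nu * t `^ (- nu) * 2 `^ (- nu).
  rewrite !powRM ?mulr_ge0 ?invr_ge0 ?ltW//.
  by rewrite -!powR_inv1 ?ltW// -!powRrM !mulN1r.
have -> : y `^ (2 * nu) = y `^ nu * y `^ nu.
  by rewrite -powRD ?(gt_eqF y0) ?implybT//; congr (_ `^ _); ring.
rewrite /bessel_cst !powRN.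
have G0 := Gamma_gt0 nu0.
have xn := powR_gt0 nu x0; have tn := powR_gt0 nu t0.
have tw := powR_gt0 nu (ltr0n R 2).
by field; rewrite !gt_eqF.
Qed.

(* Antiderivative of [y ^ (2 k + 1) * exp (- y ^ 2 / (2 t))], by parts. *)
Fixpoint gauss_prim t k (y : R) : R :=
  if k is k'.+1 then - t * (y ^+ (2 * k) * expR (- (y ^+ 2 / (2 * t)))) + 2 * k%:R * t * gauss_prim t k' y
  else - t * expR (- (y ^+ 2 / (2 * t))).

Lemma is_derive_gauss t y : 0 < t ->
  is_derive y 1 (fun y => expR (- (y ^+ 2 / (2 * t)))) (- (y / t) * expR (- (y ^+ 2 / (2 * t)))).
Proof.
move=> t0.
have dX : is_derive y 1 (fun y : R => y ^+ 2) _ := @is_deriveX _ _ (@id R) 2 y 1 1 (is_derive_id _ _).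
have dN : is_derive y 1 (fun y : R => (- (2 * t)^-1) * y ^+ 2) _ := @is_deriveZ _ _ _ _ (- (2 * t)^-1) y 1 _ dX.
have eN : (fun y : R => - (y ^+ 2 / (2 * t))) = (fun y : R => (- (2 * t)^-1) * y ^+ 2).
  by apply/funext => u; rewrite mulNr mulrC.
have de : is_derive y 1 (fun y => expR ((- (2 * t)^-1) * y ^+ 2)) _ :=
  @is_derive1_comp R (fun x => expR x) _ y _ _ (is_derive_expR _) dN.
have -> : (fun y => expR (- (y ^+ 2 / (2 * t)))) = (fun y => expR ((- (2 * t)^-1) * y ^+ 2)).
  by apply/funext => u; rewrite -[in RHS](congr1 (fun f => f u) eN).
rewrite (congr1 (fun f => f y) eN).
by apply: is_derive_eq; rewrite /GRing.scale/=; field; rewrite gt_eqF.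
Qed.

Lemma is_derive_gauss_prim t k y : 0 < t ->
  is_derive y 1 (gauss_prim t k) (y ^+ (2 * k).+1 * expR (- (y ^+ 2 / (2 * t)))).
Proof.
move=> t0; have dg := is_derive_gauss y t0.
elim: k => [|k ih].
  have H : is_derive y 1 (gauss_prim t 0) _ := @is_deriveZ _ _ _ _ (- t) y 1 _ dg.
  by apply: is_derive_eq; rewrite /GRing.scale/= muln0 expr1; field; rewrite gt_eqF.
have dX := @is_deriveX _ _ (@id R) (2 * k.+1) y 1 1 (is_derive_id _ _).
rewrite exprfctE in dX.
have dM : is_derive y 1 (fun y : R => y ^+ (2 * k.+1) * expR (- (y ^+ 2 / (2 * t)))) _ := @is_deriveM _ _ _ _ _ _ _ _ dX dg.
have d1 : is_derive y 1 (fun y : R => - t * (y ^+ (2 * k.+1) * expR (- (y ^+ 2 / (2 * t))))) _ := @is_deriveZ _ _ _ _ (- t) y 1 _ dM.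
have d2 : is_derive y 1 (fun y => 2 * k.+1%:R * t * gauss_prim t k y) _ := @is_deriveZ _ _ _ _ (2 * k.+1%:R * t) y 1 _ ih.
have H : is_derive y 1 (gauss_prim t k.+1) _ := @is_deriveD _ _ _ _ _ _ _ _ _ d1 d2.
apply: is_derive_eq; have -> : (2 * k.+1)%N = (2 * k).+2 by rewrite mulnS.
rewrite /GRing.scale/= -[((2 * k).+2)%:R]/((2 + 2 * k)%:R) -mulnS natrM -[k.+1%:R]natr1 !exprS.
by field; rewrite gt_eqF.
Qed.

Lemma gauss_prim0 t k : gauss_prim t k 0 = - (k`!%:R * (2 * t) ^+ k * t).
Proof.
elim: k => [|k ih] /=; first by rewrite expr0n/= mul0r oppr0 expR0 fact0; ring.
by rewrite ih mulnS expr0n/= mul0r mulr0 add0r factS natrM exprS; ring.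
Qed.

Lemma cvg_gauss_prim t k : 0 < t -> gauss_prim t k y @[y --> +oo] --> 0.
Proof.
move=> t0.
have cv : (y ^+ 2 / (2 * t)) @[y --> +oo] --> +oo.
  apply: gt0_cvgMly; first by rewrite invr_gt0 mulr_gt0.
  apply/cvgryPge => A; near=> y.
  have y1 : 1 <= y by near: y; apply: nbhs_pinfty_ge; exact: num_real.
  have yA : A <= y by near: y; apply: nbhs_pinfty_ge; exact: num_real.
  by apply: (le_trans yA); rewrite expr2 ler_peMl// (le_trans ler01).
elim: k => [|k ih] /=.
  rewrite -[X in _ --> X](mulr0 (- t)); apply: cvgM; first exact: cvg_cst.
  exact: (cvg_comp _ _ cv (@cvgr_expR R)).
rewrite -[X in _ --> X]addr0; apply: cvgD; last first.
  by rewrite -[X in _ --> X](mulr0 (2 * k.+1%:R * t)); apply: cvgM => //; exact: cvg_cst.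
rewrite -[X in _ --> X](mulr0 (- t)); apply: cvgM; first exact: cvg_cst.
have k0 : 0 < k.+1%:R :> R by [].
(* [y ^ (2 k + 2) exp (- y ^ 2 / (2 t))] is a multiple of a gamma kernel at [y ^ 2 / (2 t)], whose
   limit is known. *)
have : (2 * t) ^+ k.+1 * gamma_kernel k.+1%:R (y ^+ 2 / (2 * t)) @[y --> +oo] --> (2 * t) ^+ k.+1 * 0.
  apply: cvgM; first exact: cvg_cst.
  exact: (cvg_comp _ _ cv (cvg_gamma_kernel k0)).
rewrite mulr0; apply: cvg_trans; apply: near_eq_cvg; near=> y.
have y0 : 0 <= y by near: y; apply: nbhs_pinfty_ge; exact: num_real.
rewrite /= /gamma_kernel powR_mulrn ?divr_ge0 ?sqr_ge0 ?mulr_ge0 ?ltW//.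
rewrite mulrA; congr (_ * _).
by rewrite expr_div_n -exprM mulrC divfK// expf_neq0// mulf_neq0 ?gt_eqF.
Unshelve. all: end_near. Qed.

Lemma integral_gauss t k : 0 < t ->
  (\int[mu]_(y in `[0%R, +oo[) (y ^+ (2 * k).+1 * expR (- (y ^+ 2 / (2 * t))))%:E
    = (k`!%:R * (2 * t) ^+ k * t)%:E)%E.
Proof.
move=> t0.
have dF x := is_derive_gauss_prim k x t0.
have cF (x : R) : {for x, continuous (gauss_prim t k)}.
  by apply/differentiable_continuous/derivable1_diffP; have [] := dF x.
have cg (x : R) : {for x, continuous (fun y => expR (- (y ^+ 2 / (2 * t))))}.
  by apply/differentiable_continuous/derivable1_diffP; have [] := is_derive_gauss x t0.
rewrite (@ge0_continuous_FTC2y _ _ (gauss_prim t k) 0 0).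
- by rewrite gauss_prim0 -EFinB sub0r opprK.
- by move=> x x0; rewrite mulr_ge0 ?expR_ge0 ?exprn_ge0.
- apply: continuous_subspaceT => x; apply: cvgM; last exact: cg.
  exact: exprn_continuous.
- exact: cvg_gauss_prim.
- by move=> x _; have [] := dF x.
- by apply: cvg_at_right_filter; exact: cF.
- by move=> x _; rewrite derive1E; have [_ ->] := dF x.
Qed.

Lemma eseries_EFin (u : nat -> R) (l : R) :
  series u @ \oo --> l -> (\sum_(k <oo) (u k)%:E = l%:E)%E.
Proof.
move=> ul; apply/cvg_lim => //.
rewrite (_ : (fun n => _) = EFin \o series u); last first.
  by apply/funext => n /=; rewrite sumEFin seriesEnat.
by apply: cvg_comp ul _; exact: cvg_id.
Qed.

(* The value [+oo] off the state space makes [y ^ (2 nu) * bessel_scale >= 1] on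
   the whole of []-oo, y[], negative values included. *)
Definition bessel_scale y : \bar R := if 0 < y then (y `^ (- (2 * nu)))%:E else +oo%E.

Definition bessel_trans t (f : R -> \bar R) x : \bar R :=
  (\int[mu]_y ((bessel_density nu t x y)%:E * f y))%E.

Definition gauss_coeff t x k :=
  expR (- (x ^+ 2 / (2 * t))) * (x / t / 2) `^ (2 * k%:R + nu) * x `^ (- nu) * t^-1
    / (k`!%:R * Gamma (k%:R + nu + 1)).

(** The factor [y ^ (- 2 nu)] cancels the fractional powers of [y] in the density. Odd integer
    powers against a Gaussian are left, and these have the elementary antiderivative
    [gauss_prim]. *)
Lemma bessel_density_scale t x y : 0 < t -> 0 < x -> 0 < y ->
  ((bessel_density nu t x y)%:E * bessel_scale y =
  \sum_(k <oo) (gauss_coeff t x k * (y ^+ (2 * k).+1 * expR (- (y ^+ 2 / (2 * t)))))%:E)%E.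
Proof.
move=> t0 x0 y0; rewrite /bessel_scale y0 -EFinM; apply/esym/eseries_EFin.
rewrite /bessel_density y0; set A := y / t * _ * _.
have -> : A * besselI nu (x * y / t) * y `^ (- (2 * nu)) = (A * y `^ (- (2 * nu))) * besselI nu (x * y / t).
  by rewrite mulrAC.
have h : (A * y `^ (- (2 * nu))) *: series (bessel_term (x * y / t)) n @[n --> \oo] -->
    (A * y `^ (- (2 * nu))) *: besselI nu (x * y / t).
  by apply: cvgZr; exact: is_cvg_series_bessel.
rewrite /GRing.scale/= in h.
have -> : series (fun k => gauss_coeff t x k * (y ^+ (2 * k).+1 * expR (- (y ^+ 2 / (2 * t))))) =
  (fun n => (A * y `^ (- (2 * nu))) * series (bessel_term (x * y / t)) n); last exact: h.
apply/funext => n; rewrite !seriesEnat/= mulr_sumr; apply: eq_bigr => k _.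
rewrite /gauss_coeff /bessel_term.
have f0 : 0 < k`!%:R :> R by rewrite ltr0n fact_gt0.
have G0 := Gamma_nu_gt0 k.
have -> : x * y / t / 2 = (x / t / 2) * y by field; rewrite gt_eqF.
rewrite (powRM _ _ (ltW y0)) ?divr_ge0 ?(ltW x0) ?(ltW t0)//.
have -> : A = y / t * (y `^ nu * x `^ (- nu)) * (expR (- (x ^+ 2 / (2 * t))) * expR (- (y ^+ 2 / (2 * t)))).
  rewrite /A; congr (_ * _ * _).
    by rewrite powRM ?invr_ge0 ?ltW// -powR_inv1 ?ltW// -powRrM mulN1r.
  by rewrite -expRD; congr expR; field; rewrite gt_eqF.
have -> : y `^ (2 * k%:R + nu) = y ^+ (2 * k) * y `^ nu.
  by rewrite powRD ?(gt_eqF y0) ?implybT// -natrM powR_mulrn ?ltW.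
have -> : y `^ (- (2 * nu)) = (y `^ nu)^-1 * (y `^ nu)^-1.
  by rewrite -!powRN -powRD ?(gt_eqF y0) ?implybT//; congr (_ `^ _); ring.
rewrite [y ^+ (2 * k).+1]exprS.
have yn := powR_gt0 nu y0.
by field; rewrite !gt_eqF.
Qed.

Lemma gauss_coeff_integral t x k : 0 < t -> 0 < x ->
  gauss_coeff t x k * (k`!%:R * (2 * t) ^+ k * t) =
  x `^ (- (2 * nu)) * gamma_poisson nu (x ^+ 2 / (2 * t)) k.
Proof.
move=> t0 x0; rewrite /gauss_coeff /gamma_poisson /gamma_kernel.
have f0 : 0 < k`!%:R :> R by rewrite ltr0n fact_gt0.
have G0 := Gamma_nu_gt0 k.
have t20 : 0 < 2 * t by rewrite mulr_gt0.
have w0 : 0 < x ^+ 2 / (2 * t) by rewrite divr_gt0 ?exprn_gt0.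
have -> : (x ^+ 2 / (2 * t)) `^ (k%:R + nu) = (x / t / 2) `^ (2 * k%:R + nu) * x `^ nu * (2 * t) ^+ k.
  rewrite -[(2 * t) ^+ k]powR_mulrn ?(ltW t20)//.
  have xt0 : 0 < x / t / 2 by rewrite !divr_gt0.
  rewrite !powR_expR// -!expRD; congr expR.
  have -> : x / t / 2 = x / (2 * t) by field; rewrite gt_eqF.
  rewrite !ln_div ?posrE ?exprn_gt0// lnXn// -mulr_natr; ring.
have -> : x `^ (- (2 * nu)) = (x `^ nu)^-1 * (x `^ nu)^-1.
  by rewrite -!powRN -powRD ?(gt_eqF x0) ?implybT//; congr (_ `^ _); ring.
rewrite powRN; have xn := powR_gt0 nu x0.
by field; rewrite !gt_eqF.
Qed.

Lemma bessel_trans_pos t f x : measurable_fun setT f ->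
  bessel_trans t f x = (\int[mu]_(y in `]0%R, +oo[) ((bessel_density nu t x y)%:E * f y))%E.
Proof.
move=> mf; rewrite [RHS]integral_mkcond; apply: eq_integral => y _.
rewrite patchE; case: ifPn => // /negP; rewrite inE/= in_itv/= andbT => /negP.
by rewrite -leNgt => y0; rewrite bessel_density_le0// mul0e.
Qed.

Lemma measurable_bessel_scale : measurable_fun setT bessel_scale.
Proof.
apply: measurable_fun_if => //.
- exact: measurable_fun_ltr.
- apply: measurable_funTS; apply/measurable_EFinP; exact: measurable_powR.
Qed.

(** Termwise integration of the Bessel series, whose terms are nonnegative, gives [x ^ (- 2 nu)]
    times the weights [gamma_poisson nu w k] with [w = x ^ 2 / (2 t)]. *)
Lemma bessel_trans_scaleE t x : 0 < t -> 0 < x ->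
  bessel_trans t bessel_scale x =
    (x `^ (- (2 * nu)) * (1 - poisson_defect nu (x ^+ 2 / (2 * t))))%:E.
Proof.
move=> t0 x0; rewrite bessel_trans_pos; last exact: measurable_bessel_scale.
have C0 k : 0 <= gauss_coeff t x k.
  by rewrite divr_ge0 ?mulr_ge0 ?powR_ge0 ?expR_ge0 ?invr_ge0 ?(ltW t0)// (ltW (Gamma_nu_gt0 k)).
transitivity (\int[mu]_(y in `]0%R, +oo[) \sum_(k <oo) (gauss_coeff t x k * (y ^+ (2 * k).+1 * expR (- (y ^+ 2 / (2 * t)))))%:E)%E.
  apply: eq_integral => y.
  by rewrite inE/= in_itv/= andbT => y0; exact: bessel_density_scale.
have mg k : measurable_fun setT (fun y : R => y ^+ (2 * k).+1 * expR (- (y ^+ 2 / (2 * t)))).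
  apply: measurable_funM; first exact: measurable_funX.
  apply: (measurableT_comp (@measurable_expR R)); apply: measurableT_comp => //.
  by apply: measurable_funM => //; exact: measurable_funX.
have g0 k y : 0 < y -> (0 <= (y ^+ (2 * k).+1 * expR (- (y ^+ 2 / (2 * t))))%:E)%E.
  by move=> y0; rewrite lee_fin mulr_ge0 ?expR_ge0 ?exprn_ge0 ?ltW.
rewrite integral_nneseries//; last 2 first.
- move=> k; apply: measurable_funTS; apply/measurable_EFinP.
  by apply: measurable_funM; [exact: measurable_cst|exact: mg].
- move=> k y; rewrite /= in_itv/= andbT => y0; rewrite lee_fin mulr_ge0//.
  by have := g0 k y y0; rewrite lee_fin.
rewrite (eq_eseriesr (g := fun k => (x `^ (- (2 * nu)) * gamma_poisson nu (x ^+ 2 / (2 * t)) k)%:E)); last first.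
  move=> k _; under eq_integral do rewrite EFinM.
  rewrite ge0_integralZl_EFin//; last 2 first.
  - by move=> y; rewrite /= in_itv/= andbT => y0; exact: g0.
  - by apply: measurable_funTS; apply/measurable_EFinP; exact: mg.
  rewrite integral_itv_obnd_cbnd; last by apply: measurable_funTS; apply/measurable_EFinP; exact: mg.
  by rewrite integral_gauss// -EFinM gauss_coeff_integral.
have w0 : 0 <= x ^+ 2 / (2 * t) by rewrite divr_ge0 ?sqr_ge0 ?mulr_ge0 ?ltW.
apply: eseries_EFin.
have -> : series (fun k => x `^ (- (2 * nu)) * gamma_poisson nu (x ^+ 2 / (2 * t)) k) =
  (fun n => x `^ (- (2 * nu)) * series (gamma_poisson nu (x ^+ 2 / (2 * t))) n).
  by apply/funext => n; rewrite !seriesEnat/= mulr_sumr.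
by apply: cvgM; [exact: cvg_cst|exact: cvg_series_gamma_poisson].
Qed.

(** Expresses the asymptotic value through [w = x ^ 2 / (2 t)], so that the two bounds below compare
    incomplete gamma functions with [w ^ nu]. *)
Lemma bessel_cst_scale t x : 0 < t -> 0 < x ->
  bessel_cst * t `^ (- nu) = x `^ (- (2 * nu)) * ((x ^+ 2 / (2 * t)) `^ nu / Gamma (nu + 1)).
Proof.
move=> t0 x0; rewrite /bessel_cst invfM mulrAC mulrA; congr (_ / _).
have w0 : 0 < x ^+ 2 / (2 * t) by rewrite divr_gt0 ?exprn_gt0 ?mulr_gt0.
rewrite -powRN (powR_expR _ t0) (powR_expR _ x0) (powR_expR _ w0) powR_expR// -!expRD.
congr expR.
by rewrite ln_div ?posrE ?exprn_gt0 ?mulr_gt0// lnXn// lnM ?posrE//; ring.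
Qed.

Lemma bessel_trans_scale_le t x : 0 < t -> 0 < x ->
  (bessel_trans t bessel_scale x <= (bessel_cst * t `^ (- nu))%:E)%E.
Proof.
move=> t0 x0; rewrite bessel_trans_scaleE// lee_fin.
have w0 : 0 < x ^+ 2 / (2 * t) by rewrite divr_gt0 ?exprn_gt0 ?mulr_gt0.
have G0 := Gamma_gt0 nu0.
rewrite (bessel_cst_scale t0 x0).
rewrite ler_pM2l ?powR_gt0// ler_pdivlMr//.
have -> : (1 - poisson_defect nu (x ^+ 2 / (2 * t))) * Gamma (nu + 1) =
   lower_gamma nu (x ^+ 2 / (2 * t)) + gamma_kernel nu (x ^+ 2 / (2 * t)).
  by rewrite /poisson_defect; field; rewrite gt_eqF.
exact: lower_gamma_kernel_le.
Qed.

Lemma bessel_trans_scale_ge t x : 0 < t -> 0 < x ->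
  ((bessel_cst * t `^ (- nu) * expR (- (x ^+ 2 / (2 * t))))%:E <= bessel_trans t bessel_scale x)%E.
Proof.
move=> t0 x0; rewrite bessel_trans_scaleE// lee_fin.
have w0 : 0 < x ^+ 2 / (2 * t) by rewrite divr_gt0 ?exprn_gt0 ?mulr_gt0.
have G0 := Gamma_gt0 nu0.
rewrite (bessel_cst_scale t0 x0).
rewrite -mulrA ler_pM2l ?powR_gt0// mulrAC ler_pdivrMr//.
have -> : (1 - poisson_defect nu (x ^+ 2 / (2 * t))) * Gamma (nu + 1) =
   lower_gamma nu (x ^+ 2 / (2 * t)) + gamma_kernel nu (x ^+ 2 / (2 * t)).
  by rewrite /poisson_defect; field; rewrite gt_eqF.
(* Only the kernel is kept: it is already [w ^ nu exp (- w)]. *)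
by rewrite -/(gamma_kernel _ _) lerDr lower_gamma_ge0.
Qed.

Lemma bessel_scale_ge0 x : (0 <= bessel_scale x)%E.
Proof. by rewrite /bessel_scale; case: ifPn => // _; rewrite lee_fin powR_ge0. Qed.

Lemma bessel_trans_scale_super t x : 0 < t ->
  (bessel_trans t bessel_scale x <= bessel_scale x)%E.
Proof.
move=> t0; rewrite [leRHS]/bessel_scale; case: ifPn => x0; last by rewrite leey.
rewrite bessel_trans_scaleE// lee_fin ler_piMr ?powR_ge0// gerBl.
by rewrite poisson_defect_ge0// divr_ge0 ?sqr_ge0// mulr_ge0// ltW.
Qed.

Lemma bessel_trans_scale_sub y : 0 < y -> exists2 K, 0 <= K & forall t x, 0 < t -> y <= x ->
  (bessel_scale x <= bessel_trans t bessel_scale x + (K * t ^+ 2)%:E)%E.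
Proof.
move=> y0; have G0 := Gamma_gt0 nu0.
have G2 : 0 < Gamma (nu + 2 + 1) by apply: Gamma_gt0; rewrite addr_gt0.
(* The last factor, times [t ^ 2], is [w ^ (- 2)] at [w = y ^ 2 / (2 t)], the smallest [w] for
   [x >= y]. *)
exists (y `^ (- (2 * nu)) * (Gamma (nu + 2 + 1) / Gamma (nu + 1)) * (4 / (y ^+ 2) ^+ 2)).
  by rewrite !mulr_ge0 ?powR_ge0 ?invr_ge0 ?exprn_ge0 ?(ltW G0) ?(ltW G2) ?ltW.
move=> t x t0 yx; have x0 : 0 < x by exact: lt_le_trans yx.
rewrite bessel_trans_scaleE// /bessel_scale x0 -EFinD lee_fin -lerBlDl.
have -> : x `^ (- (2 * nu)) - x `^ (- (2 * nu)) * (1 - poisson_defect nu (x ^+ 2 / (2 * t)))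
  = x `^ (- (2 * nu)) * poisson_defect nu (x ^+ 2 / (2 * t)) by ring.
have w0 : 0 < x ^+ 2 / (2 * t) by rewrite divr_gt0 ?exprn_gt0 ?mulr_gt0.
rewrite -[leRHS]mulrA -[leRHS]mulrA ler_pM ?powR_ge0 ?poisson_defect_ge0 ?(ltW w0)//.
  rewrite !powRN lef_pV2 ?posrE ?powR_gt0//.
  by apply: ge0_ler_powR; rewrite ?nnegrE ?mulr_ge0 ?(ltW nu0) ?(ltW x0) ?(ltW y0).
apply: (le_trans (poisson_defect_le nu0 w0)).
rewrite ler_pM2l; last exact: divr_gt0.
have -> : 4 / (y ^+ 2) ^+ 2 * t ^+ 2 = (y ^+ 2 / (2 * t)) ^- 2.
  by rewrite expr_div_n; field; rewrite !gt_eqF.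
rewrite lef_pV2 ?posrE ?exprn_gt0 ?divr_gt0 ?exprn_gt0 ?mulr_gt0//.
have yy : y ^+ 2 / (2 * t) <= x ^+ 2 / (2 * t).
  rewrite ler_pM2r ?invr_gt0 ?mulr_gt0//.
  by rewrite ler_pXn2r ?nnegrE ?(ltW y0) ?(ltW x0).
by rewrite ler_pXn2r ?nnegrE ?(ltW w0)// divr_ge0 ?sqr_ge0// mulr_ge0// ltW.
Qed.

Lemma bessel_trans_restrict_le t x r (f : R -> \bar R) (M : R) :
  0 < t -> 0 < r -> measurable_fun setT f -> (forall y, (0 <= f y)%E) ->
  (forall y, 0 < y -> y < r -> ((bessel_density nu t x y)%:E * f y <= M%:E)%E) ->
  (bessel_trans t (f \_ `]-oo, r[) x <= (M * r)%:E)%E.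
Proof.
move=> t0 r0 mf f0 h.
have mfr : measurable_fun setT (f \_ `]-oo, r[).
  by apply/(measurable_restrictT f) => //; exact: measurable_funTS.
rewrite bessel_trans_pos//.
have M0 : 0 <= M.
  have r2 : 0 < r / 2 by rewrite divr_gt0.
  have r2r : r / 2 < r by rewrite gtr_pMr// invf_lt1// ltr1n.
  by have := le_trans (mule_ge0 _ (f0 _)) (h _ r2 r2r); rewrite !lee_fin; apply; exact: bessel_density_ge0.
have -> : (\int[mu]_(y in `]0%R, +oo[) ((bessel_density nu t x y)%:E * (f \_ `]-oo, r[) y) =
    \int[mu]_(y in `]0%R, r[) ((bessel_density nu t x y)%:E * f y))%E.
  rewrite integral_mkcond [RHS]integral_mkcond; apply: eq_integral => y _.
  rewrite !patchE !mem_setE !in_itv/= andbT.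
  by case: ltP => // y0; case: ltP => yr //=; rewrite mule0.
apply: (@le_trans _ _ (\int[mu]_(y in `]0%R, r[) (cst M%:E y))%E).
  apply: ge0_le_integral => //.
  - by move=> y _; rewrite mule_ge0// lee_fin bessel_density_ge0.
  - apply: measurable_funTS; apply: emeasurable_funM => //; apply/measurable_EFinP.
    exact: (measurableT_comp (measurable_bessel_density t) (pair1_measurable x)).
  - by move=> y; rewrite /= in_itv/= => /andP[]; exact: h.
rewrite integral_cst//= lebesgue_measure_itv/= lte_fin r0 -EFinB subr0.
by rewrite -EFinM.
Qed.

(** The scale function is unbounded near [0] but its product with the density is not, as the
    Gaussian bound carries [y ^ (2 nu)]. [D] bounds the distance from [x] to []0, r[] from below: it
    is positive for jumps over a gap and [0] for large times. *)
Lemma bessel_trans_scale_small t x r D : 0 < t -> 0 < x -> 0 < r ->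
  (forall y, 0 < y -> y < r -> D ^+ 2 <= (x - y) ^+ 2) ->
  (bessel_trans t (bessel_scale \_ `]-oo, r[) x <=
   (bessel_cst * r * t `^ (- (1 + nu)) * expR (- (D ^+ 2 / (2 * t))) * r)%:E)%E.
Proof.
move=> t0 x0 r0 hD; apply: bessel_trans_restrict_le => //.
- exact: measurable_bessel_scale.
- exact: bessel_scale_ge0.
move=> y y0 yr; rewrite /bessel_scale y0 -EFinM lee_fin.
apply: (@le_trans _ _ (bessel_cst * (y `^ (2 * nu) * y) * t `^ (- (1 + nu)) * expR (- ((x - y) ^+ 2 / (2 * t))) * y `^ (- (2 * nu)))).
  by rewrite ler_pM2r ?powR_gt0// bessel_density_le.
rewrite (powRN y); have yn := powR_gt0 (2 * nu) y0.
rewrite [leLHS](_ : _ = bessel_cst * y * t `^ (- (1 + nu)) * expR (- ((x - y) ^+ 2 / (2 * t)))); last first.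
  by field; rewrite gt_eqF.
have c0 := ltW bessel_cst_gt0; have y0' := ltW y0.
rewrite ler_pM ?mulr_ge0 ?expR_ge0 ?powR_ge0//.
  rewrite ler_pM2r ?powR_gt0// ler_pM2l ?bessel_cst_gt0//; exact: ltW.
by rewrite ler_expR lerN2 ler_pM2r ?invr_gt0 ?mulr_gt0//; exact: hD.
Qed.

Lemma bessel_trans_small t x r : 0 < t -> 0 < x -> 0 < r ->
  (bessel_trans t (cst 1%E \_ `]-oo, r[) x <=
   (bessel_cst * (r `^ (2 * nu) * r) * t `^ (- (1 + nu)) * r)%:E)%E.
Proof.
move=> t0 x0 r0; apply: bessel_trans_restrict_le => //.
move=> y y0 yr; rewrite mule1 lee_fin.
apply: (le_trans (bessel_density_le t0 x0 y0)).
have c0 := ltW bessel_cst_gt0; have [y0' yr'] := (ltW y0, ltW yr).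
rewrite -[leRHS]mulr1 ler_pM ?mulr_ge0 ?expR_ge0 ?powR_ge0//; last first.
  by rewrite expR_le1 oppr_le0 divr_ge0 ?sqr_ge0// mulr_ge0// ltW.
rewrite ler_pM2r ?powR_gt0// ler_pM2l ?bessel_cst_gt0// ler_pM ?powR_ge0//.
by apply: ge0_ler_powR; rewrite ?nnegrE ?mulr_ge0 ?(ltW nu0) ?(ltW r0) ?(ltW y0).
Qed.

Lemma expRN_le_invX (v : R) m : 0 < v -> expR (- v) <= m.+1`!%:R / v ^+ m.+1.
Proof.
move=> v0; rewrite expRN -[leRHS]invf_div.
have f0 : 0 < m.+1`!%:R :> R by rewrite ltr0n fact_gt0.
rewrite lef_pV2 ?posrE ?expR_gt0 ?divr_gt0 ?exprn_gt0//.
by apply: le_trans (expR_ge1Dxn m (ltW v0)); rewrite lerDr.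
Qed.

Lemma bessel_trans_overshoot y r : 0 < r -> r < y -> exists2 K, 0 <= K & forall t x,
  0 < t -> t <= 1 -> y <= x ->
  (bessel_trans t (bessel_scale \_ `]-oo, r[) x <= (K * t ^+ 2)%:E)%E.
Proof.
(* A jump from [[y, +oo[] to below [r] has a Gaussian cost, smaller than every power of [t];
   [m + 1 >= nu + 3] makes up for the factor [t ^ (- (1 + nu))] and leaves [t ^ 2]. *)
move=> r0 ry; pose m := (Num.truncn (nu + 3)).
have mn : nu + 3 <= m.+1%:R by rewrite ltW// truncnS_gt.
have D0 : 0 < (y - r) ^+ 2 / 2 by rewrite divr_gt0// exprn_gt0// subr_gt0.
have c0 := bessel_cst_gt0.
exists (bessel_cst * r * r * (m.+1`!%:R / ((y - r) ^+ 2 / 2) ^+ m.+1)).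
  by rewrite !mulr_ge0 ?(ltW c0) ?invr_ge0 ?exprn_ge0 ?(ltW r0) ?(ltW D0).
move=> t x t0 t1 yx; have x0 : 0 < x by rewrite (lt_le_trans _ yx)// (lt_trans r0).
apply: le_trans (@bessel_trans_scale_small t x r (y - r) t0 x0 r0 _) _.
  move=> u u0 ur; rewrite ler_pXn2r ?nnegrE ?subr_ge0 ?(ltW ry)//; last first.
    by rewrite (le_trans (ltW ur))// (le_trans (ltW ry)).
  by rewrite lerB// ltW.
rewrite lee_fin.
have -> : (y - r) ^+ 2 / (2 * t) = (y - r) ^+ 2 / 2 / t by field; rewrite gt_eqF.
set D := (y - r) ^+ 2 / 2 in D0 *.
have Dt0 : 0 < D / t by rewrite divr_gt0.
have h := expRN_le_invX m Dt0.
apply: (@le_trans _ _ (bessel_cst * r * t `^ (- (1 + nu)) * (m.+1`!%:R / (D / t) ^+ m.+1) * r)).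
  by rewrite ler_pM2r// ler_pM2l// mulr_gt0 ?powR_gt0// mulr_gt0.
rewrite [leLHS](_ : _ = bessel_cst * r * r * (m.+1`!%:R / D ^+ m.+1) * (t `^ (- (1 + nu)) * t ^+ m.+1)); last first.
  by rewrite expr_div_n; field; rewrite !gt_eqF ?exprn_gt0.
rewrite ler_pM2l; last first.
  have f0 : 0 < m.+1`!%:R :> R by rewrite ltr0n fact_gt0.
  by rewrite !mulr_gt0// invr_gt0 exprn_gt0.
rewrite -!powR_mulrn ?(ltW t0)// -powRD ?(gt_eqF t0) ?implybT//.
by apply: ger_powR; [rewrite t0|lra].
Qed.

End BesselDensity.

(** * The Markov property *)

Section MonotoneClass.
Local Open Scope ereal_scope.
Context d (T : measurableType d) (R : realType).
Variable H : (T -> \bar R) -> Prop.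
Hypothesis H_indic : forall B, measurable B -> H (fun x => (\1_B x)%:E).
Hypothesis H_add : forall f g, measurable_fun setT f -> measurable_fun setT g ->
  (forall x, 0 <= f x) -> (forall x, 0 <= g x) -> H f -> H g -> H (fun x => f x + g x).
Hypothesis H_scale : forall (k : R) f, (0 <= k)%R -> measurable_fun setT f ->
  (forall x, 0 <= f x) -> H f -> H (fun x => k%:E * f x).
Hypothesis H_lim : forall f : (T -> \bar R)^nat, (forall n, measurable_fun setT (f n)) ->
  (forall n x, 0 <= f n x) -> (forall x, nondecreasing_seq (f ^~ x)) ->
  (forall n, H (f n)) -> H (fun x => limn (f ^~ x)).

Import HBNNSimple.

Lemma ge0_fun_ind f : measurable_fun setT f -> (forall x, 0 <= f x) -> H f.
Proof.
move=> mf f0; pose g := nnsfun_approx measurableT mf.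
have -> : f = fun x => limn (fun n => (g n x)%:E).
  by apply/funext => x; apply/esym/cvg_lim => //; exact: cvg_nnsfun_approx.
apply: (H_lim (f := fun n x => (g n x)%:E)).
- by move=> n; apply/measurable_EFinP.
- by move=> n x; rewrite lee_fin.
- by move=> x m n mn; rewrite lee_fin; exact/lefP/nd_nnsfun_approx.
move=> n; set h := g n.
(* [`|y|] keeps the coefficients nonnegative; the terms with [y < 0] vanish. *)
have [s hE] : exists s : seq R, forall x, (h x)%:E = \sum_(y <- s) (`|y|%:E * (\1_(h @^-1` [set y]) x)%:E).
  exists (finmap.enum_fset (fset_set (range h))) => x.
  rewrite fimfunE fsbig_finite//= -sumEFin; apply: eq_bigr => y _.
  rewrite -EFinM indicE; case: (boolP (x \in _)); last by rewrite !mulr0.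
  by rewrite inE/= => <-; rewrite ger0_norm.
rewrite (_ : (fun x => _) = fun x => \sum_(y <- s) (`|y|%:E * (\1_(h @^-1` [set y]) x)%:E)); last first.
  by apply/funext => x; exact: hE.
have mB y : measurable (h @^-1` [set y]) by [].
have mI y : measurable_fun setT (fun x => (\1_(h @^-1` [set y]) x)%:E : \bar R).
  by apply/measurable_EFinP.
elim: s {hE} => [|y s ih].
  under eq_fun do rewrite big_nil.
  by have := H_indic (@measurable0 _ T); congr H; apply/funext => x; rewrite indic0.
under eq_fun do rewrite big_cons.
apply: H_add => //.
- by apply: measurable_funeM.
- by apply: emeasurable_sum => z; exact: measurable_funeM.
- by move=> x; apply: sume_ge0 => z _; rewrite mule_ge0// lee_fin.
- by apply: H_scale => //; exact: H_indic.
Qed.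

End MonotoneClass.

Section Markov.
Variables (R : realType) (nu : R) (d : measure_display) (T : measurableType d).
Variables (P : probability T R) (X : R -> T -> R).
Hypothesis nu0 : 0 < nu.
Hypothesis mX : forall t, measurable_fun setT (X t).
Notation mu := (@lebesgue_measure R).
Implicit Types (t s : R) (A : set R) (E : set T) (l : seq (R * set R)).

Definition valid_times l := all (fun p => 0 < p.1) l /\ (forall p, p \in l -> measurable p.2).

Definition cylinder t l : set T :=
  [set w | all (fun q => `[< q.2 (X q.1 w) >]) (cum_times t l)].

Lemma cylinder_nil t : cylinder t [::] = setT.
Proof. exact/seteqP. Qed.

Lemma cylinder_cons t s A l :
  cylinder t ((s, A) :: l) = X (t + s) @^-1` A `&` cylinder (t + s) l.
Proof.
apply/seteqP; split => w; rewrite /cylinder/=.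
  by move=> /andP[/asboolP].
by case=> /asboolP -> ->.
Qed.

Lemma valid_times_cons s A l :
  valid_times ((s, A) :: l) <-> [/\ 0 < s, measurable A & valid_times l].
Proof.
split=> [[/=/andP[s0 al] ml]|[s0 mA [al ml]]].
  split => //; first by apply: (ml (s, A)); rewrite mem_head.
  by split => // p pl; apply: ml; rewrite inE pl orbT.
split; first by rewrite /= s0.
by move=> p; rewrite inE => /predU1P[->//|]; exact: ml.
Qed.

Lemma measurable_preimX t A : measurable A -> measurable (X t @^-1` A).
Proof. by move=> mA; rewrite -[X in measurable X]setTI; exact: mX. Qed.

Lemma measurable_cylinder t l : valid_times l -> measurable (cylinder t l).
Proof.
elim: l t => [|[s A] l ih] t; first by rewrite cylinder_nil.
move=> /valid_times_cons[s0 mA vl]; rewrite cylinder_cons.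
by apply: measurableI; [exact: measurable_preimX|exact: ih].
Qed.

Local Open Scope ereal_scope.

Lemma bessel_trans_ge0 t f x : (0 < t)%R -> (forall y, 0 <= f y) -> 0 <= bessel_trans nu t f x.
Proof.
by move=> t0 f0; apply: integral_ge0 => y _; rewrite mule_ge0// lee_fin bessel_density_ge0.
Qed.

Lemma measurable_bessel_integrand t f : measurable_fun setT f ->
  measurable_fun setT (fun z : R * R => (bessel_density nu t z.1 z.2)%:E * f z.2).
Proof.
move=> mf; apply: emeasurable_funM.
  by apply/measurable_EFinP; exact: measurable_bessel_density.
exact: measurableT_comp.
Qed.

Lemma measurable_bessel_integrand1 t f x : measurable_fun setT f ->
  measurable_fun setT (fun y => (bessel_density nu t x y)%:E * f y).
Proof.
by move=> mf; exact: (measurableT_comp (measurable_bessel_integrand t mf) (pair1_measurable x)).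
Qed.

Lemma measurable_bessel_trans t f : (0 < t)%R -> measurable_fun setT f ->
  (forall y, 0 <= f y) -> measurable_fun setT (bessel_trans nu t f).
Proof.
move=> t0 mf f0.
apply: (@measurable_fun_fubini_tonelli_F _ _ _ _ _ mu (fun z : R * R => (bessel_density nu t z.1 z.2)%:E * f z.2)).
  exact: measurable_bessel_integrand.
by move=> z; rewrite mule_ge0// lee_fin bessel_density_ge0.
Qed.

Lemma bessel_fdd_cons x s A l : bessel_fdd nu x ((s, A) :: l) =
  bessel_trans nu s ((fun y => bessel_fdd nu y l) \_ A) x.
Proof.
rewrite /= /bessel_trans integral_mkcond; apply: eq_integral => y _.
by rewrite !patchE; case: ifP => // _; rewrite mule0.
Qed.

Lemma bessel_fdd_ge0 x l : valid_times l -> 0 <= bessel_fdd nu x l.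
Proof.
elim: l x => [|[s A] l ih] x vl //.
move/valid_times_cons : vl => [s0 mA vl]; rewrite bessel_fdd_cons bessel_trans_ge0// => y.
by rewrite patchE; case: ifP => // _; exact: ih.
Qed.

Lemma measurable_bessel_fdd l : valid_times l -> measurable_fun setT (fun x => bessel_fdd nu x l).
Proof.
elim: l => [|[s A] l ih]; first by move=> _; exact: measurable_cst.
move=> /valid_times_cons[s0 mA vl].
rewrite (_ : (fun x => _) = bessel_trans nu s ((fun y => bessel_fdd nu y l) \_ A)); last first.
  by apply/funext => x; exact: bessel_fdd_cons.
apply: measurable_bessel_trans => //.
  by apply/(measurable_restrictT (fun y => bessel_fdd nu y l)) => //; apply: measurable_funTS; exact: ih.
by move=> y; rewrite patchE; case: ifP => // _; exact: bessel_fdd_ge0.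
Qed.

(* Plays the role of "[E] is in the past of [t]": only this consequence of the
   Markov property is needed, so no filtration is introduced. *)
Definition markov_at t E := measurable E /\ forall A l, measurable A -> valid_times l ->
  P (E `&` X t @^-1` A `&` cylinder t l) =
  \int[P]_(w in E `&` X t @^-1` A) bessel_fdd nu (X t w) l.

Lemma measurable_fdd_comp t l : valid_times l ->
  measurable_fun setT (fun w => bessel_fdd nu (X t w) l).
Proof. by move=> vl; exact: (measurableT_comp (measurable_bessel_fdd vl)). Qed.

Lemma markov_setI t E A : markov_at t E -> measurable A -> markov_at t (E `&` X t @^-1` A).
Proof.
move=> [mE hE] mA; split; first by apply: measurableI => //; exact: measurable_preimX.
move=> B l mB vl; rewrite -(setIA E) -preimage_setI.
by apply: hE => //; exact: measurableI.
Qed.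

(** This and the next lemma carry [markov_at] from grid events to events on the whole path before
    [t]. The terms for [F] are finite, so the identities for [E] and [F] can be subtracted. *)
Lemma markov_setD t E F : F `<=` E -> markov_at t E -> markov_at t F -> markov_at t (E `\` F).
Proof.
move=> FE [mE hE] [mF hF]; split; first exact: measurableD.
move=> A l mA vl.
have mA' := measurable_preimX t mA; have mC := measurable_cylinder t vl.
have f0 w : 0 <= bessel_fdd nu (X t w) l by exact: bessel_fdd_ge0.
have mf := measurable_fdd_comp t vl.
have mFA : measurable (F `&` X t @^-1` A) by exact: measurableI.
have mEA : measurable (E `&` X t @^-1` A) by exact: measurableI.
have mEFA : measurable ((E `\` F) `&` X t @^-1` A) by apply: measurableI => //; exact: measurableD.
have fin : P (F `&` X t @^-1` A `&` cylinder t l) \is a fin_num.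
  by apply: fin_num_measure; exact: measurableI.
have key : P ((E `\` F) `&` X t @^-1` A `&` cylinder t l) + P (F `&` X t @^-1` A `&` cylinder t l) =
  \int[P]_(w in (E `\` F) `&` X t @^-1` A) bessel_fdd nu (X t w) l + P (F `&` X t @^-1` A `&` cylinder t l).
  rewrite -measureU//; last 3 first.
  - exact: measurableI.
  - exact: measurableI.
  - by apply/seteqP; split => // w [[[[_ nF] _] _] [[Fw _] _]].
  rewrite hF// -ge0_integral_setU//; last 2 first.
  - exact: measurable_funTS.
  - by apply/disj_setPRL => w [Fw _] [[_ +] _]; apply.
  have EF : E `\` F `|` F = E by rewrite setUC setDUK.
  by rewrite -!setIUl EF; exact: hE.
by have := congr1 (fun z => z - P (F `&` X t @^-1` A `&` cylinder t l)) key; rewrite !addeK.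
Qed.

Lemma markov_bigcup t (F : (set T)^nat) : nondecreasing_seq F ->
  (forall n, markov_at t (F n)) -> markov_at t (\bigcup_n F n).
Proof.
move=> ndF hF; split; first by apply: bigcup_measurable => n _; exact: (hF n).1.
move=> A l mA vl.
have mA' := measurable_preimX t mA; have mC := measurable_cylinder t vl.
have ndG B : nondecreasing_seq (fun n => F n `&` B).
  by move=> m n mn; apply/subsetPset; apply: setSI; exact/subsetPset/ndF.
have h1 : (fun n => P (F n `&` X t @^-1` A `&` cylinder t l)) @ \oo -->
    P (\bigcup_n F n `&` X t @^-1` A `&` cylinder t l).
  rewrite -setIA setI_bigcupl.
  under eq_fun do rewrite -setIA.
  apply: (@nondecreasing_cvg_mu _ _ _ P (fun n => F n `&` (X t @^-1` A `&` cylinder t l))).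
  - by move=> n; apply: measurableI; [exact: (hF n).1|exact: measurableI].
  - apply: bigcup_measurable => n _.
    by apply: measurableI; [exact: (hF n).1|exact: measurableI].
  - exact: ndG.
have h2 : (fun n => \int[P]_(w in F n `&` X t @^-1` A) bessel_fdd nu (X t w) l) @ \oo -->
    \int[P]_(w in \bigcup_n F n `&` X t @^-1` A) bessel_fdd nu (X t w) l.
  rewrite setI_bigcupl; apply: ge0_nondecreasing_set_cvg_integral => //.
  - by move=> n; apply: measurableI => //; exact: (hF n).1.
  - by move=> n; apply: measurable_funTS; exact: measurable_fdd_comp.
  - by move=> n w _; exact: bessel_fdd_ge0.
have h3 : (fun n => P (F n `&` X t @^-1` A `&` cylinder t l)) =
    (fun n => \int[P]_(w in F n `&` X t @^-1` A) bessel_fdd nu (X t w) l).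
  by apply/funext => n; exact: (hF n).2.
by rewrite h3 in h1; exact: cvg_unique h1 h2.
Qed.

(** For the indicator of [B] this is [markov_at] with the one-entry list [[:: (s, B)]]; a monotone
    class argument extends it to all nonnegative [f]. *)
Lemma markov_trans t s E f : markov_at t E -> (0 < s)%R -> measurable_fun setT f ->
  (forall x, 0 <= f x) ->
  \int[P]_(w in E) f (X (t + s) w) = \int[P]_(w in E) bessel_trans nu s f (X t w).
Proof.
move=> [mE hE] s0; move: f.
have p0 x y : 0 <= (bessel_density nu s x y)%:E by rewrite lee_fin bessel_density_ge0.
have mfX r (f : R -> \bar R) : measurable_fun setT f -> measurable_fun E (fun w => f (X r w)).
  by move=> mf; apply: measurable_funTS; exact: measurableT_comp.
apply: ge0_fun_ind.
- move=> B mB.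
  have vl : valid_times [:: (s, B)] by apply/valid_times_cons.
  have := hE setT _ measurableT vl; rewrite preimage_setT setIT cylinder_cons cylinder_nil setIT.
  under [RHS]eq_integral do rewrite bessel_fdd_cons.
  rewrite setIC -integral_indic; [|exact: mE|exact: measurable_preimX].
  move=> ->; apply: eq_integral => w _; congr bessel_trans.
  by apply/funext => y; rewrite patchE indicE/=; case: ifP.
- move=> f g mf mg f0 g0 hf hg.
  rewrite ge0_integralD; [|exact: mE|by move=> w _|exact: mfX|by move=> w _|exact: mfX].
  rewrite hf hg -ge0_integralD; last 5 first.
  - exact: mE.
  - by move=> w _; exact: bessel_trans_ge0.
  - by apply: (mfX _ (bessel_trans nu s f)); exact: measurable_bessel_trans.
  - by move=> w _; exact: bessel_trans_ge0.
  - by apply: (mfX _ (bessel_trans nu s g)); exact: measurable_bessel_trans.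
  apply: eq_integral => w _; rewrite /bessel_trans -ge0_integralD//; last 4 first.
  - by move=> y _; exact: mule_ge0.
  - exact: measurable_bessel_integrand1.
  - by move=> y _; exact: mule_ge0.
  - exact: measurable_bessel_integrand1.
  by apply: eq_integral => y _; rewrite ge0_muleDr.
- move=> k f k0 mf f0 hf.
  rewrite ge0_integralZl_EFin; [|exact: mE|by move=> w _|exact: mfX|exact: k0].
  rewrite hf -ge0_integralZl_EFin; last 4 first.
  - exact: mE.
  - by move=> w _; exact: bessel_trans_ge0.
  - by apply: (mfX _ (bessel_trans nu s f)); exact: measurable_bessel_trans.
  - exact: k0.
  apply: eq_integral => w _; rewrite /bessel_trans -ge0_integralZl_EFin//; last 2 first.
  - by move=> y _; exact: mule_ge0.
  - exact: measurable_bessel_integrand1.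
  by apply: eq_integral => y _; rewrite muleCA.
- move=> f mf f0 ndf hf.
  rewrite monotone_convergence//; last by move=> n; exact: mfX.
  under eq_fun do rewrite hf.
  rewrite -monotone_convergence//; last 3 first.
  - by move=> n; apply: (mfX _ (bessel_trans nu s (f n))); exact: measurable_bessel_trans.
  - by move=> n w _; exact: bessel_trans_ge0.
  - move=> w _ m n mn; apply: ge0_le_integral => //.
    + by move=> y _; exact: mule_ge0.
    + exact: measurable_bessel_integrand1.
    + exact: measurable_bessel_integrand1.
    + by move=> y _; apply: lee_wpmul2l => //; exact: ndf.
  apply: eq_integral => w _; rewrite /bessel_trans.
  rewrite -monotone_convergence//; last 3 first.
  - by move=> n; exact: measurable_bessel_integrand1.
  - by move=> n y _; exact: mule_ge0.
  - by move=> y _ m n mn; apply: lee_wpmul2l => //; exact: ndf.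
  apply: eq_integral => y _; apply/cvg_lim => //.
  apply: cvgeZl => //.
  by apply: ereal_nondecreasing_is_cvgn; exact: ndf.
Qed.

Lemma markov_step t s E A : markov_at t E -> (0 < s)%R -> measurable A ->
  markov_at (t + s) (E `&` X (t + s) @^-1` A).
Proof.
move=> mkE s0 mA; apply: markov_setI => //; have [mE hE] := mkE; split => // B l mB vl.
(* The entry [(s, B)] put in front turns a list for time [t + s] into one for time [t]. *)
have vl' : valid_times ((s, B) :: l) by apply/valid_times_cons.
have := hE setT _ measurableT vl'; rewrite preimage_setT setIT cylinder_cons setIA => ->.
under eq_integral do rewrite bessel_fdd_cons.
rewrite -markov_trans//; last 2 first.
- apply/(measurable_restrictT (fun y => bessel_fdd nu y l)) => //; apply: measurable_funTS.
  exact: measurable_bessel_fdd.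
- by move=> y; rewrite patchE; case: ifP => // _; exact: bessel_fdd_ge0.
by rewrite [RHS]integral_mkcondr; apply: eq_integral => w _; rewrite !patchE; congr (if _ then _ else _); apply/idP/idP; rewrite !inE.
Qed.

End Markov.

(** * Hitting probabilities *)

Section Hitting.
Variables (R : realType) (nu : R) (d : measure_display) (T : measurableType d).
Variables (P : probability T R) (X : R -> T -> R).
Hypothesis nu0 : 0 < nu.
Hypothesis mX : forall t, measurable_fun setT (X t).
Hypothesis cX : forall w, {within `[0, +oo[%classic, continuous (fun s => X s w)}.
Implicit Types (t s : R) (A : set R) (E F : set T).
Local Open Scope ereal_scope.

Definition energy t E := \int[P]_(w in E) bessel_scale nu (X t w).

Lemma energy_ge0 t E : 0 <= energy t E.
Proof. by apply: integral_ge0 => w _; exact: bessel_scale_ge0. Qed.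

Lemma measurable_scaleX t E : measurable_fun E (fun w => bessel_scale nu (X t w)).
Proof. by apply: measurable_funTS; exact: (measurableT_comp (measurable_bessel_scale nu)). Qed.

Lemma le_energy t E F : measurable E -> measurable F -> E `<=` F -> energy t E <= energy t F.
Proof.
move=> mE mF EF; apply: ge0_subset_integral => //.
  exact: measurable_scaleX.
by move=> w _; exact: bessel_scale_ge0.
Qed.

Lemma energyU t E F : measurable E -> measurable F -> E `&` F = set0 ->
  energy t (E `|` F) = energy t E + energy t F.
Proof.
move=> mE mF EF; rewrite /energy ge0_integral_setU//.
- exact: measurable_scaleX.
- by move=> w _; exact: bessel_scale_ge0.
- exact/disj_set2P.
Qed.

Lemma measurable_below t y : measurable (X t @^-1` `]-oo, y[).
Proof. exact: measurable_preimX. Qed.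

Lemma measurable_above t y : measurable (X t @^-1` `[y, +oo[).
Proof. exact: measurable_preimX. Qed.

Lemma below_above t y E :
  E = (E `&` X t @^-1` `]-oo, y[) `|` (E `&` X t @^-1` `[y, +oo[).
Proof.
rewrite -setIUr -preimage_setU [X in _ @^-1` X](_ : _ = setT) ?preimage_setT ?setIT//.
by apply/seteqP; split => // x _ /=; rewrite !in_itv/= andbT; case: ltP; [left|right].
Qed.

Lemma below_above0 t y E :
  (E `&` X t @^-1` `]-oo, y[) `&` (E `&` X t @^-1` `[y, +oo[) = set0.
Proof.
apply/seteqP; split => // w [[_ /=]]; rewrite in_itv/= => h [_ /=]; rewrite in_itv/= andbT.
by rewrite leNgt h.
Qed.

Lemma energy_split t y E : measurable E -> energy t E =
  energy t (E `&` X t @^-1` `]-oo, y[) + energy t (E `&` X t @^-1` `[y, +oo[).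
Proof.
move=> mE; rewrite [in LHS](below_above t y E) energyU//.
- by apply: measurableI => //; exact: measurable_below.
- by apply: measurableI => //; exact: measurable_above.
- exact: below_above0.
Qed.

Lemma energyS t s E : markov_at nu P X t E -> (0 < s)%R ->
  energy (t + s) E = \int[P]_(w in E) bessel_trans nu s (bessel_scale nu) (X t w).
Proof.
move=> mk s0; apply: (markov_trans nu0 mX mk s0).
  exact: measurable_bessel_scale.
exact: bessel_scale_ge0.
Qed.

Lemma measurable_transX t s (f : R -> \bar R) E : (0 < s)%R -> measurable_fun setT f -> (forall x, 0 <= f x) ->
  measurable_fun E (fun w => bessel_trans nu s f (X t w)).
Proof.
move=> s0 mf f0; apply: measurable_funTS.
by apply: (measurableT_comp (measurable_bessel_trans nu0 s0 mf f0)).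
Qed.

Lemma energy_nonincr t s E : markov_at nu P X t E -> (0 < s)%R -> energy (t + s) E <= energy t E.
Proof.
move=> mk s0; rewrite energyS//; apply: ge0_le_integral => //.
- exact: mk.1.
- by move=> w _; apply: bessel_trans_ge0 => // y; exact: bessel_scale_ge0.
- by apply: measurable_transX => //; [exact: measurable_bessel_scale|exact: bessel_scale_ge0].
- exact: measurable_scaleX.
- by move=> w _; exact: bessel_trans_scale_super.
Qed.

(** The bound on the semigroup is uniform in the position at time [t], so only the probability of
    [E] is left. *)
Lemma energy_decay t s E : markov_at nu P X t E -> (0 < s)%R ->
  E `<=` [set w | (0 < X t w)%R] ->
  energy (t + s) E <= (bessel_cst nu * s `^ (- nu))%:E * P E.
Proof.
move=> mk s0 E0; rewrite energyS// -integral_cst; last exact: mk.1.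
apply: ge0_le_integral => //.
- exact: mk.1.
- by move=> w _; apply: bessel_trans_ge0 => // y; exact: bessel_scale_ge0.
- by apply: measurable_transX => //; [exact: measurable_bessel_scale|exact: bessel_scale_ge0].
- by move=> w Ew; apply: bessel_trans_scale_le => //; exact: E0.
Qed.

Lemma prob_below_energy t y E : (0 < y)%R -> measurable E ->
  P (E `&` X t @^-1` `]-oo, y[) <= (y `^ (2 * nu))%:E * energy t (E `&` X t @^-1` `]-oo, y[).
Proof.
move=> y0 mE; set F := _ `&` _.
have mF : measurable F by apply: measurableI => //; exact: measurable_below.
rewrite -[P F]mul1e -[1%E]/(1%R%:E) -integral_cst//.
rewrite -ge0_integralZl_EFin//; last 3 first.
- by move=> w _; exact: bessel_scale_ge0.
- exact: measurable_scaleX.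
- exact: powR_ge0.
apply: ge0_le_integral => //.
  by apply: measurable_funeM; exact: measurable_scaleX.
move=> w [_ /=]; rewrite in_itv/= => Xy; rewrite /bessel_scale; case: ifPn => X0.
  rewrite -EFinM lee_fin powRN -ler_pdivrMr ?invr_gt0 ?powR_gt0// invrK mul1r.
  by apply: ge0_ler_powR; rewrite ?nnegrE ?mulr_ge0 ?(ltW nu0) ?(ltW X0) ?(ltW y0) ?(ltW Xy).
(* Where [X t <= 0] the scale function is [+oo], so the lower bound [1] holds there too. *)
by rewrite gt0_muley ?lte_fin ?powR_gt0// leey.
Qed.

(** The recursion appends the latest time, which is the form that [markov_step] and the two
    inductions along the grid need; [stayE] is the closed form, with [n + 1] grid times. *)
Fixpoint stay E t s y n : set T :=
  if n is n'.+1 then stay E t s y n' `&` X (t + n'%:R * s + s) @^-1` `[y, +oo[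
  else E `&` X t @^-1` `[y, +oo[.

Lemma stayE E t s y n :
  stay E t s y n = E `&` [set w | forall j, (j <= n)%N -> (y <= X (t + j%:R * s) w)%R].
Proof.
elim: n => [|n ih] /=.
  apply/seteqP; split => w [Ew /=]; rewrite in_itv/= andbT => h; split => //=.
    by move=> j; rewrite leqn0 => /eqP ->; rewrite mul0r addr0.
  by have := h 0%N (leqnn _); rewrite mul0r addr0.
rewrite ih; apply/seteqP; split => w.
  move=> [[Ew h]/=]; rewrite in_itv/= andbT => Xn; split => // j.
  rewrite leq_eqVlt => /predU1P[->|]; last by rewrite ltnS; exact: h.
  by rewrite -natr1 mulrDl mul1r addrA.
move=> [Ew /= h]; split; first by split => //= j jn; apply: h; rewrite (leq_trans jn).
by rewrite /= in_itv/= andbT; have := h n.+1 (leqnn _); rewrite -natr1 mulrDl mul1r addrA.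
Qed.

Lemma stay_sub E t s y n : stay E t s y n `<=` E.
Proof. by rewrite stayE => w []. Qed.

Lemma stay_above E t s y n : stay E t s y n `<=` [set w | (y <= X (t + n%:R * s) w)%R].
Proof. by rewrite stayE => w [_ /= h]; exact: h. Qed.

Lemma markov_stay E t s y n : markov_at nu P X t E -> (0 < s)%R ->
  markov_at nu P X (t + n%:R * s) (stay E t s y n).
Proof.
move=> mk s0; elim: n => [|n ih] /=.
  by rewrite mul0r addr0; apply: markov_setI.
have -> : (t + n.+1%:R * s = t + n%:R * s + s)%R by rewrite -natr1 mulrDl mul1r addrA.
exact: (markov_step nu0 mX ih s0).
Qed.

Lemma measurable_stay E t s y n : measurable E -> measurable (stay E t s y n).
Proof.
move=> mE; elim: n => [|n ih] /=; apply: measurableI => //; exact: measurable_above.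
Qed.

Lemma stayD E t s y n : E `\` stay E t s y n.+1 =
  (E `\` stay E t s y n) `|` (stay E t s y n `&` X (t + n%:R * s + s) @^-1` `]-oo, y[).
Proof.
rewrite /=; have sE := @stay_sub E t s y n.
apply/seteqP; split => w.
  move=> [Ew]; case: (pselect (stay E t s y n w)) => sw; last by left.
  move=> nh; right; split => //=; rewrite in_itv/= ltNge; apply/negP => h.
  by apply: nh; split => //=; rewrite in_itv/= andbT.
case=> [[Ew ns]|[sw /=]]; first by split => // -[/ns].
rewrite in_itv/= => h; split; first exact: sE.
by move=> [_ /=]; rewrite in_itv/= andbT leNgt h.
Qed.

Lemma prob_stayD E t s y n : measurable E -> P (E `\` stay E t s y n.+1) =
  P (E `\` stay E t s y n) + P (stay E t s y n `&` X (t + n%:R * s + s) @^-1` `]-oo, y[).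
Proof.
move=> mE; rewrite stayD measureU//.
- by apply: measurableD => //; exact: measurable_stay.
- by apply: measurableI; [exact: measurable_stay|exact: measurable_below].
- by apply/seteqP; split => // w [[_ ns] [/ns]].
Qed.

(** Doob's argument: at each grid time the energy given up on the paths found below [y] pays for
    their probability, and on the remaining paths the energy does not increase. *)
Lemma maximal_grid E t s y n : markov_at nu P X t E -> (0 < s)%R -> (0 < y)%R ->
  P (E `\` stay E t s y n) + (y `^ (2 * nu))%:E * energy (t + n%:R * s) (stay E t s y n)
   <= (y `^ (2 * nu))%:E * energy t E.
Proof.
move=> mk s0 y0; have mE := mk.1.
have e0 : 0 <= (y `^ (2 * nu))%:E by rewrite lee_fin powR_ge0.
have one r F : measurable F ->
    P (F `&` X r @^-1` `]-oo, y[) + (y `^ (2 * nu))%:E * energy r (F `&` X r @^-1` `[y, +oo[)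
    <= (y `^ (2 * nu))%:E * energy r F.
  move=> mF; rewrite (energy_split r y mF) [leRHS]ge0_muleDr ?energy_ge0//.
  by apply: leeD => //; exact: prob_below_energy.
elim: n => [|n ih].
  rewrite mul0r addr0 (_ : E `\` _ = E `&` X t @^-1` `]-oo, y[); first exact: one.
  apply/seteqP; split => w [Ew h]; split => //.
    by rewrite /= in_itv/= ltNge; apply/negP => h'; apply: h; split => //=; rewrite in_itv/= andbT.
  by move: h => /=; rewrite in_itv/= => h [_ /=]; rewrite in_itv/= andbT leNgt h.
have -> : (t + n.+1%:R * s = t + n%:R * s + s)%R by rewrite -natr1 mulrDl mul1r addrA.
rewrite (prob_stayD _ _ _ _ mE) -addeA; apply: le_trans ih; apply: leeD; first exact: lexx.
apply: le_trans (one _ _ (measurable_stay _ _ _ _ mE)) _.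
apply: lee_wpmul2l; first exact: e0.
by apply: energy_nonincr; [exact: markov_stay|exact: s0].
Qed.

(* The loss is quadratic in the step, so that it vanishes along refining grids. *)
Lemma energy_loss_step (y z : R) : (0 < z)%R -> (z < y)%R -> exists2 K : R, (0 <= K)%R &
  forall t s F, markov_at nu P X t F -> F `<=` [set w | (y <= X t w)%R] ->
    (0 < s)%R -> (s <= 1)%R ->
    energy t F <= energy (t + s) (F `&` X (t + s) @^-1` `[y, +oo[)
      + (z `^ (- (2 * nu)))%:E * P (F `&` X (t + s) @^-1` `]-oo, y[) + (K * s ^+ 2)%:E.
Proof.
move=> z0 zy; have y0 : (0 < y)%R := lt_trans z0 zy.
have [K1 K10 h1] := bessel_trans_scale_sub nu0 y0.
have [K2 K20 h2] := bessel_trans_overshoot nu0 z0 zy.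
exists (K1 + K2)%R; first exact: addr_ge0.
move=> t s F mk Fy s0 s1; have mF := mk.1.
have S0 := @bessel_scale_ge0 R nu; have mS := measurable_bessel_scale nu.
have mSz : measurable_fun setT (bessel_scale nu \_ `]-oo, z[).
  by apply/(measurable_restrictT (bessel_scale nu)) => //; exact: measurable_funTS.
have Sz0 x : 0 <= (bessel_scale nu \_ `]-oo, z[) x by rewrite patchE; case: ifP.
have T0 w : 0 <= bessel_trans nu s (bessel_scale nu) (X t w) by exact: bessel_trans_ge0.
(* From positions above [y] the mean of the scale function falls by at most [K1 s ^ 2] in one
   step. *)
have step1 : energy t F <= energy (t + s) F + (K1 * s ^+ 2)%:E.
  apply: (@le_trans _ _ (\int[P]_(w in F) (bessel_trans nu s (bessel_scale nu) (X t w) + (K1 * s ^+ 2)%:E))).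
    apply: ge0_le_integral => //.
    - exact: measurable_scaleX.
    - by apply: emeasurable_funD => //; exact: measurable_transX.
    - by move=> w Fw; apply: h1 => //; exact: Fy.
  have k0 : 0 <= (K1 * s ^+ 2)%:E by rewrite lee_fin mulr_ge0// sqr_ge0.
  rewrite ge0_integralD//; last exact: measurable_transX.
  rewrite -energyS//; apply: leeD => //.
  by rewrite integral_cst// -[leRHS]mule1; apply: lee_wpmul2l => //; exact: probability_le1.
apply: (le_trans step1).
rewrite (energy_split (t + s) y mF).
(* Paths between [z] and [y] have scale at most [z ^ (- 2 nu)]; those below [z] have jumped over the
   gap from [y] to [z] in one step. *)
have step2 : energy (t + s) (F `&` X (t + s) @^-1` `]-oo, y[) <=
    (z `^ (- (2 * nu)))%:E * P (F `&` X (t + s) @^-1` `]-oo, y[) + (K2 * s ^+ 2)%:E.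
  set G := F `&` _.
  have mG : measurable G by apply: measurableI => //; exact: measurable_below.
  have q0 : 0 <= (z `^ (- (2 * nu)))%:E by rewrite lee_fin powR_ge0.
  have mc : measurable_fun G (fun w => (bessel_scale nu \_ `]-oo, z[) (X (t + s) w)).
    by apply: measurable_funTS; exact: (measurableT_comp mSz).
  apply: (@le_trans _ _ (\int[P]_(w in G) ((z `^ (- (2 * nu)))%:E + (bessel_scale nu \_ `]-oo, z[) (X (t + s) w)))).
    apply: ge0_le_integral => //.
    - exact: measurable_scaleX.
    - by apply: emeasurable_funD.
    - move=> w _; rewrite patchE; case: ifPn => [_|].
        by rewrite leeDr.
      rewrite notin_setE/= in_itv/= => /negP; rewrite -leNgt => zX.
      rewrite adde0 /bessel_scale (lt_le_trans z0 zX) lee_fin !powRN lef_pV2 ?posrE ?powR_gt0 ?(lt_le_trans z0 zX)//.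
      by apply: ge0_ler_powR; rewrite ?nnegrE ?mulr_ge0 ?(ltW nu0) ?(ltW z0) ?(le_trans (ltW z0) zX).
  rewrite ge0_integralD//.
  rewrite integral_cst//; apply: leeD => //.
  apply: (@le_trans _ _ (\int[P]_(w in F) (bessel_scale nu \_ `]-oo, z[) (X (t + s) w))).
    apply: ge0_subset_integral => //.
    - by apply: measurable_funTS; exact: (measurableT_comp mSz).
    - by move=> w [].
  rewrite (markov_trans nu0 mX mk s0 mSz Sz0).
  apply: (@le_trans _ _ (\int[P]_(w in F) (cst (K2 * s ^+ 2)%:E w))).
    apply: ge0_le_integral => //.
    - by move=> w _; exact: bessel_trans_ge0.
    - exact: measurable_transX.
    - by move=> w Fw; apply: h2 => //; exact: Fy.
  rewrite integral_cst// -[leRHS]mule1; apply: lee_wpmul2l; last exact: probability_le1.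
  by rewrite lee_fin mulr_ge0// sqr_ge0.
have -> : ((K1 + K2) * s ^+ 2)%:E = (K1 * s ^+ 2)%:E + (K2 * s ^+ 2)%:E by rewrite mulrDl.
apply: (le_trans (leeD (leeD step2 (lexx _)) (lexx _))).
by rewrite (ACl ((3*1)*(4*2))%AC).
Qed.

Lemma energy_loss_grid (y z : R) : (0 < z)%R -> (z < y)%R -> exists2 K : R, (0 <= K)%R &
  forall t s E n, markov_at nu P X t E -> E `<=` [set w | (y <= X t w)%R] ->
    (0 < s)%R -> (s <= 1)%R ->
    energy t E <= energy (t + n%:R * s) (stay E t s y n)
      + (z `^ (- (2 * nu)))%:E * P (E `\` stay E t s y n) + (n%:R * (K * s ^+ 2))%:E.
Proof.
move=> z0 zy; have [K K0 h] := energy_loss_step z0 zy; exists K => //.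
move=> t s E n mk Ey s0 s1; have mE := mk.1.
have q0 : 0 <= (z `^ (- (2 * nu)))%:E by rewrite lee_fin powR_ge0.
elim: n => [|n ih].
  rewrite mul0r addr0 mul0r adde0.
  have -> : stay E t s y 0 = E.
    by apply/seteqP; split => [w []//|w Ew]; split => //=; rewrite in_itv/= andbT; exact: Ey.
  by rewrite setDv measure0 mule0 adde0.
have -> : (t + n.+1%:R * s = t + n%:R * s + s)%R by rewrite -natr1 mulrDl mul1r addrA.
apply: (le_trans ih).
have H := h _ _ _ (markov_stay y n mk s0) (@stay_above E t s y n) s0 s1.
apply: (le_trans (leeD (leeD H (lexx _)) (lexx _))).
rewrite prob_stayD// [_ * (P _ + P _)]ge0_muleDr//.
have -> : (n.+1%:R * (K * s ^+ 2))%:E = (n%:R * (K * s ^+ 2))%:E + (K * s ^+ 2)%:E.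
  by rewrite -natr1 mulrDl mul1r.
by rewrite (ACl ((1*(4*2))*(5*3))%AC).
Qed.

End Hitting.

(** * From dyadic grids to continuous time *)

Lemma within_continuous_lt (R : realType) (f : R -> R) (s y : R) :
  {within `[0, +oo[%classic, continuous f} -> 0 <= s -> f s < y ->
  exists2 e, 0 < e & forall u, 0 <= u -> `|u - s| < e -> f u < y.
Proof.
move=> cf s0 fy.
have : \forall u \near within `[0, +oo[%classic (nbhs s), f u < y.
  have := cf s; rewrite /continuous_at nbhs_subspace_in; last by rewrite /= in_itv/= s0.
  by move=> /cvgr_lt; apply.
rewrite /within/= => /nbhs_ballP[e /= e0 he]; exists e => // u u0 us.
by apply: (he u); [rewrite /ball/= distrC|rewrite /= in_itv/= u0].
Qed.

Lemma dyadic_lt (R : realType) (f : R -> R) (t tau s y : R) :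
  {within `[0, +oo[%classic, continuous f} -> 0 <= t -> 0 < tau ->
  t <= s -> s <= t + tau -> f s < y ->
  exists m j, (j <= 2 ^ m)%N /\ f (t + j%:R * (tau / (2 ^ m)%:R)) < y.
Proof.
move=> cf t0 tau0 ts st fy.
have [e e0 he] := within_continuous_lt cf (le_trans t0 ts) fy.
pose m := (Num.truncn (tau / e)).+1.
have m0 : 0 < (2 ^ m)%:R :> R by rewrite ltr0n expn_gt0.
have tm : tau / (2 ^ m)%:R < e.
  rewrite ltr_pdivrMr// mulrC -ltr_pdivrMr//.
  apply: (lt_trans (truncnS_gt _)).
  by rewrite ltr_nat -/m ltn_expl.
set dl := tau / (2 ^ m)%:R in tm *.
have dl0 : 0 < dl by rewrite divr_gt0.
have q0 : 0 <= (s - t) / dl by rewrite divr_ge0 ?subr_ge0// ltW.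
(* The last grid point not after [s] is within one mesh of it. *)
exists m, (Num.truncn ((s - t) / dl)); split.
  rewrite -(ler_nat R); apply: (@le_trans _ _ ((s - t) / dl)).
    by rewrite truncn_le.
  rewrite ler_pdivrMr// /dl mulrC divfK ?gt_eqF//; lra.
have /andP[h1 h2] := truncn_itv q0.
rewrite ler_pdivlMr// in h1; rewrite ltr_pdivrMr// -natr1 mulrDl mul1r in h2.
apply: he.
  by rewrite addr_ge0// mulr_ge0// ltW.
move: (_ * dl) h1 h2 => q h1 h2.
by rewrite ler0_norm; lra.
Qed.

Section Hit.
Variables (R : realType) (nu : R) (d : measure_display) (T : measurableType d).
Variables (P : probability T R) (X : R -> T -> R).
Hypothesis nu0 : 0 < nu.
Hypothesis mX : forall t, measurable_fun setT (X t).
Hypothesis cX : forall w, {within `[0, +oo[%classic, continuous (fun s => X s w)}.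
Implicit Types (t s y z tau : R) (A : set R) (E F : set T).

Definition hit t tau y : set T := [set w | exists s, [/\ t <= s, s <= t + tau & X s w < y]].

Definition hit_ever t y : set T := [set w | exists2 s, t <= s & X s w < y].

(** The inequality in [hit] is strict, so it persists near a time where it holds, and a fine enough
    dyadic grid sees it. Measurability, the Markov property and the probabilities of [hit] all come
    from this union. *)
Lemma hit_grid E t tau y : 0 <= t -> 0 < tau ->
  E `&` hit t tau y = \bigcup_m (E `\` stay X E t (tau / (2 ^ m)%:R) y (2 ^ m)).
Proof.
move=> t0 tau0; apply/seteqP; split => w.
  move=> [Ew [s [ts st Xs]]].
  have [m [j [jm Xj]]] := dyadic_lt (@cX w) t0 tau0 ts st Xs.
  exists m => //; split => //; rewrite stayE => -[_ /= h].
  by have := h j jm; rewrite leNgt Xj.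
move=> [m _ [Ew]]; rewrite stayE => h; split => //; apply: contrapT => nh; apply: h; split => //= j jm.
rewrite leNgt; apply/negP => Xj; apply: nh; exists (t + j%:R * (tau / (2 ^ m)%:R)); split => //.
  by rewrite lerDl mulr_ge0// divr_ge0// ltW.
rewrite lerD2l mulrCA ler_piMr ?(ltW tau0)// ler_pdivrMr ?mul1r ?ler_nat// ltr0n expn_gt0.
Qed.

Lemma nondecreasing_grid E t tau y :
  nondecreasing_seq (fun m => E `\` stay X E t (tau / (2 ^ m)%:R) y (2 ^ m)).
Proof.
apply/nondecreasing_seqP => m; apply/subsetPset => w [Ew nh]; split => // h; apply: nh.
move: h; rewrite !stayE => -[_ /= h]; split => //= j jm.
(* Point [j] of one grid is point [2 j] of the next. *)
have := h (2 * j)%N; rewrite expnS leq_pmul2l// => /(_ jm).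
rewrite !natrM; congr (_ <= X (t + _) w); field.
by rewrite pnatr_eq0 -lt0n expn_gt0.
Qed.

Lemma measurable_grid E t tau y m : measurable E ->
  measurable (E `\` stay X E t (tau / (2 ^ m)%:R) y (2 ^ m)).
Proof. by move=> mE; apply: measurableD => //; exact: measurable_stay. Qed.

Lemma measurable_hit t tau y : 0 <= t -> 0 < tau -> measurable (hit t tau y).
Proof.
move=> t0 tau0; rewrite -[hit _ _ _]setTI hit_grid//.
by apply: bigcup_measurable => m _; exact: measurable_grid.
Qed.

Lemma hit_everE t y : hit_ever t y = \bigcup_n hit t n.+1%:R y.
Proof.
apply/seteqP; split => w.
  move=> [s ts Xs]; exists (Num.truncn (s - t)) => //; exists s; split => //.
  by rewrite -lerBlDl ltW// truncnS_gt.
by move=> [n _ [s [ts _ Xs]]]; exists s.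
Qed.

Lemma nondecreasing_hit t y : nondecreasing_seq (fun n => hit t n.+1%:R y).
Proof.
apply/nondecreasing_seqP => n; apply/subsetPset => w [s [ts st Xs]]; exists s; split => //.
by apply: (le_trans st); rewrite lerD2l ler_nat.
Qed.

Lemma measurable_hit_ever t y : 0 <= t -> measurable (hit_ever t y).
Proof.
by move=> t0; rewrite hit_everE; apply: bigcup_measurable => n _; exact: measurable_hit.
Qed.

Lemma hit_sub_ever t tau y : hit t tau y `<=` hit_ever t y.
Proof. by move=> w [s [ts _ Xs]]; exists s. Qed.

Lemma markov_later E t tau : markov_at nu P X t E -> 0 < tau -> markov_at nu P X (t + tau) E.
Proof.
move=> mk tau0; have := markov_step nu0 mX mk tau0 measurableT.
by rewrite preimage_setT setIT.
Qed.

Lemma markov_nohit E t tau y : markov_at nu P X t E -> 0 <= t -> 0 < tau ->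
  markov_at nu P X (t + tau) (E `\` hit t tau y).
Proof.
move=> mk t0 tau0; have mk' := markov_later mk tau0.
(* [markov_setD] removes a subset, and it is the part of [hit] inside [E] that is a monotone union
   of grid events. *)
have -> : E `\` hit t tau y = E `\` (E `&` hit t tau y).
  by apply/seteqP; split => w [Ew h]; split => //; [move=> [_ /h]|move=> h'; exact: h].
apply: markov_setD => //.
rewrite hit_grid//; apply: markov_bigcup => //; first exact: nondecreasing_grid.
move=> m; apply: markov_setD => //; first exact: stay_sub.
have dl0 : 0 < tau / (2 ^ m)%:R by rewrite divr_gt0// ltr0n expn_gt0.
have := markov_stay nu0 mX y (2 ^ m) mk dl0.
by rewrite mulrC divfK// pnatr_eq0 -lt0n expn_gt0.
Qed.

Local Open Scope ereal_scope.

Lemma prob_hit_cvg E t tau y : measurable E -> (0 <= t)%R -> (0 < tau)%R ->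
  (fun m => P (E `\` stay X E t (tau / (2 ^ m)%:R) y (2 ^ m))) @ \oo --> P (E `&` hit t tau y).
Proof.
move=> mE t0 tau0; rewrite hit_grid//.
apply: (@nondecreasing_cvg_mu _ _ _ P (fun m => E `\` stay X E t (tau / (2 ^ m)%:R) y (2 ^ m))).
- by move=> m; exact: measurable_grid.
- by apply: bigcup_measurable => m _; exact: measurable_grid.
- exact: nondecreasing_grid.
Qed.

Lemma prob_hit_ever_cvg E t y : measurable E -> (0 <= t)%R ->
  (fun n => P (E `&` hit t n.+1%:R y)) @ \oo --> P (E `&` hit_ever t y).
Proof.
move=> mE t0; rewrite hit_everE setI_bigcupr.
apply: (@nondecreasing_cvg_mu _ _ _ P (fun n => E `&` hit t n.+1%:R y)).
- by move=> n; apply: measurableI => //; exact: measurable_hit.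
- by apply: bigcup_measurable => n _; apply: measurableI => //; exact: measurable_hit.
- by move=> m n mn; apply/subsetPset; apply: setIS; exact/subsetPset/nondecreasing_hit.
Qed.

Lemma prob_hit_ever_le E t y : markov_at nu P X t E -> (0 <= t)%R -> (0 < y)%R ->
  P (E `&` hit_ever t y) <= (y `^ (2 * nu))%:E * energy nu P X t E.
Proof.
move=> mk t0 y0; have mE := mk.1.
apply: (cvge_le _ (prob_hit_ever_cvg (y := y) mE t0)); near=> n.
apply: (cvge_le _ (prob_hit_cvg (y := y) mE t0 (ltr0Sn R n))); near=> m.
have dl0 : (0 < n.+1%:R / (2 ^ m)%:R :> R)%R by rewrite divr_gt0// ltr0n expn_gt0.
apply: le_trans (maximal_grid nu0 mX (2 ^ m) mk dl0 y0).
by rewrite leeDl// mule_ge0 ?energy_ge0// lee_fin powR_ge0.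
Unshelve. all: end_near. Qed.

(** The loss bound takes a level [z < y] that leaves room for an overshoot. For fixed [z] a long
    window and then a fine mesh remove the error terms; [z] tends to [y] at the end. *)
Lemma prob_hit_ever_ge E t y : markov_at nu P X t E -> (0 <= t)%R -> (0 < y)%R ->
  E `<=` [set w | (y <= X t w)%R] ->
  (y `^ (2 * nu))%:E * energy nu P X t E <= P (E `&` hit_ever t y).
Proof.
move=> mk t0 y0 Ey; have mE := mk.1.
have Pfin : P (E `&` hit_ever t y) \is a fin_num.
  by apply: fin_num_measure; apply: measurableI => //; exact: measurable_hit_ever.
have c0 := bessel_cst_gt0 nu0.
have hkey (z : R) : (0 < z)%R -> (z < y)%R ->
    energy nu P X t E <= (z `^ (- (2 * nu)))%:E * P (E `&` hit_ever t y).
  move=> z0 zy; have [K K0 hK] := energy_loss_grid P nu0 mX z0 zy.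
  have q0 : 0 <= (z `^ (- (2 * nu)))%:E by rewrite lee_fin powR_ge0.
  (* The terms are the energy left at the end of the window, the paths that have crossed, and
     [2 ^ m] losses quadratic in the mesh. *)
  have bound (tau : R) m : (0 < tau)%R -> (tau <= (2 ^ m)%:R)%R ->
      energy nu P X t E <= (bessel_cst nu * tau `^ (- nu))%:E +
        (z `^ (- (2 * nu)))%:E * P (E `&` hit_ever t y) + (K * tau ^+ 2 / (2 ^ m)%:R)%:E.
    move=> tau0 taum; have m0 : (0 < (2 ^ m)%:R :> R)%R by rewrite ltr0n expn_gt0.
    have dl0 : (0 < tau / (2 ^ m)%:R)%R by rewrite divr_gt0.
    have dl1 : (tau / (2 ^ m)%:R <= 1)%R by rewrite ler_pdivrMr// mul1r.
    apply: (le_trans (hK t _ E (2 ^ m)%N mk Ey dl0 dl1)).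
    have -> : ((2 ^ m)%:R * (tau / (2 ^ m)%:R) = tau)%R by rewrite mulrC divfK// gt_eqF.
    apply: leeD; last by rewrite lee_fin le_eqVlt; apply/orP; left; apply/eqP; field; rewrite gt_eqF.
    apply: leeD.
      have mS : measurable (stay X E t (tau / (2 ^ m)%:R) y (2 ^ m)) by exact: measurable_stay.
      apply: (@le_trans _ _ (energy nu P X (t + tau) E)); first by apply: le_energy => //; exact: stay_sub.
      apply: (le_trans (energy_decay nu0 mX mk tau0 _)).
        by move=> w /Ey /=; exact: lt_le_trans.
      rewrite -[leRHS]mule1; apply: lee_wpmul2l; last exact: probability_le1.
      by rewrite lee_fin mulr_ge0 ?powR_ge0 ?(ltW c0).
    apply: lee_wpmul2l => //; apply: le_measure; rewrite ?inE.
    - exact: measurable_grid.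
    - by apply: measurableI => //; exact: measurable_hit_ever.
    - move=> w h; have : (E `&` hit t tau y) w by rewrite hit_grid//; exists m.
      by move=> [Ew /hit_sub_ever hw].
  apply/lee_addgt0Pr => e e0.
  have e20 : (0 < e / 2)%R by rewrite divr_gt0.
  (* The solution of [c tau ^ (- nu) = e / 2]. *)
  pose tau := ((e / 2 / bessel_cst nu)^-1 `^ nu^-1)%R.
  have ec0 : (0 < e / 2 / bessel_cst nu)%R by rewrite divr_gt0.
  have tau0 : (0 < tau)%R by rewrite powR_gt0// invr_gt0.
  have tauE : (bessel_cst nu * tau `^ (- nu) = e / 2)%R.
    rewrite /tau -powRrM mulrN mulVf ?gt_eqF// powR_inv1 ?invr_ge0 ?(ltW ec0)// invrK.
    by rewrite mulrC divfK// gt_eqF.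
  (* The first bound makes the mesh at most [1], the second the total loss at most [e / 2]; both use
     [m < 2 ^ m]. *)
  pose m := maxn (Num.truncn tau).+1 (Num.truncn (K * tau ^+ 2 / (e / 2))).+1.
  have m0 : (0 < (2 ^ m)%:R :> R)%R by rewrite ltr0n expn_gt0.
  have mle k x : (k <= m)%N -> (x < k%:R)%R -> (x <= (2 ^ m)%:R :> R)%R.
    move=> km xk; rewrite (le_trans (ltW xk))// ler_nat (leq_trans km)//.
    by rewrite ltnW// ltn_expl.
  have m1 : (tau <= (2 ^ m)%:R)%R by apply: mle (leq_maxl _ _) _; exact: truncnS_gt.
  have m2 : (K * tau ^+ 2 / (e / 2) <= (2 ^ m)%:R)%R.
    by apply: mle (leq_maxr _ _) _; exact: truncnS_gt.
  apply: (le_trans (bound tau m tau0 m1)).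
  rewrite tauE addeAC addeC; apply: leeD => //.
  rewrite -EFinD lee_fin [leRHS]splitr lerD2l ler_pdivrMr// [leRHS]mulrC -ler_pdivrMr//.
(* The limit in [z] is taken in real numbers; finiteness comes from [hkey] at [z = y / 2]. *)
have Efin : energy nu P X t E \is a fin_num.
  rewrite ge0_fin_numE ?energy_ge0//.
  have y20 : (0 < y / 2)%R by rewrite divr_gt0.
  have y2y : (y / 2 < y)%R by rewrite gtr_pMr// invf_lt1// ltr1n.
  apply: (le_lt_trans (hkey _ y20 y2y)).
  by rewrite -(fineK Pfin) -EFinM ltry.
rewrite -(fineK Pfin) -(fineK Efin) -EFinM lee_fin.
have cv : (z `^ (2 * nu) * fine (energy nu P X t E))%R @[z --> y^'-] -->
    (y `^ (2 * nu) * fine (energy nu P X t E))%R.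
  apply: cvgM; last exact: cvg_cst.
  apply: cvg_at_left_filter.
  have : {for y, continuous (fun x : R => x `^ (2 * nu))%R}.
    apply/differentiable_continuous/derivable1_diffP.
    by apply: derivable_powR; rewrite in_itv/= andbT.
  exact.
apply: (cvgr_to_le cv); near=> z.
have z0 : (0 < z)%R by near: z; exact: nbhs_left_gt.
have zy : (z < y)%R by near: z; exact: nbhs_left_lt.
have := hkey z z0 zy; rewrite -(fineK Pfin) -(fineK Efin) -EFinM lee_fin powRN.
by rewrite mulrC ler_pdivlMr ?powR_gt0// mulrC.
Unshelve. all: end_near. Qed.

End Hit.

(** * Large-time asymptotics *)

Lemma powRN_small (R : realType) (p e : R) : 0 < p -> 0 < e ->
  exists2 M, 0 < M & forall x, M <= x -> x `^ (- p) <= e.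
Proof.
move=> p0 e0; exists (e^-1 `^ p^-1); first by rewrite powR_gt0// invr_gt0.
move=> x Mx; have M0 : 0 < e^-1 `^ p^-1 by rewrite powR_gt0// invr_gt0.
have -> : e = (e^-1 `^ p^-1) `^ (- p).
  by rewrite -powRrM mulrN mulVf ?gt_eqF// powR_inv1 ?invr_ge0 ?(ltW e0)// invrK.
have x0 := lt_le_trans M0 Mx.
rewrite !powRN lef_pV2 ?posrE ?powR_gt0 ?invr_gt0//.
by apply: ge0_ler_powR; rewrite ?nnegrE ?(ltW p0) ?(ltW M0) ?(ltW x0).
Qed.

(** Restarting at a fixed time [s] does not change the leading order in [t]. *)
Lemma cvg_ratio_powR (R : realType) (s p : R) : 0 < s ->
  t `^ p * (t - s) `^ (- p) @[t --> +oo] --> (1 : R).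
Proof.
move=> s0.
have h1 : (1 - s / t) `^ (- p) @[t --> +oo] --> (1 : R) `^ (- p).
  have hc : (1 - s / t) @[t --> +oo] --> (1 : R).
    rewrite -[X in _ --> X]subr0; apply: cvgB; first exact: cvg_cst.
    rewrite -(mulr0 s); apply: cvgM; first exact: cvg_cst.
    apply/cvgrPdist_le => e e0; near=> t.
    have te : e^-1 <= t by near: t; apply: nbhs_pinfty_ge; exact: num_real.
    have ei : 0 < e^-1 by rewrite invr_gt0.
    have t0 : 0 < t by exact: lt_le_trans te.
    by rewrite sub0r normrN gtr0_norm ?invr_gt0// -[leRHS]invrK lef_pV2 ?posrE.
  have cp : {for 1, continuous (fun x : R => x `^ (- p))}.
    apply/differentiable_continuous/derivable1_diffP.
    by apply: derivable_powR; rewrite in_itv/= andbT.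
  exact: (cvg_comp _ _ hc cp).
rewrite powR1 in h1; apply: cvg_trans h1; apply: near_eq_cvg; near=> t.
have ts : s < t by near: t; apply: nbhs_pinfty_gt; exact: num_real.
have t0 : 0 < t by exact: lt_trans ts.
have -> : t - s = t * (1 - s / t) by field; rewrite gt_eqF.
have u0 : 0 <= 1 - s / t by rewrite subr_ge0 ler_pdivrMr// mul1r ltW.
by rewrite powRM ?(ltW t0)// mulrA -powRD ?(gt_eqF t0) ?implybT// subrr powRr0 mul1r.
Unshelve. all: end_near. Qed.

Lemma ratio_powR_small (R : realType) (a p e : R) : 0 < a -> 0 < p -> 0 < e ->
  exists z, [/\ 0 < z, z <= a & (z / a) `^ p <= e].
Proof.
move=> a0 p0 e0; have [M M0 /(_ (Num.max M 1)) h] := powRN_small p0 e0.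
have m1 : 1 <= Num.max M 1 by rewrite le_max lexx orbT.
have m0 : 0 < Num.max M 1 := lt_le_trans ltr01 m1.
exists (a / Num.max M 1); split; first by rewrite divr_gt0.
  by rewrite ler_pdivrMr// ler_peMr// ltW.
have -> : a / Num.max M 1 / a = (Num.max M 1)^-1 by field; rewrite !gt_eqF.
by rewrite -powR_inv1 ?(ltW m0)// -powRrM mulN1r; apply: h; rewrite le_max lexx.
Qed.

Section BesselProcess.
Variables (R : realType) (nu a : R) (d : measure_display) (T : measurableType d).
Variables (P : probability T R) (X : R -> T -> R).
Hypothesis nu0 : 0 < nu.
Hypothesis a0 : 0 < a.
Hypothesis HX : is_bessel_process P nu a X.
Implicit Types (t s x y z : R) (E F : set T).

Let X0 w : X 0 w = a. Proof. by case: HX. Qed.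
Let cX w : {within `[0, +oo[%classic, continuous (fun s => X s w)}.
Proof. by case: HX. Qed.
Let mX t : measurable_fun setT (X t). Proof. by case: HX. Qed.

Local Open Scope ereal_scope.

Notation c := (bessel_cst nu).

(** The only use of the finite-dimensional laws of [X]; other events in the past are reached from
    this one by the closure properties of [markov_at]. *)
Lemma markov_at0 : markov_at nu P X 0 setT.
Proof.
split => // A l mA vl; rewrite setTI.
have [Aa|nAa] := pselect (A a).
  have -> : X 0 @^-1` A = setT by apply/seteqP; split => // w _ /=; rewrite X0.
  rewrite setTI; under eq_integral do rewrite X0.
  rewrite integral_cst// [X in _ * X]probability_setT mule1.
  by case: HX => _ _ _; apply; [exact: vl.1|exact: vl.2].
have -> : X 0 @^-1` A = set0 by apply/seteqP; split => // w /=; rewrite X0.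
by rewrite set0I measure0 integral_set0.
Qed.

Definition surv t z : set T := setT `\` hit X 0 t z.

Lemma markov_surv t z : (0 < t)%R -> markov_at nu P X t (surv t z).
Proof. by move=> t0; have := markov_nohit nu0 mX cX z markov_at0 (lexx 0%R) t0; rewrite add0r. Qed.

Lemma measurable_surv t z : (0 < t)%R -> measurable (surv t z).
Proof. by move=> t0; exact: (markov_surv z t0).1. Qed.

Lemma survP t z w : surv t z w <-> forall s, (0 <= s)%R -> (s <= t)%R -> (z <= X s w)%R.
Proof.
split=> [[_ h] s s0 st|h].
  by rewrite leNgt; apply/negP => Xs; apply: h; exists s; rewrite add0r.
by split => // -[s [s0]]; rewrite add0r => st; rewrite ltNge h.
Qed.

Lemma surv_subt s t z : (s <= t)%R -> surv t z `<=` surv s z.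
Proof. by move=> st w /survP h; apply/survP => u u0 us; apply: h => //; exact: le_trans st. Qed.

Lemma surv_subz t z y : (z <= y)%R -> surv t y `<=` surv t z.
Proof. by move=> zy w /survP h; apply/survP => u u0 us; apply: (le_trans zy); exact: h. Qed.

Lemma energy0 : energy nu P X 0 setT = (a `^ (- (2 * nu)))%:E.
Proof.
rewrite /energy; under eq_integral do rewrite X0.
by rewrite integral_cst// [X in _ * X]probability_setT mule1 /bessel_scale a0.
Qed.

Lemma integral_Xt t (f : R -> \bar R) : (0 < t)%R -> measurable_fun setT f -> (forall x, 0 <= f x) ->
  \int[P]_w f (X t w) = bessel_trans nu t f a.
Proof.
move=> t0 mf f0; have := markov_trans nu0 mX markov_at0 t0 mf f0; rewrite add0r => ->.
under eq_integral do rewrite X0.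
by rewrite integral_cst// [X in _ * X]probability_setT mule1.
Qed.

Lemma energyT_le t : (0 < t)%R -> energy nu P X t setT <= (c * t `^ (- nu))%:E.
Proof.
move=> t0; rewrite /energy integral_Xt//; last 2 first.
- exact: measurable_bessel_scale.
- exact: bessel_scale_ge0.
exact: bessel_trans_scale_le.
Qed.

Lemma energy_fin t E : (0 < t)%R -> measurable E -> energy nu P X t E \is a fin_num.
Proof.
move=> t0 mE; rewrite ge0_fin_numE ?energy_ge0//.
apply: (@le_lt_trans _ _ (energy nu P X t setT)); first exact: le_energy.
by apply: (le_lt_trans (energyT_le t0)); rewrite ltry.
Qed.

(** Both hitting bounds apply from time [0], where the path sits at [a >= z] and the energy is
    [a ^ (- 2 nu)]. *)
Lemma prob_hit_ever0 z : (0 < z)%R -> (z <= a)%R ->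
  P (hit_ever X 0 z) = ((z / a) `^ (2 * nu))%:E.
Proof.
move=> z0 za.
have -> : ((z / a) `^ (2 * nu))%:E = (z `^ (2 * nu))%:E * energy nu P X 0 setT.
  rewrite energy0 -EFinM powRM ?invr_ge0 ?(ltW z0) ?(ltW a0)//.
  by rewrite -[(a^-1)%R]powR_inv1 ?(ltW a0)// -powRrM mulN1r.
apply/eqP; rewrite eq_le; apply/andP; split.
  have := prob_hit_ever_le nu0 mX cX markov_at0 (lexx 0%R) z0; by rewrite setTI.
have := prob_hit_ever_ge nu0 mX cX markov_at0 (lexx 0%R) z0; rewrite setTI; apply.
by move=> w _ /=; rewrite X0.
Qed.

Lemma prob_surv_ge t z : (0 < t)%R -> (0 < z)%R -> (z <= a)%R ->
  (1 - (z / a) `^ (2 * nu))%:E <= P (surv t z).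
Proof.
move=> t0 z0 za; rewrite /surv setTD probability_setC; last exact: measurable_hit.
rewrite EFinB; apply: leeB => //; rewrite -prob_hit_ever0//.
apply: le_measure; rewrite ?inE.
- exact: measurable_hit.
- exact: measurable_hit_ever.
- exact: hit_sub_ever.
Qed.

Lemma prob_surv_near z e : (0 < e)%R -> (0 < z)%R -> (z <= a)%R ->
  exists2 s, (0 < s)%R & P (surv s z) <= (1 - (z / a) `^ (2 * nu) + e)%:E.
Proof.
move=> e0 z0 za.
have := @prob_hit_ever_cvg R d T P X mX cX setT 0%R z measurableT (lexx 0%R).
rewrite setTI prob_hit_ever0// => /fine_cvgP[_].
have lt : ((z / a) `^ (2 * nu) - e < (z / a) `^ (2 * nu))%R by rewrite gtrBl.
move=> /cvgr_ge => /(_ _ lt) [n _ /(_ n (leqnn n)) /= hn].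
exists n.+1%:R => //; rewrite setTI in hn.
have Pf : P (hit X 0 n.+1%:R z) \is a fin_num by apply: fin_num_measure; exact: measurable_hit.
rewrite /surv setTD probability_setC; last exact: measurable_hit.
rewrite -(fineK Pf) -EFinB lee_fin; lra.
Qed.

(** Take [s] with [P(I_s >= z)] close to [P(I_oo >= z)]. From [s] on the energy is at most
    [c (t - s) ^ (- nu)] times this probability, and the shift by [s] is harmless. *)
Lemma energy_surv_upper z e : (0 < e)%R -> (0 < z)%R -> (z <= a)%R ->
  \forall t \near +oo%R,
    (t `^ nu * fine (energy nu P X t (surv t z)) <= c * (1 - (z / a) `^ (2 * nu)) + e)%R.
Proof.
move=> e0 z0 za; have c0 := bessel_cst_gt0 nu0.
have ec0 : (0 < e / 2 / c)%R by rewrite !divr_gt0.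
have [s s0 hs] := prob_surv_near ec0 z0 za.
set D := (c * (1 - (z / a) `^ (2 * nu)) + e / 2)%R.
have cv : (t `^ nu * (t - s) `^ (- nu) * D)%R @[t --> +oo%R] --> (1 * D)%R.
  by apply: cvgM; [exact: cvg_ratio_powR|exact: cvg_cst].
have De : (1 * D < D + e / 2)%R by rewrite mul1r ltrDl divr_gt0.
have /cvgr_le/(_ _ De) hD := cv; near=> t.
have ts : (s < t)%R by near: t; apply: nbhs_pinfty_gt; exact: num_real.
have t0 : (0 < t)%R := lt_trans s0 ts.
have ts0 : (0 < t - s)%R by rewrite subr_gt0.
apply: (@le_trans _ _ (t `^ nu * (t - s) `^ (- nu) * D)%R); last first.
  have -> : (c * (1 - (z / a) `^ (2 * nu)) + e = D + e / 2)%R by rewrite /D; field.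
  by near: t.
rewrite -mulrA ler_pM2l ?powR_gt0//.
have mS := measurable_surv z t0; have mSs := measurable_surv z s0.
rewrite -lee_fin fineK; last exact: energy_fin.
apply: (@le_trans _ _ (energy nu P X t (surv s z))).
  by apply: le_energy => //; apply: surv_subt; exact: ltW.
have -> : t = (s + (t - s))%R by ring.
apply: (le_trans (energy_decay nu0 mX (markov_surv z s0) ts0 _)).
  by move=> w /survP h /=; rewrite (lt_le_trans z0)// h// ltW.
have -> : (s + (t - s) - s = t - s)%R by ring.
apply: (le_trans (lee_wpmul2l _ hs)).
  by rewrite lee_fin mulr_ge0 ?powR_ge0 ?(ltW c0).
rewrite -EFinM lee_fin /D le_eqVlt; apply/orP; left; apply/eqP.
by field; rewrite gt_eqF.
Unshelve. all: end_near. Qed.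

(** Above [r] the scale function is at most [r ^ (- 2 nu)]; its mean below [r] is bounded over all
    paths, with [D = 0] in [bessel_trans_scale_small]. For [r] of order [sqrt t] both coefficients
    are of order [t ^ (- nu)]. *)
Lemma energy_le_split t r E : (0 < t)%R -> (0 < r)%R -> measurable E ->
  energy nu P X t E <= (r `^ (- (2 * nu)))%:E * P E + (c * r * t `^ (- (1 + nu)) * r)%:E.
Proof.
move=> t0 r0 mE; have q0 : 0 <= (r `^ (- (2 * nu)))%:E by rewrite lee_fin powR_ge0.
have mSr : measurable_fun setT (bessel_scale nu \_ `]-oo, r[).
  apply/(measurable_restrictT (bessel_scale nu)) => //; apply: measurable_funTS.
  exact: measurable_bessel_scale.
have Sr0 x : 0 <= (bessel_scale nu \_ `]-oo, r[) x.
  by rewrite patchE; case: ifP => // _; exact: bessel_scale_ge0.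
have mc : measurable_fun setT (fun w => (bessel_scale nu \_ `]-oo, r[) (X t w)).
  exact: (measurableT_comp mSr).
apply: (@le_trans _ _ (\int[P]_(w in E) ((r `^ (- (2 * nu)))%:E + (bessel_scale nu \_ `]-oo, r[) (X t w)))).
  apply: ge0_le_integral => //.
  - by move=> w _; exact: bessel_scale_ge0.
  - exact: measurable_scaleX.
  - by apply: emeasurable_funD => //; exact: measurable_funTS.
  - move=> w _; rewrite patchE; case: ifPn => [_|].
      by rewrite leeDr.
    rewrite notin_setE/= in_itv/= => /negP; rewrite -leNgt => rX.
    have X0' := lt_le_trans r0 rX.
    rewrite adde0 /bessel_scale X0' lee_fin !powRN lef_pV2 ?posrE ?powR_gt0//.
    by apply: ge0_ler_powR; rewrite ?nnegrE ?mulr_ge0 ?(ltW nu0) ?(ltW r0) ?(ltW X0').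
rewrite ge0_integralD//; last exact: measurable_funTS.
rewrite integral_cst//; apply: leeD => //.
apply: (@le_trans _ _ (\int[P]_w (bessel_scale nu \_ `]-oo, r[) (X t w))).
  by apply: ge0_subset_integral.
rewrite integral_Xt//.
have := @bessel_trans_scale_small R nu nu0 t a r 0%R t0 a0 r0.
rewrite expr0n/= mul0r oppr0 expR0 mulr1; apply.
by move=> y _ _; exact: sqr_ge0.
Qed.

Lemma prob_below_le s x : (0 < s)%R -> (0 < x)%R ->
  P (X s @^-1` `]-oo, x[) <= (c * (x `^ (2 * nu) * x) * s `^ (- (1 + nu)) * x)%:E.
Proof.
move=> s0 x0; have mB := measurable_below mX s x.
rewrite -[X in P X]setIT -integral_indic//.
have -> : \int[P]_w (\1_(X s @^-1` `]-oo, x[) w)%:E =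
    \int[P]_w (cst 1%E \_ `]-oo, x[) (X s w).
  apply: eq_integral => w _; rewrite indicE patchE.
  have -> : (w \in X s @^-1` `]-oo, x[) = (X s w \in `]-oo, x[%classic).
    by apply/idP/idP; rewrite !inE.
  by case: ifP.
rewrite integral_Xt//.
- exact: bessel_trans_small.
- by apply/(measurable_restrictT (cst 1%E)).
- by move=> y; rewrite patchE; case: ifP.
Qed.

Lemma prob_above_small s e : (0 < e)%R -> exists2 L, (0 < L)%R & P (X s @^-1` `[L, +oo[) <= e%:E.
Proof.
move=> e0; pose F n := X s @^-1` `[n.+1%:R, +oo[.
have mF n : measurable (F n) by exact: measurable_preimX.
have F0 : \bigcap_n F n = set0.
  apply/seteqP; split => // w h; have := h (Num.truncn `|X s w|) I.
  rewrite /F/= in_itv/= andbT leNgt => /negP; apply.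
  by apply: (le_lt_trans (ler_norm _)); exact: truncnS_gt.
have niF : nonincreasing_seq F.
  apply/nonincreasing_seqP => n; apply/subsetPset => w; rewrite /F/= !in_itv/= !andbT.
  by apply: le_trans; rewrite ler_nat.
have := @nonincreasing_cvg_mu _ _ _ P F _ mF _ niF.
rewrite F0 measure0 => cv.
have {cv} : (P \o F) @ \oo --> 0%:E.
  by apply: cv => //; rewrite ltey_eq fin_num_measure.
move=> /fine_cvgP[_] /cvgr_le => /(_ e e0) [n _ /(_ n (leqnn n)) /= hn].
exists n.+1%:R => //; rewrite -lee_fin fineK in hn => //.
by apply: fin_num_measure; exact: mF.
Qed.

(** Among the paths that survive up to some time [s], keep those with [X_s] in [[x, L[]. Their
    energy at [t] is at least about [c t ^ (- nu)] times their probability. From it is deducted the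
    energy of those that go below [z] after [s]: they are improbable for large [x], and
    [energy_le_split] at [r = k sqrt t] turns this into little energy. There are five errors of at
    most [e / 5]. *)
Lemma energy_surv_lower z e : (0 < e)%R -> (0 < z)%R -> (z <= a)%R ->
  \forall t \near +oo%R,
    (c * (1 - (z / a) `^ (2 * nu)) - e <= t `^ nu * fine (energy nu P X t (surv t z)))%R.
Proof.
move=> e0 z0 za; have c0 := bessel_cst_gt0 nu0.
have e50 : (0 < e / 5)%R by rewrite divr_gt0.
(* The order of choice is [k], [x], [s], [L], [t], each depending on earlier ones. Here
   [c k ^ 2 = e / 5] is the contribution of positions below [r = k sqrt t]. *)
pose k := (Num.sqrt (e / 5 / c))%R.
have k0 : (0 < k)%R by rewrite sqrtr_gt0 divr_gt0.
have k2 : (c * k ^+ 2 = e / 5)%R.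
  by rewrite sqr_sqrtr; [rewrite mulrC divfK// gt_eqF|exact/ltW/divr_gt0].
(* [(z / x) ^ (2 nu)] bounds the probability of going below [z] from above [x], and [k ^ (- 2 nu)]
   is [t ^ nu] times the scale function at [r]. *)
have [x x0 hx] : exists2 x, (0 < x)%R & (k `^ (- (2 * nu)) * (z `^ (2 * nu) * x `^ (- (2 * nu))) <= e / 5)%R.
  have p0 : (0 < 2 * nu)%R by rewrite mulr_gt0.
  have D0 : (0 < k `^ (- (2 * nu)) * z `^ (2 * nu))%R by rewrite mulr_gt0 ?powR_gt0.
  have [M M0 /(_ M (lexx _)) h] := powRN_small p0 (divr_gt0 e50 D0).
  by exists M => //; rewrite mulrA mulrC -ler_pdivlMr.
(* At time [s] the path is above [x] but for a probability of at most [e / (5 c)]. *)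
have [s s0 hs] : exists2 s, (0 < s)%R & (c * (c * (x `^ (2 * nu) * x) * s `^ (- (1 + nu)) * x) <= e / 5)%R.
  have p0 : (0 < 1 + nu)%R by rewrite addr_gt0.
  have D0 : (0 < c * (c * (x `^ (2 * nu) * x) * x))%R by rewrite !mulr_gt0 ?powR_gt0.
  have [M M0 /(_ M (lexx _)) h] := powRN_small p0 (divr_gt0 e50 D0).
  by exists M => //; rewrite mulrAC mulrA mulrC -ler_pdivlMr.
have [L L0 hL] := prob_above_small s (divr_gt0 e50 c0).
have [mB mA] := (measurable_below mX s x, measurable_above mX s L).
pose G := surv s z `&` X s @^-1` `[x, +oo[ `&` X s @^-1` `]-oo, L[.
have mkG : markov_at nu P X s G.
  by apply: markov_setI => //; apply: markov_setI => //; exact: markov_surv.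
have mG := mkG.1.
have Gx w : G w -> (x <= X s w)%R by move=> [[_ /=]]; rewrite in_itv/= andbT.
have GL w : G w -> (X s w < L)%R by move=> [_ /=]; rewrite in_itv.
have mS := measurable_surv z s0.
pose pG := fine (P G).
have PG : P G = pG%:E by rewrite fineK// fin_num_measure.
have pG1 : (pG <= 1)%R by rewrite -lee_fin -PG probability_le1.
have pG0 : (0 <= pG)%R by rewrite -lee_fin -PG.
(* The two losses are the paths below [x] and those at or above [L] at time [s]. *)
have hG : (c * (1 - (z / a) `^ (2 * nu)) - e / 5 - e / 5 <= c * pG)%R.
  have : P (surv s z) <= P G + P (X s @^-1` `]-oo, x[) + P (X s @^-1` `[L, +oo[).
    apply: (@le_trans _ _ (P (G `|` X s @^-1` `]-oo, x[ `|` X s @^-1` `[L, +oo[))).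
      apply: le_measure; rewrite ?inE//; first by do 2 apply: measurableU => //.
      move=> w sw; case: (ltP (X s w) x) => xw; first by left; right; rewrite /= in_itv.
      case: (ltP (X s w) L) => Lw; last by right; rewrite /= in_itv/= andbT.
      by left; left; split; [split|]; rewrite //= in_itv/= ?andbT.
    apply: (le_trans (measureU2 _ _ _)) => //; first exact: measurableU.
    by apply: leeD => //; apply: (le_trans (measureU2 _ _ _)).
  move=> /(le_trans (prob_surv_ge s0 z0 za)) h.
  have {}h := le_trans h (leeD (leeD (lexx _) (prob_below_le s0 x0)) hL).
  rewrite PG -!EFinD lee_fin in h.
  have := ler_wpM2l (ltW c0) h; rewrite [in X in (_ <= X)%R -> _]mulrDr [in X in (_ <= X)%R -> _]mulrDr.
  have -> : (c * (e / 5 / c) = e / 5)%R by rewrite mulrC divfK// gt_eqF.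
  lra.
near=> t.
have ts : (s < t)%R by near: t; apply: nbhs_pinfty_gt; exact: num_real.
have tL : (s + c * L ^+ 2 / (2 * (e / 5)) < t)%R by near: t; apply: nbhs_pinfty_gt; exact: num_real.
have t0 : (0 < t)%R := lt_trans s0 ts.
have ts0 : (0 < t - s)%R by rewrite subr_gt0.
have mSt := measurable_surv z t0.
pose q := (L ^+ 2 / (2 * (t - s)))%R.
have q5 : (c * q <= e / 5)%R.
  rewrite /q mulrA ler_pdivrMr ?mulr_gt0//.
  have : (c * L ^+ 2 / (2 * (e / 5)) <= t - s)%R by rewrite lerBrDl ltW.
  rewrite ler_pdivrMr ?mulr_gt0// => h; apply: (le_trans h).
  by rewrite le_eqVlt; apply/orP; left; apply/eqP; ring.
pose eS := fine (energy nu P X t (surv t z)).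
have eSE : energy nu P X t (surv t z) = eS%:E by rewrite fineK// energy_fin.
pose r := (k * t `^ (2^-1))%R.
have r0 : (0 < r)%R by rewrite mulr_gt0 ?powR_gt0.
have mH : measurable (hit_ever X s z) by apply: measurable_hit_ever => //; exact: ltW.
have stepA : (c * (t - s) `^ (- nu) * expR (- q) * pG)%:E <= energy nu P X t G.
  have -> : t = (s + (t - s))%R by ring.
  rewrite (energyS nu0 mX mkG ts0) EFinM -PG -integral_cst//.
  have -> : (s + (t - s) - s = t - s)%R by ring.
  apply: ge0_le_integral => //.
  - by move=> w _; rewrite lee_fin !mulr_ge0 ?powR_ge0 ?expR_ge0 ?(ltW c0).
  - apply: measurable_transX => //; first exact: measurable_bessel_scale.
    exact: bessel_scale_ge0.
  - move=> w Gw; have Xs0 : (0 < X s w)%R := lt_le_trans x0 (Gx w Gw).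
    apply: le_trans (bessel_trans_scale_ge nu0 ts0 Xs0).
    rewrite lee_fin ler_pM2l ?mulr_gt0 ?powR_gt0// ler_expR lerN2.
    rewrite /q ler_pM2r ?invr_gt0 ?mulr_gt0// ler_pXn2r ?nnegrE ?(ltW Xs0) ?(ltW L0)//.
    exact/ltW/GL.
(* A path of [G] that does not go below [z] after [s] either belongs to [surv t z]. *)
have stepB : energy nu P X t G <= eS%:E + energy nu P X t (G `&` hit_ever X s z).
  have mGH : measurable (G `&` hit_ever X s z) by exact: measurableI.
  have mGD : measurable (G `\` hit_ever X s z) by exact: measurableD.
  have -> : energy nu P X t G = energy nu P X t (G `&` hit_ever X s z) + energy nu P X t (G `\` hit_ever X s z).
    rewrite -energyU//; first by rewrite setUIDK.
    by apply/seteqP; split => // w [[_ h] [_ nh]]; exact: nh h.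
  rewrite addeC -eSE; apply: leeD => //; apply: le_energy => //.
  move=> w [[[/survP sw _] _] nh]; apply/survP => u u0 ut.
  case: (leP u s) => us; first exact: sw.
  by rewrite leNgt; apply/negP => Xu; apply: nh; exists u => //; exact: ltW.
have stepC : energy nu P X t (G `&` hit_ever X s z) <=
    (r `^ (- (2 * nu)) * (z `^ (2 * nu) * x `^ (- (2 * nu))) + c * r * t `^ (- (1 + nu)) * r)%:E.
  apply: (le_trans (energy_le_split t0 r0 _)); first exact: measurableI.
  rewrite EFinD; apply: leeD => //; rewrite EFinM; apply: lee_wpmul2l; first by rewrite lee_fin powR_ge0.
  apply: (le_trans (prob_hit_ever_le nu0 mX cX mkG (ltW s0) z0)).
  rewrite EFinM; apply: lee_wpmul2l; first by rewrite lee_fin powR_ge0.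
  have x20 : 0 <= (x `^ (- (2 * nu)))%:E by rewrite lee_fin powR_ge0.
  apply: (@le_trans _ _ ((x `^ (- (2 * nu)))%:E * P G)); last first.
    by rewrite -[leRHS]mule1; apply: lee_wpmul2l => //; exact: probability_le1.
  rewrite -integral_cst//; apply: ge0_le_integral => //.
  - by move=> w _; exact: bessel_scale_ge0.
  - exact: measurable_scaleX.
  - move=> w /Gx xX; have Xs0 := lt_le_trans x0 xX.
    rewrite /bessel_scale Xs0 lee_fin !powRN lef_pV2 ?posrE ?powR_gt0//.
    by apply: ge0_ler_powR; rewrite ?nnegrE ?mulr_ge0 ?(ltW nu0) ?(ltW x0) ?(ltW Xs0).
have := le_trans stepA (le_trans stepB (leeD (lexx _) stepC)).
rewrite -EFinD lee_fin => main.
have tn0 : (0 < t `^ nu)%R by rewrite powR_gt0.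
have {main} := ler_wpM2l (ltW tn0) main.
rewrite -/eS [in X in (_ <= X)%R -> _]mulrDr.
have rE1 : (t `^ nu * (r `^ (- (2 * nu)) * (z `^ (2 * nu) * x `^ (- (2 * nu)))) = k `^ (- (2 * nu)) * (z `^ (2 * nu) * x `^ (- (2 * nu))))%R.
  rewrite mulrA; congr (_ * _)%R; rewrite /r powRM ?powR_ge0 ?(ltW k0)// -powRrM.
  rewrite mulrCA -powRD ?(gt_eqF t0) ?implybT//.
  have -> : (nu + 2^-1 * - (2 * nu) = 0)%R by field.
  by rewrite powRr0 mulr1.
have rE2 : (t `^ nu * (c * r * t `^ (- (1 + nu)) * r) = e / 5)%R.
  have -> : (t `^ nu * (c * r * t `^ (- (1 + nu)) * r) = c * k ^+ 2 * (t `^ nu * t `^ (- (1 + nu)) * (t `^ 2^-1 * t `^ 2^-1)))%R.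
    by rewrite /r; ring.
  rewrite -!powRD ?(gt_eqF t0) ?implybT//.
  have -> : (nu + - (1 + nu) + (2^-1 + 2^-1) = 0)%R by field.
  by rewrite powRr0 mulr1.
rewrite [in X in (_ <= X)%R -> _]mulrDr rE1 rE2 => main.
(* [(t - s) ^ (- nu) >= t ^ (- nu)], and the Gaussian factor is at least [1 - q], where
   [c q <= e / 5]. *)
have low : (c * pG - e / 5 <= t `^ nu * (c * (t - s) `^ (- nu) * expR (- q) * pG))%R.
  apply: (@le_trans _ _ (c * expR (- q) * pG)%R).
    have q1 : (1 - q <= expR (- q))%R by exact: expR_ge1Dx.
    have q0 : (0 <= q)%R by rewrite /q divr_ge0 ?sqr_ge0 ?mulr_ge0 ?(ltW ts0).
    have cp0 : (0 <= c * pG)%R by rewrite mulr_ge0 ?(ltW c0).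
    have := ler_wpM2l cp0 q1.
    have cq0 : (0 <= c * q)%R by apply: mulr_ge0 => //; exact: ltW.
    have : (c * q * pG <= c * q)%R by rewrite ler_piMr.
    lra.
  have -> : (t `^ nu * (c * (t - s) `^ (- nu) * expR (- q) * pG) = t `^ nu * (t - s) `^ (- nu) * (c * expR (- q) * pG))%R by ring.
  rewrite ler_peMl ?mulr_ge0 ?expR_ge0 ?(ltW c0)//.
  rewrite powRN ler_pdivlMr ?powR_gt0// mul1r.
  apply: ge0_ler_powR; rewrite ?nnegrE ?(ltW nu0) ?(ltW t0) ?(ltW ts0)//.
  by rewrite gerBl ltW.
lra.
Unshelve. all: end_near. Qed.

Lemma cvg_energy_surv_gt0 z : (0 < z)%R -> (z <= a)%R ->
  (t `^ nu * fine (energy nu P X t (surv t z)))%R @[t --> +oo%R] --> (c * (1 - (z / a) `^ (2 * nu)))%R.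
Proof.
move=> z0 za; apply/cvgrPdist_le => e e0; near=> t.
rewrite distrC ler_distl; apply/andP; split.
- by near: t; exact: energy_surv_lower.
- by near: t; exact: energy_surv_upper.
Unshelve. all: end_near. Qed.

Lemma energy_surv_subz t z y : (0 < t)%R -> (z <= y)%R ->
  (fine (energy nu P X t (surv t y)) <= fine (energy nu P X t (surv t z)))%R.
Proof.
move=> t0 zy; have [m1 m2] := (measurable_surv z t0, measurable_surv y t0).
by rewrite fine_le ?energy_fin//; apply: le_energy => //; exact: surv_subz.
Qed.

Lemma energyT_fine_le t E : (0 < t)%R -> measurable E ->
  (t `^ nu * fine (energy nu P X t E) <= c)%R.
Proof.
move=> t0 mE; have tn := powR_gt0 nu t0.
rewrite mulrC -ler_pdivlMr// -powRN -lee_fin fineK ?energy_fin//.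
by apply: le_trans (energyT_le t0); exact: le_energy.
Qed.

(** The level [0] is added by squeezing: the energy on [surv t 0] lies between that on [surv t z],
    for a small [z > 0], and the bound [c t ^ (- nu)] for the whole space. *)
Lemma cvg_energy_surv z : (0 <= z)%R -> (z <= a)%R ->
  (t `^ nu * fine (energy nu P X t (surv t z)))%R @[t --> +oo%R] --> (c * (1 - (z / a) `^ (2 * nu)))%R.
Proof.
rewrite le_eqVlt => /predU1P[<- _|]; last exact: cvg_energy_surv_gt0.
have c0 := bessel_cst_gt0 nu0; have nu20 : (0 < 2 * nu)%R by rewrite mulr_gt0.
clear z; rewrite mul0r powR0 ?gt_eqF// subr0 mulr1; apply/cvgrPdist_le => e e0.
have ec0 : (0 < e / 2 / c)%R by rewrite !divr_gt0.
have [z [z0 za hz]] := ratio_powR_small a0 nu20 ec0.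
have e20 : (0 < e / 2)%R by rewrite divr_gt0.
near=> t; have t0 : (0 < t)%R by near: t; apply: nbhs_pinfty_gt; exact: num_real.
have ht : (c * (1 - (z / a) `^ (2 * nu)) - e / 2 <= t `^ nu * fine (energy nu P X t (surv t z)))%R.
  by near: t; exact: energy_surv_lower.
have up := energyT_fine_le t0 (measurable_surv 0%R t0).
have lo : (t `^ nu * fine (energy nu P X t (surv t z)) <= t `^ nu * fine (energy nu P X t (surv t 0%R)))%R.
  by rewrite ler_pM2l ?powR_gt0// energy_surv_subz// ltW.
have cz := ler_wpM2l (ltW c0) hz.
have e2E : (c * (e / 2 / c) = e / 2)%R by rewrite mulrC divfK// gt_eqF.
rewrite e2E in cz; rewrite ger0_norm ?subr_ge0//.
move: ht up lo cz; set u1 := (t `^ nu * _)%R; set u2 := (t `^ nu * _)%R.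
by move: ((z / a) `^ (2 * nu))%R => q; lra.
Unshelve. all: end_near. Qed.

(** On [surv t z] the path is at or above [z] at time [t], so the upper and lower hitting bounds
    meet. *)
Lemma prob_surv_hit t z : (0 < t)%R -> (0 < z)%R ->
  P (surv t z `&` hit_ever X t z) = (z `^ (2 * nu))%:E * energy nu P X t (surv t z).
Proof.
move=> t0 z0; have mk := markov_surv z t0; apply/eqP; rewrite eq_le; apply/andP; split.
  exact: (prob_hit_ever_le nu0 mX cX mk (ltW t0) z0).
apply: (prob_hit_ever_ge nu0 mX cX mk (ltW t0) z0) => w /survP /=; apply => //.
exact: ltW.
Qed.

(** Going below [0] entails going below every [z > 0], which has probability [(z / a) ^ (2 nu)] for
    [z <= a]. *)
Lemma prob_hit_neg : P (hit_ever X 0 0) = 0.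
Proof.
apply/eqP; rewrite eq_le measure_ge0 andbT; apply/lee_addgt0Pr => e e0; rewrite add0e.
have nu20 : (0 < 2 * nu)%R by rewrite mulr_gt0.
have [z [z0 za hz]] := ratio_powR_small a0 nu20 e0.
apply: (@le_trans _ _ (P (hit_ever X 0 z))).
  apply: le_measure; rewrite ?inE; try exact: measurable_hit_ever.
  by move=> w [s s0 Xs]; exists s => //; exact: lt_trans z0.
by rewrite prob_hit_ever0// lee_fin.
Qed.

End BesselProcess.

(** * Stieltjes sums *)

Lemma sum_ord_telescope (V : zmodType) (f : nat -> V) N :
  \sum_(i < N) (f i - f i.+1) = f 0 - f N.
Proof.
elim: N => [|N ih]; first by rewrite big_ord0 subrr.
by rewrite big_ord_recr/= ih addrA subrK.
Qed.

Section PowerIntegral.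
Variable R : realType.
Notation mu := (@lebesgue_measure R).
Implicit Types (p x y u : R).

Lemma continuous_powR_gt0 p x : 0 < x -> {for x, continuous (fun u : R => u `^ p)}.
Proof.
move=> x0; apply/differentiable_continuous/derivable1_diffP.
by apply: derivable_powR; rewrite in_itv/= andbT.
Qed.

Lemma integral_powR_gt0 p x y : p != 0 -> 0 < x -> x <= y ->
  (\int[mu]_(u in `]x, y]) (u `^ (p - 1))%:E = ((y `^ p - x `^ p) / p)%:E)%E.
Proof.
move=> p0 x0; rewrite le_eqVlt => /predU1P[->|xy].
  by rewrite set_itv_ge ?bnd_simp ?ltxx// integral_set0 subrr mul0r.
have y0 : 0 < y := lt_trans x0 xy.
rewrite integral_itv_obnd_cbnd; last first.
  by apply: measurable_funTS; apply/measurable_EFinP; exact: measurable_powR.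
have dF (u : R) : 0 < u -> is_derive u 1 (fun u => p^-1 * u `^ p) (u `^ (p - 1)).
  move=> u0; have H : is_derive u 1 (fun u => p^-1 * u `^ p) _ :=
    @is_deriveZ _ _ _ _ p^-1 u 1 _ (is_derive1_powR p u0).
  by apply: is_derive_eq; rewrite /GRing.scale/=; field.
have cF (u : R) : 0 < u -> {for u, continuous (fun u => p^-1 * u `^ p)}.
  by move=> u0; apply/differentiable_continuous/derivable1_diffP; have [] := dF u u0.
rewrite (@continuous_FTC2 _ _ (fun u => p^-1 * u `^ p))//.
- by rewrite -EFinB; congr EFin; ring.
- apply: continuous_in_subspaceT => u; rewrite inE/= in_itv/= => /andP[xu _].
  exact/continuous_powR_gt0/(lt_le_trans x0).
- split.
  + by move=> u; rewrite in_itv/= => /andP[xu _]; have [] := dF u (lt_trans x0 xu).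
  + by apply: cvg_at_right_filter; exact: cF.
  + by apply: cvg_at_left_filter; exact: cF.
- move=> u; rewrite in_itv/= => /andP[xu _]; rewrite derive1E.
  by have [_ ->] := dF u (lt_trans x0 xu).
Qed.

(** For [p < 1] the integrand is unbounded at [0], so []0, y]] is exhausted by the intervals []y /
    (n + 1), y]]. *)
Lemma integral_powR p x y : 0 < p -> 0 <= x -> x <= y ->
  (\int[mu]_(u in `]x, y]) (u `^ (p - 1))%:E = ((y `^ p - x `^ p) / p)%:E)%E.
Proof.
move=> p0; rewrite le_eqVlt => /predU1P[<-|x0]; last by apply: integral_powR_gt0 => //; rewrite gt_eqF.
rewrite le_eqVlt => /predU1P[<-|y0].
  by rewrite set_itv_ge ?bnd_simp ?ltxx// integral_set0 subrr mul0r.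
have mp : measurable_fun setT (fun u : R => (u `^ (p - 1))%:E).
  by apply/measurable_EFinP; exact: measurable_powR.
have yn n : 0 < y / n.+1%:R by rewrite divr_gt0.
have bigE : `]0, y]%classic = \bigcup_n `]y / n.+1%:R, y]%classic :> set R.
  apply/seteqP; split => u /=; rewrite in_itv/=.
    move=> /andP[u0 uy]; exists (Num.truncn (y / u)) => //=; rewrite in_itv/= uy andbT.
    by rewrite ltr_pdivrMr// mulrC -ltr_pdivrMr// truncnS_gt.
  by move=> [n _ /=]; rewrite in_itv/= => /andP[nu ->]; rewrite (lt_trans (yn n)).
have h1 : (\int[mu]_(u in `](y / n.+1%:R)%R, y]) (u `^ (p - 1))%:E)%E @[n --> \oo] -->
    (\int[mu]_(u in `]0%R, y]) (u `^ (p - 1))%:E)%E.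
  rewrite bigE; apply: ge0_nondecreasing_set_cvg_integral => //.
  - move=> m n mn; apply/subsetPset; apply: subset_itvr; rewrite bnd_simp.
    by rewrite ler_pM2l// lef_pV2 ?posrE// ler_nat.
  - by move=> n; exact: measurable_funTS.
  - by move=> n u _; rewrite lee_fin powR_ge0.
have h2 : ((y `^ p - (y / n.+1%:R) `^ p) / p) @[n --> \oo] --> (y `^ p - 0 `^ p) / p.
  rewrite powR0 ?gt_eqF//; apply: cvgM; last exact: cvg_cst.
  apply: cvgB; first exact: cvg_cst.
  apply/cvgrPdist_le => e e0; have yp := powR_gt0 p y0.
  have [M M0 hM] := powRN_small p0 (divr_gt0 e0 yp).
  near=> n; have Mn : M <= n.+1%:R.
    by near: n; exists (Num.truncn M).+1 => // n /= h; rewrite ltW// (lt_le_trans (truncnS_gt _))// ler_nat ltnW.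
  rewrite sub0r normrN ger0_norm ?powR_ge0// powRM ?(ltW y0)//.
  by rewrite -powR_inv1// -powRrM mulN1r mulrC -ler_pdivlMr// hM.
have h3 : (\int[mu]_(u in `](y / n.+1%:R)%R, y]) (u `^ (p - 1))%:E)%E @[n --> \oo] -->
    ((y `^ p - 0 `^ p) / p)%:E.
  rewrite (_ : (fun n => _) = EFin \o (fun n => (y `^ p - (y / n.+1%:R) `^ p) / p)).
    by apply: cvg_comp h2 _; exact: cvg_id.
  apply/funext => n; apply: integral_powR_gt0 => //; first by rewrite gt_eqF.
  by rewrite ler_pdivrMr// ler_peMr ?ler1n// ltW.
exact: cvg_unique h1 h3.
Unshelve. all: end_near. Qed.

Lemma measurable_powR_E p (D : set R) : measurable_fun D (fun u : R => (u `^ p)%:E).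
Proof. by apply: measurable_funTS; apply/measurable_EFinP; exact: measurable_powR. Qed.

Lemma integrable_powR p x y : 0 < p -> 0 <= x -> x <= y ->
  mu.-integrable `]x, y] (fun u => (u `^ (p - 1))%:E).
Proof.
move=> p0 x0 xy; apply/integrableP; split; first exact: measurable_powR_E.
under eq_integral do rewrite gee0_abs ?lee_fin ?powR_ge0//.
by rewrite integral_powR// ltry.
Qed.

Lemma Rintegral_powR p x y : 0 < p -> 0 <= x -> x <= y ->
  Rintegral mu `]x, y] (fun u => u `^ (p - 1)) = (y `^ p - x `^ p) / p.
Proof. by move=> p0 x0 xy; rewrite /Rintegral integral_powR. Qed.

Lemma integrable_EFinZl (i : interval R) (k : R) (f : R -> R) :
  mu.-integrable [set` i] (EFin \o f) -> mu.-integrable [set` i] (EFin \o (fun u => k * f u)).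
Proof. by move=> fi; apply: eq_integrable (integrableZl _ k fi). Qed.

Lemma integrable_EFinB (i : interval R) (f g : R -> R) :
  mu.-integrable [set` i] (EFin \o f) -> mu.-integrable [set` i] (EFin \o g) ->
  mu.-integrable [set` i] (EFin \o (fun u => f u - g u)).
Proof. by move=> fi gi; apply: eq_integrable (integrableB _ fi gi). Qed.

Lemma integrable_weighted_powR p x y (f : R -> R) (M : R) : 0 < p -> 0 <= x -> x <= y ->
  measurable_fun setT f -> (forall u, x < u -> u <= y -> `|f u| <= M) ->
  mu.-integrable `]x, y] (fun u => (f u * u `^ (p - 1))%:E).
Proof.
move=> p0 x0 xy mf fM.
have iM : mu.-integrable `]x, y] (fun u => M%:E * (u `^ (p - 1))%:E)%E.
  by apply: integrableZl => //; exact: integrable_powR.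
apply: le_integrable iM => //.
- by apply: measurable_funTS; apply/measurable_EFinP; apply: measurable_funM => //; exact: measurable_powR.
- move=> u; rewrite /= in_itv/= => /andP[xu uy].
  rewrite lee_fin normrM [X in _ * X]ger0_norm ?powR_ge0//.
  apply: le_trans (ler_norm _); apply: ler_wpM2r; first exact: powR_ge0.
  exact: fM.
Qed.

Lemma Rintegral_partition (f : R -> R) (z : nat -> R) N : nondecreasing_seq z ->
  mu.-integrable `]z 0, z N] (EFin \o f) ->
  Rintegral mu `]z 0, z N] f = \sum_(i < N) Rintegral mu `]z i, z i.+1] f.
Proof.
move=> ndz; elim: N => [|N ih] fi.
  by rewrite big_ord0 set_itv_ge ?bnd_simp ?ltxx// Rintegral_set0.
have z0N : z 0 <= z N by exact: ndz.
have zNS : z N <= z N.+1 by exact: ndz.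
rewrite big_ord_recr/= -ih; last first.
  by apply: integrableS fi => //; apply: subset_itvl; rewrite bnd_simp.
by rewrite -(@Rintegral_itvB _ f _ _ (z N) fi) ?bnd_simp//= addrC subrK.
Qed.

Lemma Rintegral_oc_cc (f : R -> R) x y : x <= y -> measurable_fun setT f ->
  Rintegral mu `[x, y] f = Rintegral mu `]x, y] f.
Proof.
move=> xy mf; rewrite /Rintegral -integral_itv_obnd_cbnd//.
by apply: measurable_funTS; apply/measurable_EFinP.
Qed.

Section Stieltjes.
Variables (nu c a : R).
Hypotheses (nu0 : 0 < nu) (c0 : 0 < c) (a0 : 0 < a).

Let nu20 : 0 < 2 * nu. Proof. by rewrite mulr_gt0. Qed.

(** With [c = bessel_cst nu], the limit of [t ^ nu] times the energy on [surv X t z]; as a function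
    of [z], the tail of the measure with density [tail_cst u ^ (2 nu - 1)] on [[0, a]]. *)
Definition tail_fun z := c * (1 - (z / a) `^ (2 * nu)).

Definition tail_cst := 2 * nu * c / a `^ (2 * nu).

Lemma tail_cst_gt0 : 0 < tail_cst.
Proof. by rewrite divr_gt0 ?powR_gt0// mulr_gt0. Qed.

Lemma tail_funE z : 0 <= z -> tail_fun z = c - c / a `^ (2 * nu) * z `^ (2 * nu).
Proof.
move=> z0; rewrite /tail_fun powRM ?invr_ge0 ?(ltW a0)//.
rewrite -[a^-1]powR_inv1 ?(ltW a0)// -powRrM mulN1r powRN; ring.
Qed.

Lemma tail_fun_integral x y : 0 <= x -> x <= y ->
  tail_cst * Rintegral mu `]x, y] (fun u => u `^ (2 * nu - 1)) = tail_fun x - tail_fun y.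
Proof.
move=> x0 xy; rewrite Rintegral_powR// !tail_funE ?(le_trans x0)// /tail_cst.
have an := powR_gt0 (2 * nu) a0.
by field; rewrite !gt_eqF.
Qed.

(** Lower and upper Stieltjes sums: [(u - b) ^ (2 nu)] is nondecreasing, so its values at the two
    ends of a cell bound it there. *)
Lemma tail_stieltjes_bounds b N (z : nat -> R) : 0 <= b -> z 0 = b -> z N = a -> nondecreasing_seq z ->
  let J := tail_cst * Rintegral mu `[b, a] (fun u => u `^ (2 * nu - 1) * (u - b) `^ (2 * nu)) in
  \sum_(i < N) (z i - b) `^ (2 * nu) * (tail_fun (z i) - tail_fun (z i.+1)) <= J /\
  J <= \sum_(i < N) (z i.+1 - b) `^ (2 * nu) * (tail_fun (z i) - tail_fun (z i.+1)).
Proof.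
move=> b0 z0 zN ndz J.
have ba : b <= a by rewrite -z0 -zN; exact: ndz.
pose f u := (u - b) `^ (2 * nu) * u `^ (2 * nu - 1).
have mf0 : measurable_fun setT (fun u : R => (u - b) `^ (2 * nu)).
  by apply: (measurableT_comp (@measurable_powR R _)); exact: measurable_funB.
have mf : measurable_fun setT f by apply: measurable_funM => //; exact: measurable_powR.
have mono u v : b <= u -> u <= v -> (u - b) `^ (2 * nu) <= (v - b) `^ (2 * nu).
  move=> bu uv; apply: ge0_ler_powR; rewrite ?nnegrE ?(ltW nu20) ?subr_ge0// ?(le_trans bu)//.
  by rewrite lerD2r.
have zb i : b <= z i by rewrite -z0; exact: ndz.
have zz i : z i <= z i.+1 by exact: ndz.
have zp i : 0 <= z i by exact: le_trans (zb i).
have fi x y : b <= x -> x <= y -> mu.-integrable `]x, y] (EFin \o f).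
  move=> bx xy; apply: (@integrable_weighted_powR _ _ _ _ ((y - b) `^ (2 * nu))) => //.
    exact: le_trans bx.
  move=> u xu uy; rewrite ger0_norm ?powR_ge0// mono// (le_trans bx)// ltW//.
have JE : J = \sum_(i < N) tail_cst * Rintegral mu `]z i, z i.+1] f.
  rewrite -mulr_sumr -(@Rintegral_partition f z N ndz); last by apply: fi; rewrite ?z0// zN.
  rewrite z0 zN -Rintegral_oc_cc; [|exact: ba|exact: mf].
  by rewrite /J; apply: (congr1 ( *%R tail_cst)); apply: eq_Rintegral => u _; exact: mulrC.
have pi i : mu.-integrable `]z i, z i.+1] (EFin \o (fun u => u `^ (2 * nu - 1))).
  exact: integrable_powR.
rewrite JE; split; apply: ler_sum => i _; rewrite -tail_fun_integral// mulrCA;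
  (apply: ler_wpM2l; first exact: ltW tail_cst_gt0);
  (rewrite -RintegralZl; [|exact: measurable_itv|exact: pi]); apply: le_Rintegral; try exact: measurable_itv.
- exact: integrable_EFinZl.
- exact: fi.
- move=> u; rewrite /= in_itv/= => /andP[zu uz].
  by apply: ler_wpM2r; [exact: powR_ge0|exact/mono/ltW].
- exact: fi.
- exact: integrable_EFinZl.
- move=> u; rewrite /= in_itv/= => /andP[zu uz].
  apply: ler_wpM2r; first exact: powR_ge0.
  by apply: mono => //; apply: le_trans (zb i) (ltW zu).
Qed.

(** The limit of [t ^ nu P(I_oo < z <= I_t)], by [prob_surv_hit] and [cvg_energy_surv]; it vanishes
    at [0] and at [a]. *)
Definition hit_tail z := z `^ (2 * nu) * tail_fun z.

Lemma hit_tail_integral x y : 0 <= x -> x <= y ->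
  tail_cst * Rintegral mu `]x, y] (fun u => (a `^ (2 * nu) - 2 * u `^ (2 * nu)) * u `^ (2 * nu - 1))
  = hit_tail y - hit_tail x.
Proof.
move=> x0 xy; have y0 := le_trans x0 xy.
have p4 : 0 < 4 * nu by rewrite mulr_gt0.
have i2 : mu.-integrable `]x, y] (EFin \o (fun u => a `^ (2 * nu) * u `^ (2 * nu - 1))).
  exact/integrable_EFinZl/integrable_powR.
have i4 : mu.-integrable `]x, y] (EFin \o (fun u => 2 * u `^ (4 * nu - 1))).
  exact/integrable_EFinZl/integrable_powR.
have -> : Rintegral mu `]x, y] (fun u => (a `^ (2 * nu) - 2 * u `^ (2 * nu)) * u `^ (2 * nu - 1)) =
   Rintegral mu `]x, y] (fun u => a `^ (2 * nu) * u `^ (2 * nu - 1) - 2 * u `^ (4 * nu - 1)).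
  apply: eq_Rintegral => u; rewrite inE/= in_itv/= => /andP[xu _].
  have u0 : 0 < u := le_lt_trans x0 xu.
  rewrite mulrBl -mulrA -powRD ?(gt_eqF u0) ?implybT//; congr (_ - _ * _ `^ _); ring.
rewrite RintegralB// !RintegralZl//; try exact: integrable_powR.
rewrite !Rintegral_powR// /hit_tail !tail_funE// /tail_cst.
have e4 u : 0 <= u -> u `^ (4 * nu) = u `^ (2 * nu) * u `^ (2 * nu).
  move=> u0; rewrite -powRD; first by congr (_ `^ _); ring.
  by rewrite gt_eqF// addr_gt0.
rewrite !e4//; have an := powR_gt0 (2 * nu) a0.
by field; rewrite !gt_eqF.
Qed.

(** The constant after [e]: on [[0, a]] the factor [a ^ (2 nu) - 2 u ^ (2 nu)] is at most
    [a ^ (2 nu)] in absolute value, and the measure [tail_cst u ^ (2 nu - 1) du] has mass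
    [tail_fun 0 = c]. *)
Lemma hit_tail_stieltjes (g : R -> R) N (z : nat -> R) (e : R) : z 0 = 0 -> z N = a ->
  nondecreasing_seq z -> continuous g ->
  (forall i u, (i < N)%N -> z i <= u -> u <= z i.+1 -> `|g (z i) - g u| <= e) ->
  `|\sum_(i < N) g (z i) * (hit_tail (z i.+1) - hit_tail (z i)) -
    tail_cst * Rintegral mu `[0, a] (fun u => (a `^ (2 * nu) - 2 * u `^ (2 * nu)) * u `^ (2 * nu - 1) * g u)|
  <= e * (c * a `^ (2 * nu)).
Proof.
move=> z0 zN ndz cg ge.
pose w u := a `^ (2 * nu) - 2 * u `^ (2 * nu).
pose f u := w u * u `^ (2 * nu - 1) * g u.
have mw : measurable_fun setT w.
  apply: measurable_funB => //; apply: measurable_funM => //; exact: measurable_powR.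
have mg : measurable_fun setT g by exact: continuous_measurable_fun.
have mf : measurable_fun setT f.
  by apply: measurable_funM => //; apply: measurable_funM => //; exact: measurable_powR.
have zp i : 0 <= z i by rewrite -z0; exact: ndz.
have zz i : z i <= z i.+1 by exact: ndz.
have za i : (i <= N)%N -> z i <= a by move=> iN; rewrite -zN; exact: ndz.
have wle u : 0 <= u -> u <= a -> `|w u| <= a `^ (2 * nu).
  move=> u0 ua; have : u `^ (2 * nu) <= a `^ (2 * nu).
    by apply: ge0_ler_powR; rewrite ?nnegrE ?(ltW nu20) ?(ltW a0).
  have := powR_ge0 u (2 * nu); rewrite /w ler_norml => h1 h2; apply/andP; split; lra.
have [B hB] : exists B, forall u, 0 <= u -> u <= a -> `|g u| <= B.
  have /compact_bounded[B [_ hB]] : compact (g @` `[0, a]%classic).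
    apply: continuous_compact; last exact: segment_compact.
    exact: continuous_subspaceT.
  exists (B + 1) => u u0 ua; apply: (hB (B + 1)); first by rewrite ltrDl.
  by exists u => //=; rewrite in_itv/= u0.
have fi x y : 0 <= x -> x <= y -> y <= a -> mu.-integrable `]x, y] (EFin \o f).
  move=> x0 xy ya.
  have -> : EFin \o f = (fun u => ((w u * g u) * u `^ (2 * nu - 1))%:E).
    by apply/funext => u /=; rewrite /f mulrAC.
  apply: (@integrable_weighted_powR _ _ _ _ (a `^ (2 * nu) * B)) => //.
    exact: measurable_funM.
  move=> u xu uy; have u0 := le_trans x0 (ltW xu); have ua := le_trans uy ya.
  by rewrite normrM ler_pM ?wle ?hB.
have -> : Rintegral mu `[0, a] (fun u => w u * u `^ (2 * nu - 1) * g u) =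
    \sum_(i < N) Rintegral mu `]z i, z i.+1] f.
  rewrite -Rintegral_partition// z0 zN ?Rintegral_oc_cc ?(ltW a0)//.
  by apply: fi => //; exact: ltW.
rewrite mulr_sumr -sumrB; apply: (le_trans (ler_norm_sum _ _ _)).
have -> : e * (c * a `^ (2 * nu)) = \sum_(i < N) e * a `^ (2 * nu) * (tail_fun (z i) - tail_fun (z i.+1)).
  rewrite -mulr_sumr.
  have -> : \sum_(i < N) (tail_fun (z i) - tail_fun (z i.+1)) = tail_fun (z 0) - tail_fun (z N).
    exact: (sum_ord_telescope (tail_fun \o z)).
  rewrite z0 zN /tail_fun mul0r divff ?gt_eqF// powR0 ?gt_eqF// powR1; ring.
apply: ler_sum => i _; have iN := ltn_ord i.
have aS := za _ iN.
rewrite -hit_tail_integral// -tail_fun_integral// mulrCA -mulrBr normrM gtr0_norm ?tail_cst_gt0//.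
rewrite [leRHS]mulrCA; apply: ler_wpM2l; first exact: ltW tail_cst_gt0.
have wi : mu.-integrable `]z i, z i.+1] (EFin \o (fun u => w u * u `^ (2 * nu - 1))).
  apply: (@integrable_weighted_powR _ _ _ _ (a `^ (2 * nu))) => //.
  by move=> u xu uy; apply: wle; [exact: le_trans (ltW xu)|exact: le_trans aS].
have gwi : mu.-integrable `]z i, z i.+1] (EFin \o (fun u => g (z i) * (w u * u `^ (2 * nu - 1)))).
  exact: integrable_EFinZl.
have pi : mu.-integrable `]z i, z i.+1] (EFin \o (fun u => u `^ (2 * nu - 1))).
  exact: integrable_powR.
have di : mu.-integrable `]z i, z i.+1] (EFin \o (fun u => g (z i) * (w u * u `^ (2 * nu - 1)) - f u)).
  by apply: integrable_EFinB => //; exact: fi.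
rewrite -/w -RintegralZl// -RintegralB//; last exact: fi.
apply: (le_trans (le_normr_Rintegral _ _)) => //.
rewrite -RintegralZl//; apply: le_Rintegral => //.
- exact: integrable_norm.
- exact: integrable_EFinZl.
- move=> u; rewrite /= in_itv/= => /andP[zu uz].
  have u0 := le_trans (zp i) (ltW zu); have ua := le_trans uz aS.
  have -> : g (z i) * (w u * u `^ (2 * nu - 1)) - f u = (g (z i) - g u) * w u * u `^ (2 * nu - 1).
    by rewrite /f; ring.
  rewrite !normrM [X in _ * X]ger0_norm ?powR_ge0//.
  apply: ler_wpM2r; first exact: powR_ge0.
  by apply: ler_pM => //; [apply: ge => //; exact: ltW|exact: wle].
Qed.

End Stieltjes.
End PowerIntegral.

Lemma segment_modulus (R : realType) (g : R -> R) (a e : R) : continuous g -> 0 < e ->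
  exists2 dl, 0 < dl & forall x y, 0 <= x -> x <= a -> `|x - y| < dl -> `|g x - g y| <= e.
Proof.
move=> cg e0; have e20 : 0 < e / 2 by rewrite divr_gt0.
have /compact_near_coveringP/(_ _ ((0 : R)^'+)
  (fun dl x => forall y, `|x - y| < dl -> `|g x - g y| <= e)) := @segment_compact R 0 a.
case=> [x _|dl0 dl0_gt0 h].
  have /cvgrPdist_lt /(_ _ e20) /nbhs_ballP[r /= r0 hr] := cg x.
  have r20 : 0 < r / 2 by rewrite divr_gt0.
  (* Half of the radius for the centre [u] and half for [dl] put both [u] and [y] within [r] of
     [x]. *)
  exists (ball x (r / 2), [set dl : R | dl < r / 2]) => /=.
    by split; [exact: nbhsx_ballx|exact: nbhs_right_lt].
  move=> [u dl] /= [xu dlr] y uy; rewrite /ball/= in xu.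
  have xy : `|x - y| < r.
    have -> : x - y = (x - u) + (u - y) by ring.
    by apply: (le_lt_trans (ler_normD _ _)); move: (lt_trans uy dlr); lra.
  have h1 := hr u (lt_trans xu _); have h2 := hr y xy.
  have -> : g u - g y = - (g x - g u) + (g x - g y) by ring.
  apply: (le_trans (ler_normD _ _)); rewrite normrN.
  have r2r : r / 2 < r by rewrite gtr_pMr// invf_lt1// ltr1n.
  by have := h1 r2r; lra.
exists (dl0 / 2); first by rewrite divr_gt0.
move=> x y x0 xa; apply: (h (dl0 / 2)) => //=.
- by rewrite sub0r normrN gtr0_norm ?divr_gt0// gtr_pMr// invf_lt1// ltr1n.
- by rewrite divr_gt0.
- by rewrite in_itv/= x0.
Qed.

Lemma uniform_partition (R : realType) (g : R -> R) (a e : R) : 0 < a -> continuous g -> 0 < e ->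
  exists N (z : nat -> R), [/\ z 0 = 0, z N = a, nondecreasing_seq z &
    forall i u, (i < N)%N -> z i <= u -> u <= z i.+1 -> `|g (z i) - g u| <= e].
Proof.
move=> a0 cg e0; have [dl dl0 h] := segment_modulus a cg e0.
pose N := (Num.truncn (a / dl)).+1; have N0 : 0 < N%:R :> R by [].
have aN : a / N%:R < dl by rewrite ltr_pdivrMr// mulrC -ltr_pdivrMr// truncnS_gt.
exists N, (fun i => i%:R * (a / N%:R)); split.
- by rewrite mul0r.
- by rewrite mulrC divfK// gt_eqF.
- by move=> i j ij; rewrite ler_wpM2r ?ler_nat// divr_ge0 ?(ltW a0).
- move=> i u iN zu uz; apply: h.
  + by rewrite mulr_ge0// divr_ge0 ?(ltW a0).
  + by rewrite mulrA ler_pdivrMr// mulrC ler_pM2l// ler_nat ltnW.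
  + by move: uz; rewrite -natr1 mulrDl mul1r ler0_norm ?subr_le0//; lra.
Qed.

(** * Infima of the paths *)

Section Infima.
Variables (R : realType) (d : measure_display) (T : measurableType d) (X : R -> T -> R).
Hypothesis mX : forall t, measurable_fun setT (X t).
Hypothesis cX : forall w, {within `[0, +oo[%classic, continuous (fun s => X s w)}.
Implicit Types (t s y z : R).

Lemma run_inf_attained t w : 0 <= t -> exists s, [/\ 0 <= s, s <= t, X s w = run_inf X t w &
  forall u, 0 <= u -> u <= t -> X s w <= X u w].
Proof.
move=> t0.
have ct : {within `[0, t], continuous (fun s => X s w)}.
  by apply: continuous_subspaceW (cX (w := w)) => u /=; rewrite !in_itv/= andbT => /andP[].
have [s] := EVT_min t0 ct; rewrite in_itv/= => /andP[s0 st] hs; exists s; split => //.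
  apply/eqP; rewrite eq_le; apply/andP; split.
    apply: lb_le_inf; first by exists (X 0 w), 0 => //=; rewrite in_itv/= lexx.
    by move=> _ [u /= ut <-]; exact: hs.
  apply: ge_inf; last by exists s => //=; rewrite in_itv/= s0.
  by exists (X s w) => _ [u /= ut <-]; exact: hs.
by move=> u u0 ut; apply: hs; rewrite in_itv/= u0.
Qed.

Lemma le_run_inf t z w : 0 <= t ->
  z <= run_inf X t w <-> (forall s, 0 <= s -> s <= t -> z <= X s w).
Proof.
move=> t0; have [s [s0 st <- hs]] := run_inf_attained w t0.
by split=> [zs u u0 ut|]; [exact: le_trans (hs u u0 ut)|apply].
Qed.

Lemma glob_inf_lt y w : glob_inf X w < y -> hit_ever X 0 y w.
Proof.
move=> /inf_lt[]; first by exists (X 0 w), 0 => //=; rewrite in_itv/= lexx.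
by move=> _ [s /= + <-] Xy; rewrite in_itv/= andbT => s0; exists s.
Qed.

(** The infimum of a set unbounded below is [0] by default, hence the level [y] that the path never
    goes below. *)
Lemma ge_glob_inf s y w : ~ hit_ever X 0 y w -> 0 <= s -> glob_inf X w <= X s w.
Proof.
move=> nh s0; apply: ge_inf; last by exists s => //=; rewrite in_itv/= s0.
exists y => _ [u /= + <-]; rewrite in_itv/= andbT => u0.
by rewrite leNgt; apply/negP => h; apply: nh; exists u.
Qed.

Lemma measurable_run_inf t : 0 < t -> measurable_fun setT (run_inf X t).
Proof.
move=> t0; apply: (measurability _ (RGenCInfty.measurableE R)) => // _ [_ [y ->] <-].
rewrite setTI (_ : _ @^-1` _ = ~` hit X 0 t y).
  by apply: measurableC; exact: measurable_hit.
apply/seteqP; split => w; rewrite /= in_itv/= andbT (le_run_inf _ _ (ltW t0)).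
  by move=> h [s [s0]]; rewrite add0r => st; rewrite ltNge h.
move=> nh s s0 st; rewrite leNgt; apply/negP => Xy; apply: nh.
by exists s; rewrite add0r.
Qed.

Lemma measurable_glob_inf : measurable_fun setT (glob_inf X).
Proof.
have mh y : measurable (hit_ever X 0 y) by exact: measurable_hit_ever.
(* The paths bounded below. On the others [glob_inf] has the default value [0], so these satisfy
   [y <= glob_inf X w] exactly when [y <= 0]. *)
pose B := \bigcup_n ~` hit_ever X 0 (- n%:R).
have mB : measurable B by apply: bigcup_measurable => n _; exact: measurableC.
have BP w : B w <-> has_inf [set X s w | s in `[0, +oo[%classic].
  split=> [[n _ nh]|[_ [m hm]]].
    split; first by exists (X 0 w), 0 => //=; rewrite in_itv/= lexx.
    exists (- n%:R) => _ [u /= + <-]; rewrite in_itv/= andbT => u0.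
    by rewrite leNgt; apply/negP => h; apply: nh; exists u.
  exists (Num.truncn `|m|).+1 => // -[s s0]; apply/negP; rewrite -leNgt.
  apply: (@le_trans _ _ m); last by apply: hm; exists s => //=; rewrite in_itv/= s0.
  rewrite lerNl; apply: (le_trans (ler_norm _)); rewrite normrN ltW//; exact: truncnS_gt.
apply: (measurability _ (RGenCInfty.measurableE R)) => // _ [_ [y ->] <-].
rewrite setTI (_ : _ @^-1` _ = (B `&` ~` hit_ever X 0 y) `|` (if y <= 0 then ~` B else set0)).
  apply: measurableU; first by apply: measurableI => //; exact: measurableC.
  by case: ifP => // _; exact: measurableC.
apply/seteqP; split => w; rewrite /= in_itv/= andbT.
  move=> yG; have [Bw|nB] := pselect (B w).
    left; split => // -[s s0 Xs]; have [_ hl] := (BP w).1 Bw.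
    have : glob_inf X w <= X s w by apply: ge_inf => //; exists s => //=; rewrite in_itv/= s0.
    by move=> /(le_trans yG); rewrite leNgt Xs.
  right; move: yG; rewrite /glob_inf inf_out; last by move/BP.
  by move=> ->.
case=> [[Bw nh]|].
  by rewrite leNgt; apply/negP => /glob_inf_lt.
case: ifP => // y0 nB; rewrite /glob_inf inf_out//; by move/BP.
Qed.

(** On the compact [[0, t]] the continuous distance from [X s w] to [G w] avoids [0] only if it is
    at least some [1 / (n + 1)], and this is the complement of a [hit] event for the distance. *)
Lemma measurable_never_eq (G : T -> R) t : measurable_fun setT G -> 0 < t ->
  measurable [set w | forall s, 0 <= s -> s <= t -> X s w != G w].
Proof.
move=> mG t0; pose Y s w := `|X s w - G w|.
have mY s : measurable_fun setT (Y s).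
  by apply: measurableT_comp => //; exact: measurable_funB.
have cY w : {within `[0, +oo[%classic, continuous (fun s => Y s w)}.
  move=> s; apply: cvg_norm; apply: cvgB; first exact: (cX (w := w)).
  exact: cvg_cst.
rewrite (_ : [set w | _] = \bigcup_n ~` hit Y 0 t n.+1%:R^-1).
  by apply: bigcup_measurable => n _; apply: measurableC; exact: measurable_hit.
apply/seteqP; split => w.
  move=> /= h.
  have ct : {within `[0, t], continuous (fun s => Y s w)}.
    by apply: continuous_subspaceW (cY w) => u /=; rewrite !in_itv/= andbT => /andP[].
  have [s] := EVT_min (ltW t0) ct; rewrite in_itv/= => /andP[s0 st] hs.
  have Ys : 0 < Y s w by rewrite normr_gt0 subr_eq0 h.
  exists (Num.truncn (Y s w)^-1) => // -[u [u0]]; rewrite add0r => ut; apply/negP; rewrite -leNgt.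
  apply: (@le_trans _ _ (Y s w)); last by apply: hs; rewrite in_itv/= u0.
  by rewrite -[leRHS]invrK lef_pV2 ?posrE ?invr_gt0// ltW// truncnS_gt.
move=> [n _ nh] s s0 st; apply/eqP => XG; apply: nh; exists s; rewrite add0r; split => //.
by rewrite /Y XG subrr normr0 invr_gt0.
Qed.

(** The infimum of the empty set is [0], so [argmin_time] is [0] when [glob_inf] is not attained;
    hence the first clause. *)
Lemma argmin_time_gt t w : 0 <= t -> t < argmin_time X w <->
  (exists2 s, 0 <= s & X s w = glob_inf X w) /\ (forall s, 0 <= s -> s <= t -> X s w != glob_inf X w).
Proof.
move=> t0; rewrite /argmin_time; set S := [set s | _]; split=> [tS|[[s s0 Xs] h]].
  have lbS : has_lbound S by exists 0 => s [].
  split.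
    apply: contrapT => nS; have S0 : S = set0.
      by apply/seteqP; split => // s [s0 Xs]; apply: nS; exists s.
    by move: tS; rewrite S0 inf0 ltNge t0.
  move=> s s0 st; apply/eqP => Xs; have := ge_inf lbS (conj s0 Xs : S s).
  by rewrite leNgt (le_lt_trans st tS).
have S0 : S !=set0 by exists s.
(* The strict inequality needs a margin: by continuity a value avoided at [t] is avoided up to some
   [t + e]. The sign gives [Y] the form that [within_continuous_lt] takes. *)
pose Y u := - `|X u w - glob_inf X w|.
have cY : {within `[0, +oo[%classic, continuous Y}.
  move=> u; apply: cvgN; apply: cvg_norm; apply: cvgB; first exact: (cX (w := w)).
  exact: cvg_cst.
have Yt : Y t < 0 by rewrite oppr_lt0 normr_gt0 subr_eq0 h.
have [e e0 he] := within_continuous_lt cY t0 Yt.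
apply: (@lt_le_trans _ _ (t + e)); first by rewrite ltrDl.
apply: lb_le_inf => // u [u0 Xu]; rewrite leNgt; apply/negP => ut.
have ltu : t < u by rewrite ltNge; apply/negP => ule; move: (h u u0 ule); rewrite Xu eqxx.
have := he u u0; rewrite /Y Xu subrr normr0 oppr0 ltxx gtr0_norm ?subr_gt0// => H.
by suff : false by []; apply: H; rewrite ltrBlDl.
Qed.

Lemma measurable_argmin_time_gt t : 0 < t -> measurable [set w | t < argmin_time X w].
Proof.
move=> t0; have mG := measurable_glob_inf.
rewrite (_ : [set w | _] = (\bigcup_n ~` [set w | forall s, 0 <= s -> s <= n.+1%:R -> X s w != glob_inf X w])
   `&` [set w | forall s, 0 <= s -> s <= t -> X s w != glob_inf X w]).
  apply: measurableI; last exact: measurable_never_eq.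
  by apply: bigcup_measurable => n _; apply: measurableC; exact: measurable_never_eq.
apply/seteqP; split => w /=; rewrite (argmin_time_gt _ (ltW t0)).
  move=> [[s s0 Xs] h]; split => //; exists (Num.truncn s) => // H.
  by have /negP := H s s0 (ltW (truncnS_gt s)); rewrite Xs eqxx.
move=> [[n _ nh] h]; split => //; apply: contrapT => H; apply: nh => s s0 _.
by apply/eqP => Xs; apply: H; exists s.
Qed.

End Infima.

Lemma cvg_sum_ord (R : realType) (S : Type) (F : set_system S) (FF : Filter F)
    (f : nat -> S -> R) (l : nat -> R) N :
  (forall i, (i < N)%N -> f i x @[x --> F] --> l i) ->
  \sum_(i < N) f i x @[x --> F] --> \sum_(i < N) l i.
Proof.
elim: N => [|N ih] fl.
  by rewrite big_ord0 (_ : (fun _ => _) = cst 0) ?funeqE => [|x]; [exact: cvg_cst|rewrite big_ord0].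
rewrite big_ord_recr/= (_ : (fun _ => _) = (fun x => \sum_(i < N) f i x + f N x)).
  by apply: cvgD; [apply: ih => i iN; apply: fl; exact: ltnW|exact: fl].
by apply/funext => x; rewrite big_ord_recr.
Qed.

(** * The limits *)

Section Limits.
Variables (R : realType) (nu a : R) (d : measure_display) (T : measurableType d).
Variables (P : probability T R) (X : R -> T -> R).
Hypothesis nu0 : 0 < nu.
Hypothesis a0 : 0 < a.
Hypothesis HX : is_bessel_process P nu a X.
Implicit Types (t s x y z b : R) (E F : set T).

Let X0 w : X 0 w = a. Proof. by case: HX. Qed.
Let cX w : {within `[0, +oo[%classic, continuous (fun s => X s w)}.
Proof. by case: HX. Qed.
Let mX t : measurable_fun setT (X t). Proof. by case: HX. Qed.
Notation c := (bessel_cst nu).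
Let c0 : 0 < c := bessel_cst_gt0 nu0.
Let nu20 : 0 < 2 * nu. Proof. by rewrite mulr_gt0. Qed.

Local Notation pr E := (fine (P E)).
Local Notation en t z := (fine (energy nu P X t (surv X t z))).

Let prE E : measurable E -> P E = (pr E)%:E.
Proof. by move=> mE; rewrite fineK// fin_num_measure. Qed.

Let pr_ge0 E : 0 <= pr E. Proof. exact: fine_ge0. Qed.

Lemma pr_le E F : measurable E -> measurable F -> E `<=` F -> pr E <= pr F.
Proof. by move=> mE mF EF; rewrite -lee_fin -!prE//; apply: le_measure; rewrite ?inE. Qed.

Lemma prU E F : measurable E -> measurable F -> E `&` F = set0 -> pr (E `|` F) = pr E + pr F.
Proof.
move=> mE mF EF; apply: EFin_inj; rewrite EFinD -!prE//; last exact: measurableU.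
by rewrite measureU.
Qed.

(* Positivity of the paths is not assumed: it holds only almost surely, as a
   consequence of the finite-dimensional laws. *)
Definition goes_negative := hit_ever X 0 0.

Lemma measurable_neg : measurable goes_negative.
Proof. exact: measurable_hit_ever. Qed.

Lemma pr_neg : pr goes_negative = 0.
Proof. by rewrite (prob_hit_neg nu0 a0 HX). Qed.

Lemma pr_modneg E F : measurable E -> measurable F -> E `<=` F `|` goes_negative -> pr E <= pr F.
Proof.
move=> mE mF EF; have mN := measurable_neg.
apply: (@le_trans _ _ (pr (F `|` goes_negative))); first by apply: pr_le => //; exact: measurableU.
have -> : F `|` goes_negative = F `|` (goes_negative `\` F) by rewrite setUDr setDv setD0.
rewrite prU//; [|exact: measurableD|by apply/seteqP; split => // w [Fw [_ /(_ Fw)]]].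
rewrite gerDl -pr_neg; apply: pr_le => //; exact: measurableD.
Qed.

Lemma surv_run_inf t z w : 0 < t -> surv X t z w <-> z <= run_inf X t w.
Proof.
move=> t0; rewrite (le_run_inf cX _ _ (ltW t0)).
split=> [[_ h] s s0 st|h].
  by rewrite leNgt; apply/negP => Xs; apply: h; exists s; rewrite add0r.
by split => // -[s [s0]]; rewrite add0r => st; rewrite ltNge h.
Qed.

Lemma run_inf_le t w : 0 < t -> run_inf X t w <= a.
Proof.
move=> t0; have := (le_run_inf cX (run_inf X t w) w (ltW t0)).1 (lexx _) 0 (lexx _) (ltW t0).
by rewrite X0.
Qed.

Definition gap t b : set T := [set w | run_inf X t w - glob_inf X w > b].

Lemma measurable_gap t b : 0 < t -> measurable (gap t b).
Proof.
move=> t0; have m1 := measurable_run_inf mX cX t0; have m2 := measurable_glob_inf mX cX.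
have := measurable_funB m1 m2 => /(_ measurableT `]b, +oo[%classic).
rewrite setTI => /(_ (measurable_itv _)); congr measurable.
by apply/seteqP; split => w; rewrite /= in_itv/= andbT.
Qed.

Lemma measurable_bin t x y : 0 < t -> measurable (surv X t x `\` surv X t y).
Proof. by move=> t0; apply: measurableD; exact: (measurable_surv nu0 HX). Qed.

Lemma energy_bin t x y : 0 < t -> x <= y ->
  energy nu P X t (surv X t x `\` surv X t y) = (en t x - en t y)%:E.
Proof.
move=> t0 xy; have mx := measurable_surv nu0 HX x t0; have my := measurable_surv nu0 HX y t0.
have mb := measurable_bin x y t0.
have : energy nu P X t (surv X t x) = energy nu P X t (surv X t x `\` surv X t y) + energy nu P X t (surv X t y).
  rewrite -energyU//; last by rewrite setDKI.
  by rewrite setUC setDUK//; exact: surv_subz.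
have [[f1 f2] f3] := (energy_fin nu0 a0 HX t0 mx, energy_fin nu0 a0 HX t0 my, energy_fin nu0 a0 HX t0 mb).
rewrite -(fineK f1) -(fineK f2) -(fineK f3) -EFinD => -[->].
by rewrite addrK.
Qed.

(** On [x <= I_t < y] a gap above [b] forces [I_oo < I_t - b < y - b]; until [t] the path is at or
    above [I_t], so it goes below [y - b] after [t]. *)
Lemma gap_bin_le t b x y : 0 < t -> 0 <= b -> b <= x -> x <= y ->
  pr (gap t b `&` (surv X t x `\` surv X t y)) <= (y - b) `^ (2 * nu) * (en t x - en t y).
Proof.
(* The empty bin is set apart, as [y - b] could then be [0]. *)
move=> t0 b0 bx; rewrite le_eqVlt => /predU1P[->|xy].
  by rewrite setDv setI0 measure0 subrr mulr0.
have yb : 0 < y - b by rewrite subr_gt0 (le_lt_trans bx).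
have mb := measurable_bin x y t0; have mg := measurable_gap b t0.
have mh : measurable (hit_ever X t (y - b)) by apply: measurable_hit_ever => //; exact: ltW.
have mk : markov_at nu P X t (surv X t x `\` surv X t y).
  apply: (markov_setD nu0 mX); [by apply: surv_subz; exact: ltW|exact: (markov_surv nu0 HX)|exact: (markov_surv nu0 HX)].
apply: (@le_trans _ _ (pr ((surv X t x `\` surv X t y) `&` hit_ever X t (y - b)))).
  apply: pr_le; [exact: measurableI|exact: measurableI|move=> w [gw bw]; split => //].
  have [sx /(surv_run_inf _ _ t0)/negP] := bw; rewrite -ltNge => Iy.
  have : glob_inf X w < run_inf X t w - b by rewrite ltrBrDl -ltrBrDr.
  move=> /glob_inf_lt[s s0 Xs]; exists s; last by apply: (lt_trans Xs); rewrite ltrD2r.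
  rewrite leNgt; apply/negP => st.
  have := (le_run_inf cX (run_inf X t w) w (ltW t0)).1 (lexx _) s s0 (ltW st).
  by rewrite leNgt (lt_le_trans Xs)// gerBl.
rewrite -lee_fin -prE ?EFinM; last exact: measurableI.
rewrite -energy_bin// ?(ltW xy)//.
exact: (prob_hit_ever_le nu0 mX cX mk (ltW t0) yb).
Qed.

(** Since [x <= I_t], going below [x - b] after [t] brings [I_oo] below [I_t - b]. Negative paths
    are discarded as a null event, because [glob_inf] may be a default value there. *)
Lemma gap_bin_ge t b x y : 0 < t -> 0 <= b -> b <= x -> x <= y ->
  (x - b) `^ (2 * nu) * (en t x - en t y) <= pr (gap t b `&` (surv X t x `\` surv X t y)).
Proof.
move=> t0 b0; rewrite le_eqVlt => /predU1P[->|bx] xy.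
  by rewrite subrr powR0 ?gt_eqF// mul0r.
have xb : 0 < x - b by rewrite subr_gt0.
have mb := measurable_bin x y t0; have mg := measurable_gap b t0.
have mh : measurable (hit_ever X t (x - b)) by apply: measurable_hit_ever => //; exact: ltW.
have mk : markov_at nu P X t (surv X t x `\` surv X t y).
  apply: (markov_setD nu0 mX); [exact: surv_subz|exact: (markov_surv nu0 HX)|exact: (markov_surv nu0 HX)].
apply: (@le_trans _ _ (pr ((surv X t x `\` surv X t y) `&` hit_ever X t (x - b)))); last first.
  apply: pr_modneg; [exact: measurableI|exact: measurableI|move=> w [bw [s ts Xs]]].
  have [nw|nw] := pselect (goes_negative w); [by right|left; split => //].
  have xI : x <= run_inf X t w by apply/(surv_run_inf _ _ t0); exact: bw.1.
  have := ge_glob_inf nw (le_trans (ltW t0) ts); rewrite /gap/=; lra.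
rewrite -lee_fin -prE ?EFinM; last exact: measurableI.
rewrite -energy_bin//.
apply: (prob_hit_ever_ge nu0 mX cX mk (ltW t0) xb) => w [[_ h] _] /=.
rewrite leNgt; apply/negP => Xt; apply: h; exists t; rewrite add0r; split => //; first exact: ltW.
by apply: (lt_le_trans Xt); rewrite gerBl.
Qed.

(** The last cell, on which [I_t = a]. An upper bound is enough: its limit is a multiple of
    [tail_fun a = 0]. *)
Lemma gap_top_le t b : 0 < t -> 0 <= b -> b <= a ->
  pr (gap t b `&` surv X t a) <= (a - b) `^ (2 * nu) * en t a.
Proof.
move=> t0 b0 ba; have ms := measurable_surv nu0 HX a t0; have mg := measurable_gap b t0.
have sub y : a - b <= y -> gap t b `&` surv X t a `<=` surv X t a `&` hit_ever X t y.
  move=> aby w [gw sw]; split => //.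
  have : glob_inf X w < run_inf X t w - b by rewrite ltrBrDl -ltrBrDr.
  move=> /glob_inf_lt[s s0 Xs]; have Ia := run_inf_le w t0.
  exists s; last by apply: (lt_le_trans Xs); rewrite (le_trans _ aby)// lerD2r.
  rewrite leNgt; apply/negP => st.
  have := (le_run_inf cX (run_inf X t w) w (ltW t0)).1 (lexx _) s s0 (ltW st).
  by rewrite leNgt (lt_le_trans Xs)// gerBl.
(* For [b = a] the level [a - b] is [0], and going below it is a null event. *)
move: ba; rewrite le_eqVlt => /predU1P[ba|ba].
  subst b; rewrite subrr powR0 ?gt_eqF// mul0r -pr_neg; apply: pr_le; [exact: measurableI|exact: measurable_neg|].
  by move=> w /(sub 0); rewrite subrr => /(_ (lexx _))[_ [s ts Xs]]; exists s => //; exact: le_trans (ltW t0) ts.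
have ab : 0 < a - b by rewrite subr_gt0.
have mh : measurable (hit_ever X t (a - b)) by apply: measurable_hit_ever => //; exact: ltW.
apply: (@le_trans _ _ (pr (surv X t a `&` hit_ever X t (a - b)))).
  by apply: pr_le; [exact: measurableI|exact: measurableI|exact: sub].
rewrite -lee_fin -prE ?EFinM; last exact: measurableI.
rewrite fineK; last exact: (energy_fin nu0 a0 HX).
exact: (prob_hit_ever_le nu0 mX cX (markov_surv nu0 HX a t0) (ltW t0) ab).
Qed.

Lemma pr_bins E t (z : nat -> R) N : 0 < t -> measurable E -> nondecreasing_seq z ->
  pr E = pr (E `\` surv X t (z 0)) + \sum_(i < N) pr (E `&` (surv X t (z i) `\` surv X t (z i.+1)))
    + pr (E `&` surv X t (z N)).
Proof.
move=> t0 mE ndz; have ms y := measurable_surv nu0 HX y t0.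
elim: N => [|N ih].
  rewrite big_ord0 addr0 -prU; [|exact: measurableD|exact: measurableI|].
    by rewrite setUC setUIDK.
  by apply/seteqP; split => // w [[_ nw] [_ /nw]].
rewrite ih big_ord_recr/= -!addrA; congr (_ + (_ + _)).
rewrite -prU; last 3 first.
- by apply: measurableI => //; exact: measurable_bin.
- exact: measurableI.
- by apply/seteqP; split => // w [[_ [_ h]] [_ /h]].
rewrite -setIUr setUC setDUK//; apply: surv_subz; exact: ndz.
Qed.

(** [I_t < b] together with a gap above [b] gives [I_oo < 0]. *)
Lemma pr_gap_below t b : 0 < t -> 0 <= b -> pr (gap t b `\` surv X t b) = 0.
Proof.
move=> t0 b0; have ms := measurable_surv nu0 HX b t0; have mg := measurable_gap b t0.
apply/eqP; rewrite eq_le pr_ge0 andbT -pr_neg; apply: pr_le.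
- exact: measurableD.
- exact: measurable_neg.
move=> w [gw /(surv_run_inf _ _ t0)/negP]; rewrite -ltNge => Ib.
by apply: glob_inf_lt; move: gw; rewrite /gap/=; lra.
Qed.

Lemma gap_bounds t b N (z : nat -> R) : 0 < t -> 0 <= b -> b <= a ->
  z 0 = b -> z N = a -> nondecreasing_seq z ->
  \sum_(i < N) (z i - b) `^ (2 * nu) * (en t (z i) - en t (z i.+1)) <= pr (gap t b) /\
  pr (gap t b) <= \sum_(i < N) (z i.+1 - b) `^ (2 * nu) * (en t (z i) - en t (z i.+1))
    + (a - b) `^ (2 * nu) * en t a.
Proof.
move=> t0 b0 ba z0 zN ndz; have zb i : b <= z i by rewrite -z0; exact: ndz.
have zz i : z i <= z i.+1 by exact: ndz.
rewrite (@pr_bins _ t z N)//; last exact: measurable_gap.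
rewrite z0 pr_gap_below// add0r zN; split.
  rewrite -[leLHS]addr0; apply: lerD; last exact: pr_ge0.
  by apply: ler_sum => i _; exact: gap_bin_ge.
by rewrite lerD ?gap_top_le//; apply: ler_sum => i _; exact: gap_bin_le.
Qed.

Lemma cvg_en z : 0 <= z -> z <= a -> t `^ nu * en t z @[t --> +oo] --> tail_fun nu c a z.
Proof. by move=> z0 za; exact: (cvg_energy_surv nu0 a0 HX). Qed.

(* [(u - b) ^ (2 nu)] increases by the same amount on each cell. *)
Let cell b N i := b + (a - b) * (i%:R / N%:R) `^ (2 * nu)^-1.

Lemma cell_pow b N i : b <= a -> (cell b N i - b) `^ (2 * nu) = (a - b) `^ (2 * nu) * (i%:R / N%:R).
Proof.
move=> ba; have ab : 0 <= a - b by rewrite subr_ge0.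
have iN : 0 <= i%:R / N%:R :> R by rewrite divr_ge0.
by rewrite /cell addrC addKr powRM ?powR_ge0// -powRrM mulVf ?gt_eqF// powRr1.
Qed.

Let sandwich (J q U L e : R) : L <= J -> J <= U -> U - L <= e / 2 -> L - e / 2 <= q -> q <= U + e / 2 ->
  `|J - q| <= e.
Proof. by move=> *; rewrite ler_norml; apply/andP; split; lra. Qed.

Theorem cvg_gap b : 0 <= b -> b <= a ->
  t `^ nu * pr (gap t b) @[t --> +oo] -->
    tail_cst nu c a * Rintegral lebesgue_measure `[b, a] (fun u => u `^ (2 * nu - 1) * (u - b) `^ (2 * nu)).
Proof.
move=> b0 ba; set J := tail_cst _ _ _ * _; apply/cvgrPdist_le => e e0.
have ab : 0 <= a - b by rewrite subr_ge0.
have A0 : 0 <= (a - b) `^ (2 * nu) * c by rewrite mulr_ge0 ?powR_ge0 ?(ltW c0).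
(* The upper and lower sums will differ by [(a - b) ^ (2 nu) / N] times [tail_fun b <= c]. *)
pose N := (Num.truncn ((a - b) `^ (2 * nu) * c / (e / 2))).+1.
have e20 : 0 < e / 2 by rewrite divr_gt0.
have N0 : 0 < N%:R :> R by [].
have NA : (a - b) `^ (2 * nu) * c / N%:R <= e / 2.
  by rewrite ler_pdivrMr// [leRHS]mulrC -ler_pdivrMr// ltW// truncnS_gt.
pose z := cell b N.
have z0 : z 0 = b by rewrite /z /cell mul0r powR0 ?mulr0 ?addr0// invr_eq0 gt_eqF.
have zN : z N = a by rewrite /z /cell divff ?gt_eqF// powR1 mulr1 addrC subrK.
have ndz : nondecreasing_seq z.
  move=> i j ij; rewrite lerD2l ler_wpM2l//; apply: ge0_ler_powR.
  - by rewrite invr_ge0 ltW.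
  - by rewrite nnegrE divr_ge0.
  - by rewrite nnegrE divr_ge0.
  - by rewrite ler_pM2r ?invr_gt0// ler_nat.
have zb i : b <= z i by rewrite -z0; exact: ndz.
have za i : (i <= N)%N -> z i <= a by move=> iN; rewrite -zN; exact: ndz.
have zp i : 0 <= z i by exact: le_trans (zb i).
pose H := tail_fun nu c a.
pose U := \sum_(i < N) (z i.+1 - b) `^ (2 * nu) * (H (z i) - H (z i.+1)).
pose L := \sum_(i < N) (z i - b) `^ (2 * nu) * (H (z i) - H (z i.+1)).
have [LJ JU] := tail_stieltjes_bounds nu0 c0 a0 b0 z0 zN ndz.
have H0 y : 0 <= y -> H y <= c.
  by move=> y0; rewrite /H /tail_fun ler_piMr ?(ltW c0)// gerBl powR_ge0.
have Ha : H a = 0 by rewrite /H /tail_fun divff ?gt_eqF// powR1 subrr mulr0.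
have UL : U - L <= e / 2.
  have -> : U - L = \sum_(i < N) (a - b) `^ (2 * nu) / N%:R * (H (z i) - H (z i.+1)).
    rewrite -sumrB; apply: eq_bigr => i _; rewrite -mulrBl !cell_pow// -natr1.
    by congr (_ * _); field; rewrite gt_eqF.
  rewrite -mulr_sumr.
  have -> : \sum_(i < N) (H (z i) - H (z i.+1)) = H (z 0) - H (z N).
    exact: (sum_ord_telescope (H \o z)).
  rewrite z0 zN Ha subr0; apply: le_trans NA; rewrite mulrAC.
  rewrite ler_pM2r ?invr_gt0//; apply: ler_wpM2l; first exact: powR_ge0.
  exact: H0.
(* The partition stays fixed while [t] tends to infinity, so finitely many limits [cvg_en] are
   combined. *)
have cvU : t `^ nu * (\sum_(i < N) (z i.+1 - b) `^ (2 * nu) * (en t (z i) - en t (z i.+1))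
    + (a - b) `^ (2 * nu) * en t a) @[t --> +oo] --> U + (a - b) `^ (2 * nu) * H a.
  rewrite (_ : (fun t => _) = (fun t => \sum_(i < N) (z i.+1 - b) `^ (2 * nu) * (t `^ nu * en t (z i) - t `^ nu * en t (z i.+1)) + (a - b) `^ (2 * nu) * (t `^ nu * en t a))).
    apply: cvgD; last by apply: cvgM; [exact: cvg_cst|apply: cvg_en => //; exact: ltW].
    apply: (@cvg_sum_ord _ _ _ _ (fun i t => (z i.+1 - b) `^ (2 * nu) * (t `^ nu * en t (z i) - t `^ nu * en t (z i.+1))) (fun i => (z i.+1 - b) `^ (2 * nu) * (H (z i) - H (z i.+1)))) => i iN; apply: cvgM; first exact: cvg_cst.
    by apply: cvgB; apply: cvg_en => //; apply: za => //; exact: ltnW.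
  apply/funext => t; rewrite mulrDr mulr_sumr; congr (_ + _); last by ring.
  by apply: eq_bigr => i _; rewrite -[in RHS]mulrBr mulrCA.
have cvL : t `^ nu * (\sum_(i < N) (z i - b) `^ (2 * nu) * (en t (z i) - en t (z i.+1))) @[t --> +oo] --> L.
  rewrite (_ : (fun t => _) = (fun t => \sum_(i < N) (z i - b) `^ (2 * nu) * (t `^ nu * en t (z i) - t `^ nu * en t (z i.+1)))).
    apply: (@cvg_sum_ord _ _ _ _ (fun i t => (z i - b) `^ (2 * nu) * (t `^ nu * en t (z i) - t `^ nu * en t (z i.+1))) (fun i => (z i - b) `^ (2 * nu) * (H (z i) - H (z i.+1)))) => i iN; apply: cvgM; first exact: cvg_cst.
    by apply: cvgB; apply: cvg_en => //; apply: za => //; exact: ltnW.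
  by apply/funext => t; rewrite mulr_sumr; apply: eq_bigr => i _; rewrite -[in RHS]mulrBr mulrCA.
rewrite Ha mulr0 addr0 in cvU.
have Ue : U < U + e / 2 by rewrite ltrDl.
have Le : L - e / 2 < L by rewrite gtrBl.
have /cvgr_le/(_ _ Ue) nU := cvU; have /cvgr_ge/(_ _ Le) nL := cvL.
near=> t; have t0 : 0 < t by near: t; apply: nbhs_pinfty_gt; exact: num_real.
have tn := powR_gt0 nu t0.
have [lo up] := gap_bounds t0 b0 ba z0 zN ndz.
have {}lo := ler_wpM2l (ltW tn) lo; have {}up := ler_wpM2l (ltW tn) up.
have hU : t `^ nu * (\sum_(i < N) (z i.+1 - b) `^ (2 * nu) * (en t (z i) - en t (z i.+1))
    + (a - b) `^ (2 * nu) * en t a) <= U + e / 2 by near: t.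
have hL : L - e / 2 <= t `^ nu * (\sum_(i < N) (z i - b) `^ (2 * nu) * (en t (z i) - en t (z i.+1))) by near: t.
have h1 := le_trans hL lo; have h2 := le_trans up hU.
exact: (@sandwich J _ U L e LJ JU UL h1 h2).
Unshelve. all: end_near. Qed.

End Limits.

(** * The time at which the infimum is attained *)

Section Limits2.
Variables (R : realType) (nu a : R) (d : measure_display) (T : measurableType d).
Variables (P : probability T R) (X : R -> T -> R).
Hypothesis nu0 : 0 < nu.
Hypothesis a0 : 0 < a.
Hypothesis HX : is_bessel_process P nu a X.
Implicit Types (t s x y z b : R) (E F : set T).

Let X0 w : X 0 w = a. Proof. by case: HX. Qed.
Let cX w : {within `[0, +oo[%classic, continuous (fun s => X s w)}.
Proof. by case: HX. Qed.
Let mX t : measurable_fun setT (X t). Proof. by case: HX. Qed.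
Notation c := (bessel_cst nu).
Let c0 : 0 < c := bessel_cst_gt0 nu0.
Let nu20 : 0 < 2 * nu. Proof. by rewrite mulr_gt0. Qed.
Local Notation pr E := (fine (P E)).
Local Notation en t z := (fine (energy nu P X t (surv X t z))).

Lemma prU_le E F : measurable E -> measurable F -> pr (E `|` F) <= pr E + pr F.
Proof.
move=> mE mF; rewrite -lee_fin EFinD !fineK ?fin_num_measure//; first exact: measureU2.
exact: measurableU.
Qed.

Lemma glob_inf_lt_run_inf t w : 0 <= t -> ~ goes_negative X w ->
  (forall s, 0 <= s -> s <= t -> X s w != glob_inf X w) -> glob_inf X w < run_inf X t w.
Proof.
move=> t0 nw h; have [s [s0 st <- _]] := run_inf_attained cX w t0.
by rewrite lt_neqAle eq_sym h//= (ge_glob_inf nw).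
Qed.

Lemma gap0_bound : exists2 K, 0 < K & \forall t \near +oo, t `^ nu * pr (gap X t 0) <= K.
Proof.
have := cvg_gap nu0 a0 HX (lexx 0) (ltW a0); set J := tail_cst _ _ _ * _ => cv.
exists (`|J| + 1); first by rewrite ltr_wpDl.
have Je : J < `|J| + 1 by rewrite (le_lt_trans (ler_norm _))// ltrDl.
by move: cv => /cvgr_le/(_ _ Je).
Qed.

Lemma pr_gap0_small e : 0 < e -> exists2 t, 0 < t & pr (gap X t 0) <= e.
Proof.
move=> e0; have [K K0 [M [_ hM]]] := gap0_bound.
have [L L0 hL] := powRN_small nu0 (divr_gt0 e0 K0).
pose t := Num.max (M + 1) L; exists t; first by rewrite lt_max L0 orbT.
have t0 : 0 < t by rewrite lt_max L0 orbT.
have tL : L <= t by rewrite le_max lexx orbT.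
have Mt : M < t by rewrite lt_max ltrDl ltr01.
have := hM t Mt; have := hL t tL; rewrite powRN ler_pdivlMr// => h1 h2.
have tn := powR_gt0 nu t0.
have -> : pr (gap X t 0) = (t `^ nu)^-1 * (t `^ nu * pr (gap X t 0)) by rewrite mulKf// gt_eqF.
by apply: le_trans h1; apply: ler_wpM2l => //; rewrite invr_ge0 ltW.
Qed.

(** If the infimum is not attained up to [t], there is a gap at [t]. Conversely a gap at [t] gives
    [argmin_time > t] once the infimum is attained somewhere; this fails only if there is a gap at
    every [u], and the probability of a gap at [u] can be made as small as desired. *)
Lemma pr_argmin_gap t : 0 < t -> pr [set w | t < argmin_time X w] = pr (gap X t 0).
Proof.
move=> t0; have mA := measurable_argmin_time_gt mX cX t0.
have mg s : 0 < s -> measurable (gap X s 0) by exact: (measurable_gap HX).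
apply/eqP; rewrite eq_le; apply/andP; split.
  apply: (pr_modneg nu0 a0 HX) => //; first exact: mg.
  move=> w /= /(argmin_time_gt cX _ (ltW t0))[_ h].
  have [nw|nw] := pselect (goes_negative X w); [by right|left].
  by rewrite /gap/= subr_gt0; apply: glob_inf_lt_run_inf => //; exact: ltW.
apply/ler_addgt0Pr => e e0; have [u u0 hu] := pr_gap0_small e0.
apply: (@le_trans _ _ (pr ([set w | t < argmin_time X w] `|` gap X u 0))).
  apply: (pr_modneg nu0 a0 HX); [exact: mg|by apply: measurableU => //; exact: mg|move=> w gw].
  have [nw|nw] := pselect (goes_negative X w); [by right|left].
  have [gu|gu] := pselect (gap X u 0 w); [by right|left].
  apply/(argmin_time_gt cX _ (ltW t0)); rewrite /gap/= subr_gt0 in gw; split.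
    have [s [s0 su Is _]] := run_inf_attained cX w (ltW u0); exists s => //.
    apply/eqP; rewrite eq_le (ge_glob_inf nw)// andbT Is leNgt; apply/negP => h.
    by apply: gu; rewrite /gap/= subr_gt0.
  move=> s s0 st; rewrite gt_eqF// (lt_le_trans gw)//.
  exact: (le_run_inf cX (run_inf X t w) w (ltW t0)).1.
by apply: (le_trans (prU_le _ _)) => //; [exact: mg|rewrite lerD2l].
Qed.

Lemma tail_gap0 : tail_cst nu c a * Rintegral lebesgue_measure `[0, a]
    (fun u => u `^ (2 * nu - 1) * (u - 0) `^ (2 * nu)) = a `^ (2 * nu) / (2 `^ (nu + 1) * Gamma (nu + 1)).
Proof.
have p4 : 0 < 4 * nu by rewrite mulr_gt0.
have G0 : 0 < Gamma (nu + 1) by exact: Gamma_gt0.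
rewrite Rintegral_oc_cc ?(ltW a0)//; last first.
  apply: measurable_funM; first exact: measurable_powR.
  by apply: (measurableT_comp (@measurable_powR R _)); exact: measurable_funB.
have -> : Rintegral lebesgue_measure `]0, a] (fun u : R => u `^ (2 * nu - 1) * (u - 0) `^ (2 * nu))
   = Rintegral lebesgue_measure `]0, a] (fun u => u `^ (4 * nu - 1)).
  apply: eq_Rintegral => u; rewrite inE/= in_itv/= => /andP[u0 _].
  by rewrite subr0 -powRD ?(gt_eqF u0) ?implybT//; congr (_ `^ _); ring.
rewrite Rintegral_powR ?(ltW a0)// powR0 ?gt_eqF// subr0 /tail_cst /bessel_cst.
have -> : a `^ (4 * nu) = a `^ (2 * nu) * a `^ (2 * nu).
  by rewrite -powRD ?(gt_eqF a0) ?implybT//; congr (_ `^ _); ring.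
have -> : (2 : R) `^ (nu + 1) = 2 `^ nu * 2 by rewrite powRD ?pnatr_eq0 ?implybT// powRr1.
have an := powR_gt0 (2 * nu) a0; have tn : 0 < (2 : R) `^ nu by rewrite powR_gt0.
by field; rewrite !gt_eqF.
Qed.

Theorem cvg_argmin : t `^ nu * pr [set w | t < argmin_time X w] @[t --> +oo] -->
  a `^ (2 * nu) / (2 `^ (nu + 1) * Gamma (nu + 1)).
Proof.
rewrite -tail_gap0; apply: cvg_trans (cvg_gap nu0 a0 HX (lexx 0) (ltW a0)).
apply: near_eq_cvg; near=> t; rewrite pr_argmin_gap.
  by [].
by near: t; apply: nbhs_pinfty_gt; exact: num_real.
Unshelve. all: end_near. Qed.

End Limits2.

(** * Expectations through step functions *)

Lemma step_approx (R : realType) (g : R -> R) (z : nat -> R) (e : R) N : 0 <= e -> nondecreasing_seq z ->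
  (forall i u, (i < N)%N -> z i <= u -> u <= z i.+1 -> `|g (z i) - g u| <= e) ->
  forall x, z 0 <= x -> x <= z N ->
  `|g x - (g (z 0) + \sum_(i < N) (g (z i.+1) - g (z i)) * (z i.+1 <= x)%R%:R)| <= e.
Proof.
move=> e0 ndz gz x zx.
have above n : z n <= x ->
    g (z 0) + \sum_(i < n) (g (z i.+1) - g (z i)) * (z i.+1 <= x)%R%:R = g (z n).
  elim: n => [|n ih] znx; first by rewrite big_ord0 addr0.
  have zz : z n <= z n.+1 by exact: ndz.
  by rewrite big_ord_recr/= addrA ih ?(le_trans zz)// znx mulr1 addrC subrK.
elim: N gz => [|N ih] gz xz.
  have -> : x = z 0 by apply/eqP; rewrite eq_le xz.
  by rewrite big_ord0 addr0 subrr normr0.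
case: (leP (z N.+1) x) => [zNx|xzN].
  by rewrite above//; have -> : x = z N.+1 by [apply/eqP; rewrite eq_le xz]; rewrite subrr normr0.
rewrite big_ord_recr/= [z N.+1 <= x]leNgt xzN mulr0 addr0.
case: (leP x (z N)) => [xN|zN].
  by apply: ih => // i u iN; apply: gz; exact: ltnW.
by rewrite above ?(ltW zN)// distrC; apply: gz => //; exact: ltW.
Qed.

(** The step function errs by at most [e] at each of [x] and [y]. The factor [x < y] is essential:
    in expectation it becomes the probability of a gap, of order [t ^ (- nu)], which absorbs the
    multiplication by [t ^ nu]. *)
Lemma step_diff (R : realType) (g : R -> R) (z : nat -> R) (e : R) N x y : 0 <= e -> nondecreasing_seq z ->
  (forall i u, (i < N)%N -> z i <= u -> u <= z i.+1 -> `|g (z i) - g u| <= e) ->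
  z 0 <= x -> x <= y -> y <= z N ->
  `|g x - g y + \sum_(i < N) (g (z i.+1) - g (z i)) * ((x < z i.+1) && (z i.+1 <= y))%R%:R|
  <= 2 * e * (x < y)%R%:R.
Proof.
move=> e0 ndz gz zx; rewrite le_eqVlt => /predU1P[->|xy] yz.
  rewrite ltxx mulr0 subrr add0r big1 ?normr0// => i _.
  by rewrite ltNge andNb mulr0.
rewrite xy mulr1.
have hx := step_approx e0 ndz gz zx (le_trans (ltW xy) yz).
have hy := step_approx e0 ndz gz (le_trans zx (ltW xy)) yz.
set sx := \sum_(i < N) _ in hx; set sy := \sum_(i < N) _ in hy.
have -> : \sum_(i < N) (g (z i.+1) - g (z i)) * ((x < z i.+1) && (z i.+1 <= y))%R%:R = sy - sx.
  rewrite -sumrB; apply: eq_bigr => i _; rewrite -mulrBr; congr (_ * _).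
  case: (ltP x (z i.+1)) => /= xz; first by rewrite subr0.
  by rewrite (le_trans xz (ltW xy)) subrr.
move: hx hy; rewrite !ler_norml => /andP[h1 h2] /andP[h3 h4].
by apply/andP; split; lra.
Qed.

Lemma summation_by_parts (R : comNzRingType) (g h : nat -> R) N :
  \sum_(i < N) g i * (h i.+1 - h i) = g N * h N - g 0 * h 0 - \sum_(i < N) (g i.+1 - g i) * h i.+1.
Proof.
elim: N => [|N ih]; first by rewrite !big_ord0 subrr subr0.
by rewrite !big_ord_recr/= ih; ring.
Qed.

Section ExpectationLimit.
Variables (R : realType) (nu a : R) (d : measure_display) (T : measurableType d).
Variables (P : probability T R) (X : R -> T -> R).
Hypothesis nu0 : 0 < nu.
Hypothesis a0 : 0 < a.
Hypothesis HX : is_bessel_process P nu a X.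
Implicit Types (t s x y z b : R) (E F : set T).

Let X0 w : X 0 w = a. Proof. by case: HX. Qed.
Let cX w : {within `[0, +oo[%classic, continuous (fun s => X s w)}.
Proof. by case: HX. Qed.
Let mX t : measurable_fun setT (X t). Proof. by case: HX. Qed.
Notation c := (bessel_cst nu).
Let c0 : 0 < c := bessel_cst_gt0 nu0.
Let nu20 : 0 < 2 * nu. Proof. by rewrite mulr_gt0. Qed.
Local Notation pr E := (fine (P E)).
Local Notation en t z := (fine (energy nu P X t (surv X t z))).

Notation D := (~` goes_negative X).

Let mN : measurable (goes_negative X). Proof. exact: (measurable_neg HX). Qed.
Let mD : measurable D. Proof. exact: measurableC. Qed.
Let PD : (P D < +oo)%E. Proof. by rewrite ltey_eq fin_num_measure. Qed.

Lemma pr_setI_nonneg E : measurable E -> pr (E `&` D) = pr E.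
Proof.
move=> mE; have mED : measurable (E `&` D) by exact: measurableI.
apply/eqP; rewrite eq_le (pr_le P mED mE (@subIsetl _ _ _))/=.
by apply: (pr_modneg nu0 a0 HX) => // w Ew; have [nw|nw] := pselect (goes_negative X w); [right|left].
Qed.

Lemma bounded_integrable_nonneg (f : T -> R) (B : R) : measurable_fun setT f ->
  (forall w, D w -> `|f w| <= B) -> P.-integrable D (EFin \o f).
Proof.
move=> mf fB; apply: measurable_bounded_integrable => //; first exact: measurable_funTS.
exists B; split; first exact: num_real.
by move=> M BM w Dw; apply: le_trans (ltW BM); exact: fB.
Qed.

(** The composites of [g] with the infima are known to be bounded on nonnegative paths, where the
    infima lie in [[0, a]]; the complement is null and is removed from the integral. *)
Lemma integral_nonneg (f : T -> R) (B : R) : measurable_fun setT f ->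
  (forall w, D w -> `|f w| <= B) ->
  fine (\int[P]_w (f w)%:E) = Rintegral P D f.
Proof.
move=> mf fB; have PN : P (goes_negative X) = 0 by exact: (prob_hit_neg nu0 a0 HX).
have mE : measurable_fun setT (EFin \o f) by exact/measurable_EFinP.
rewrite (negligible_integral mN measurableT _ PN) ?setTD//.
apply/integrableP; split => //.
rewrite (ge0_negligible_integral mN) ?setTD//; last exact: measurableT_comp.
by have /integrableP[_] := bounded_integrable_nonneg mf fB.
Qed.

Lemma Rintegral_sum_indic N (k : nat -> R) (B : nat -> set T) : (forall i, measurable (B i)) ->
  P.-integrable D (EFin \o (fun w => \sum_(i < N) k i * \1_(B i) w)) /\
  Rintegral P D (fun w => \sum_(i < N) k i * \1_(B i) w) = \sum_(i < N) k i * pr (B i).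
Proof.
move=> mB.
have i1 i : P.-integrable D (EFin \o (\1_(B i) : T -> R)).
  by apply: (integrableS measurableT) => //; exact: integrable_indic.
have ik i : P.-integrable D (EFin \o (fun w => k i * \1_(B i) w)).
  by apply: eq_integrable (integrableZl _ (k i) (i1 i)).
elim: N => [|N [ih1 ih2]].
  have -> : (fun w : T => \sum_(i < 0) k i * \1_(B i) w) = cst 0 by apply/funext => w; rewrite big_ord0.
  by rewrite big_ord0 Rintegral_cst// mul0r; split => //; exact: integrable0.
have -> : (fun w => \sum_(i < N.+1) k i * \1_(B i) w) =
    (fun w => \sum_(i < N) k i * \1_(B i) w + k N * \1_(B N) w) :> (T -> R).
  by apply/funext => w; rewrite big_ord_recr.
split; first by apply: eq_integrable (integrableD _ ih1 (ik N)).
rewrite RintegralD// ih2 big_ord_recr/= RintegralZl//; congr (_ + _ * _).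
by rewrite /Rintegral integral_indic// pr_setI_nonneg.
Qed.

(** Matches the event whose probability is given by [prob_surv_hit] with the indicator in
    [step_diff]. *)
Lemma crossing_event t z w : 0 < t -> D w ->
  (surv X t z `&` hit_ever X t z) w <-> (glob_inf X w < z) && (z <= run_inf X t w).
Proof.
move=> t0 nw; split=> [[/(surv_run_inf HX _ _ t0) zI [s ts Xs]]|/andP[Gz zI]].
  rewrite zI andbT; apply: le_lt_trans Xs; apply: (ge_glob_inf nw).
  exact: le_trans (ltW t0) ts.
split; first exact/(surv_run_inf HX _ _ t0).
have [s s0 Xs] := glob_inf_lt Gz; exists s => //; rewrite leNgt; apply/negP => st.
by have := (le_run_inf cX z w (ltW t0)).1 zI s s0 (ltW st); rewrite leNgt Xs.
Qed.

Lemma inf_bounds t w : 0 < t -> D w ->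
  [/\ 0 <= glob_inf X w, glob_inf X w <= run_inf X t w & run_inf X t w <= a].
Proof.
move=> t0 nw; split; last exact: (run_inf_le HX).
- by rewrite leNgt; apply/negP => /glob_inf_lt.
- have [s [s0 st <- _]] := run_inf_attained cX w (ltW t0); exact: (ge_glob_inf nw).
Qed.

Lemma expectation_step (g : R -> R) N (z : nat -> R) (e t : R) : 0 < t -> 0 <= e -> continuous g ->
  z 0 = 0 -> z N = a -> nondecreasing_seq z ->
  (forall i u, (i < N)%N -> z i <= u -> u <= z i.+1 -> `|g (z i) - g u| <= e) ->
  `|fine (\int[P]_w (g (glob_inf X w))%:E) - fine (\int[P]_w (g (run_inf X t w))%:E) +
    \sum_(i < N) (g (z i.+1) - g (z i)) * (z i.+1 `^ (2 * nu) * en t (z i.+1))|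
  <= 2 * e * pr (gap X t 0).
Proof.
move=> t0 e0 cg z0 zN ndz gz.
have mg := continuous_measurable_fun cg.
have mG : measurable_fun setT (fun w => g (glob_inf X w)).
  by apply: measurableT_comp => //; exact: measurable_glob_inf.
have mI : measurable_fun setT (fun w => g (run_inf X t w)).
  by apply: measurableT_comp => //; exact: measurable_run_inf.
have [B hB] : exists B, forall u, 0 <= u -> u <= a -> `|g u| <= B.
  have /compact_bounded[B [_ hB]] : compact (g @` `[0, a]%classic).
    apply: continuous_compact; last exact: segment_compact.
    exact: continuous_subspaceT.
  exists (B + 1) => u u0 ua; apply: (hB (B + 1)); first by rewrite ltrDl.
  by exists u => //=; rewrite in_itv/= u0.
have bG w : D w -> `|g (glob_inf X w)| <= B.
  by move=> /(inf_bounds t0)[G0 GI Ia]; apply: hB => //; exact: le_trans Ia.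
have bI w : D w -> `|g (run_inf X t w)| <= B.
  by move=> /(inf_bounds t0)[G0 GI Ia]; apply: hB => //; exact: le_trans GI.
pose A i := surv X t (z i.+1) `&` hit_ever X t (z i.+1).
have zp i : 0 <= z i by rewrite -z0; exact: ndz.
have mA i : measurable (A i).
  apply: measurableI; first exact: (measurable_surv nu0 HX).
  by apply: measurable_hit_ever => //; exact: ltW.
have prA i : z i.+1 `^ (2 * nu) * en t (z i.+1) = pr (A i).
  (* At level [0] both sides vanish, as going below [0] is a null event. *)
  have := zp i.+1; rewrite le_eqVlt => /predU1P[zi|zi].
    rewrite -zi powR0 ?gt_eqF// mul0r; apply/eqP; rewrite eq_le fine_ge0//=.
    rewrite -[leRHS](pr_neg nu0 a0 HX); apply: pr_le => // w [_ [s ts]].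
    by rewrite -zi => Xs; exists s => //; exact: le_trans (ltW t0) ts.
  rewrite /A (prob_surv_hit nu0 HX)// fineM//.
  by apply: (energy_fin nu0 a0 HX) => //; exact: (measurable_surv nu0 HX).
rewrite (integral_nonneg mG bG) (integral_nonneg mI bI).
under eq_bigr do rewrite prA.
have iG := bounded_integrable_nonneg mG bG; have iI := bounded_integrable_nonneg mI bI.
have [iS <-] := Rintegral_sum_indic N (fun i => g (z i.+1) - g (z i)) mA.
have iB : P.-integrable D (EFin \o (fun w => g (glob_inf X w) - g (run_inf X t w))).
  by apply: eq_integrable (integrableB _ iG iI).
rewrite -RintegralB// -RintegralD//.
have mgap : measurable (gap X t 0) by exact: (measurable_gap HX).
have i1 : P.-integrable D (EFin \o (\1_(gap X t 0) : T -> R)).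
  by apply: (integrableS measurableT) => //; exact: integrable_indic.
have -> : 2 * e * pr (gap X t 0) = Rintegral P D (fun w => 2 * e * \1_(gap X t 0) w).
  by rewrite RintegralZl// /Rintegral integral_indic// pr_setI_nonneg.
have iT : P.-integrable D (EFin \o (fun w => g (glob_inf X w) - g (run_inf X t w) +
    \sum_(i < N) (g (z i.+1) - g (z i)) * \1_(A i) w)).
  by apply: eq_integrable (integrableD _ iB iS).
apply: (le_trans (le_normr_Rintegral _ _)) => //.
apply: le_Rintegral => //.
- exact: integrable_norm.
- by apply: eq_integrable (integrableZl _ (2 * e) i1).
move=> w Dw; have [G0 GI Ia] := inf_bounds t0 Dw.
have -> : \1_(gap X t 0) w = (glob_inf X w < run_inf X t w)%R%:R :> R.
  by rewrite indicE; congr ((nat_of_bool _)%:R); apply/idP/idP; rewrite inE /gap/= subr_gt0.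
have -> : \sum_(i < N) (g (z i.+1) - g (z i)) * \1_(A i) w =
    \sum_(i < N) (g (z i.+1) - g (z i)) * ((glob_inf X w < z i.+1) && (z i.+1 <= run_inf X t w))%R%:R.
  apply: eq_bigr => i _; rewrite indicE; congr (_ * (nat_of_bool _)%:R).
  by apply/idP/idP; rewrite inE => /(crossing_event _ t0 Dw).
by apply: step_diff => //; rewrite ?z0 ?zN.
Qed.

Theorem cvg_expectation (g : R -> R) : continuous g ->
  t `^ nu * (fine (\int[P]_w (g (glob_inf X w))%:E) - fine (\int[P]_w (g (run_inf X t w))%:E))
    @[t --> +oo] -->
  tail_cst nu c a * Rintegral lebesgue_measure `[0, a]
    (fun u => (a `^ (2 * nu) - 2 * u `^ (2 * nu)) * u `^ (2 * nu - 1) * g u).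
Proof.
move=> cg; set J := tail_cst _ _ _ * _; apply/cvgrPdist_le => eps eps0.
have [K K0 nK] := gap0_bound nu0 a0 HX.
(* Collects three errors, in units of [e]: [1] for the finite sum at time [t], [2 K] for the step
   function, [c a ^ (2 nu)] for the Stieltjes sum. *)
pose M := 1 + (2 * K + c * a `^ (2 * nu)).
have M0 : 0 < M by rewrite !addr_gt0 ?mulr_gt0 ?powR_gt0.
pose e := eps / M; have e0 : 0 < e by rewrite divr_gt0.
have eM : e * (c * a `^ (2 * nu)) + (e + e * (2 * K)) = eps.
  have -> : e * (c * a `^ (2 * nu)) + (e + e * (2 * K)) = e * M by rewrite /M; ring.
  by rewrite divfK ?gt_eqF.
have [N [z [z0 zN ndz gz]]] := uniform_partition a0 cg e0.
have zp i : 0 <= z i by rewrite -z0; exact: ndz.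
have zle i : (i < N)%N -> z i.+1 <= a by move=> iN; rewrite -zN; exact: ndz.
pose h := hit_tail nu c a \o z.
pose S := \sum_(i < N) (g (z i.+1) - g (z i)) * h i.+1.
(* There is no boundary term, since [hit_tail] vanishes at [0] and [a]. *)
have SE : \sum_(i < N) g (z i) * (h i.+1 - h i) = - S.
  rewrite (summation_by_parts (g \o z)) /h/= z0 zN /hit_tail/tail_fun powR0 ?gt_eqF//.
  by rewrite divff ?gt_eqF// powR1 subrr !(mulr0, mul0r) subrr sub0r.
have SJ := hit_tail_stieltjes nu0 c0 a0 z0 zN ndz cg gz.
have cvS : \sum_(i < N) (g (z i.+1) - g (z i)) * (z i.+1 `^ (2 * nu) * (t `^ nu * en t (z i.+1)))
    @[t --> +oo] --> S.
  apply: (@cvg_sum_ord _ _ _ _ (fun i t => (g (z i.+1) - g (z i)) * (z i.+1 `^ (2 * nu) * (t `^ nu * en t (z i.+1))))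
    (fun i => (g (z i.+1) - g (z i)) * h i.+1)) => i iN.
  apply: cvgM; first exact: cvg_cst; apply: cvgM; first exact: cvg_cst.
  by apply: (cvg_en nu0 a0 HX) => //; exact: zle.
(* Here [p] is the limit, [q] the quantity at time [t], [u] the limit sum and [v] the sum at time
   [t]. *)
have decomp (p q u v : R) : p - q = - (- u - p) + (- (u - v) + - (q + v)) by ring.
have /cvgrPdist_le/(_ e e0) nS := cvS.
near=> t; have t0 : 0 < t by near: t; apply: nbhs_pinfty_gt; exact: num_real.
have h1 : `|S - \sum_(i < N) (g (z i.+1) - g (z i)) * (z i.+1 `^ (2 * nu) * (t `^ nu * en t (z i.+1)))| <= e.
  by near: t.
have h2 : t `^ nu * pr (gap X t 0) <= K by near: t.
have h3 := expectation_step t0 (ltW e0) cg z0 zN ndz gz.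
set St := \sum_(i < N) _ in h1; set Dt := fine _ - fine _ in h3 *.
have tn := powR_gt0 nu t0.
have {}h3 : `|t `^ nu * Dt + St| <= e * (2 * K).
  have -> : t `^ nu * Dt + St = t `^ nu * (Dt + \sum_(i < N) (g (z i.+1) - g (z i)) * (z i.+1 `^ (2 * nu) * en t (z i.+1))).
    rewrite [RHS]mulrDr; congr (_ + _); rewrite mulr_sumr; apply: eq_bigr => i _.
    by rewrite [RHS]mulrCA; congr (_ * _); exact: mulrCA.
  rewrite normrM gtr0_norm//; apply: (le_trans (ler_wpM2l (ltW tn) h3)).
  rewrite mulrCA (mulrC 2) -mulrA; apply: ler_wpM2l; first exact: ltW.
  by rewrite ler_wpM2l.
rewrite SE in SJ.
rewrite (decomp J _ S St).
rewrite -eM.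
apply: (le_trans (ler_normD _ _)); rewrite normrN; apply: lerD => //.
by apply: (le_trans (ler_normD _ _)); rewrite !normrN; apply: lerD.
Unshelve. all: end_near. Qed.

End ExpectationLimit.

Theorem theorem2p2 (R : realType) (d : measure_display) (T : measurableType d)
    (P : probability T R) (nu a : R) (X : R -> T -> R) :
  0 < nu -> 0 < a -> is_bessel_process P nu a X ->
  let C := 2 * nu / (2 `^ nu * a `^ (2 * nu) * Gamma (nu + 1)) in
  [/\ (forall b : R, 0 <= b <= a ->
         (fun t => t `^ nu * fine (P [set w | run_inf X t w - glob_inf X w > b]))
           @ +oo --> C * Rintegral lebesgue_measure `[b, a]
                         (fun z => z `^ (2 * nu - 1) * (z - b) `^ (2 * nu))),
      (fun t => t `^ nu * fine (P [set w | argmin_time X w > t]))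
         @ +oo --> a `^ (2 * nu) / (2 `^ (nu + 1) * Gamma (nu + 1)) &
      (forall g : R -> R, continuous g ->
         (fun t => t `^ nu *
            (fine (\int[P]_w (g (glob_inf X w))%:E)
             - fine (\int[P]_w (g (run_inf X t w))%:E)))
           @ +oo --> C * Rintegral lebesgue_measure `[0, a]
                         (fun z => (a `^ (2 * nu) - 2 * z `^ (2 * nu)) * z `^ (2 * nu - 1) * g z))].
Proof.
move=> nu0 a0 HX C.
have -> : C = tail_cst nu (bessel_cst nu) a.
  have an := powR_gt0 (2 * nu) a0; have tn : 0 < (2 : R) `^ nu by rewrite powR_gt0.
  have G0 := Gamma_gt0 nu0.
  by rewrite /C /tail_cst /bessel_cst; field; rewrite !gt_eqF.
split.
- by move=> b /andP[b0 ba]; exact: (cvg_gap nu0 a0 HX b0 ba).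
- exact: (cvg_argmin nu0 a0 HX).
- by move=> g cg; exact: (cvg_expectation nu0 a0 HX cg).
Qed.
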